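(* Let $T>0$, let $k,d,m$ be positive integers and $\mathcal J=\{1,\dots,m\}$. Let $b:[0,T]\times\mathbb R^k\to\mathbb R^k$ and $\sigma:[0,T]\times\mathbb R^k\to\mathbb R^{k\times d}$ be jointly continuous with $|b(t,x)|+|\sigma(t,x)|\le C(1+|x|)$ and $|b(t,x)-b(t,x')|+|\sigma(t,x)-\sigma(t,x')|\le C|x-x'|$ for some constant $C\ge 0$ and all $t\in[0,T]$, $x,x'\in\mathbb R^k$. Assume that for every $i\in\mathcal J$ the function $f_i:[0,T]\times\mathbb R^{k}\times\mathbb R^m\times\mathbb R^d\to\mathbb R$, $(t,x,y^1,\dots,y^m,z)\mapsto f_i(t,x,y^1,\dots,y^m,z)$, satisfies: (1) $(t,x)\mapsto f_i(t,x,y^1,\dots,y^m,z)$ is continuous uniformly with respect to $(y^1,\dots,y^m,z)$; (2) for some $C\ge0$ and all arguments, $|f_i(t,x,y^1,\dots,y^m,z)-f_i(t,x,\bar y^1,\dots,\bar y^m,\bar z)|\le C(|y^1-\bar y^1|+\dots+|y^m-\bar y^m|+|z-\bar z|)$; (3) $(t,x)\mapsto f_i(t,x,0,\dots,0)$ is Borel measurable and of polynomial growth; (4) for every $l\in\mathcal J\setminus\{i\}$, $y^l\mapsto -f_i(t,x,y^1,\dots,y^m,z)$ is non-decreasing when all other arguments are fixed (i.e. $f_i$ is non-increasing in $y^l$). Assume that for all $i\ne j$ in $\mathcal J$ the function $g_{ij}:[0,T]\times\mathbb R^k\to\mathbb R$ is continuous, non-negative and of polynomial growth, and that for every $(t,x)\in[0,T]\times\mathbb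 R^k$ and every finite sequence $i_1,\dots,i_N\in\mathcal J$ with $N\ge3$, $i_1=i_N$ and $\mathrm{card}\{i_1,\dots,i_N\}=N-1$ one has $g_{i_1i_2}(t,x)+\dots+g_{i_{N-1}i_N}(t,x)>0$. Assume that every $h_i:\mathbb R^k\to\mathbb R$ is continuous, of polynomial growth, and $h_i(x)\ge\max_{j\in\mathcal J\setminus\{i\}}(h_j(x)-g_{ij}(T,x))$ for all $x\in\mathbb R^k$. Then the system: for all $i\in\mathcal J$, $$\min\Big\{v_i(t,x)-\max_{j\in\mathcal J\setminus\{i\}}(v_j(t,x)-g_{ij}(t,x));\ -\partial_tv_i(t,x)-\mathcal Lv_i(t,x)-f_i(t,x,v_1(t,x),\dots,v_m(t,x),\sigma^\top(t,x)D_xv_i(t,x))\Big\}=0,\qquad v_i(T,x)=h_i(x),$$ has a continuous viscosity solution $(v_1,\dots,v_m)$ with components of polynomial growth.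
   Context: $\mathcal L\varphi(t,x)=\frac12\mathrm{Tr}[(\sigma\sigma^\top)(t,x)D^2_{xx}\varphi(t,x)]+b(t,x)^\top D_x\varphi(t,x)$. A function $\phi$ is of polynomial growth if $|\phi(t,x)|\le C(1+|x|^\gamma)$ (resp. $|\phi(x)|\le C(1+|x|^\gamma)$) for some constants $C,\gamma\ge0$. A maximum over the empty set is read as $-\infty$. Jets. For $u:[0,T]\times\mathbb R^k\to\mathbb R$ lower (resp. upper) semicontinuous, the parabolic subjet $J^-u(t,x)$ (resp. superjet $J^+u(t,x)$) is the set of triples $(p,q,M)\in\mathbb R\times\mathbb R^k\times\mathbb S^k$ ($\mathbb S^k$ = symmetric real $k\times k$ matrices) with $u(t',x')\ge$ (resp. $\le$) $u(t,x)+p(t'-t)+\langle q,x'-x\rangle+\frac12\langle x'-x,M(x'-x)\rangle+o(|t'-t|+|x'-x|^2)$ as $(t',x')\to(t,x)$ in $[0,T]\times\mathbb R^k$. The limiting subjet $\bar J^-u(t,x)$ (resp. limiting superjet $\bar J^+u(t,x)$) is the set of limits $(p,q,M)=\lim_n(p_n,q_n,M_n)$ with $(p_n,q_n,M_n)\in J^-u(t_n,x_n)$ (resp. $J^+u(t_n,x_n)$), $(t_n,x_n)\to(t,x)$ and $u(t_n,x_n)\to u(t,x)$. Viscosity solutions. $(v_i)_{i\in\mathcal J}$ with every $v_i$ lower (resp. upper) semicontinuous on $[0,T]\times\mathbb R^k$ is a viscosity supersolution (resp. subsolution) of the system if for every $i\in\mathcal J$, every $(t,x)\in[0,T)\times\mathbb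 R^k$ and every $(p,q,M)\in\bar J^-v_i(t,x)$ (resp. $\bar J^+v_i(t,x)$), $$\min\Big\{v_i(t,x)-\max_{j\in\mathcal J\setminus\{i\}}(v_j(t,x)-g_{ij}(t,x));\ -p-b(t,x)^\top q-\tfrac12\mathrm{Tr}[(\sigma\sigma^\top)(t,x)M]-f_i(t,x,v_1(t,x),\dots,v_m(t,x),\sigma(t,x)^\top q)\Big\}\ge0\ (\text{resp. }\le0),$$ and $v_i(T,x)\ge h_i(x)$ (resp. $\le h_i(x)$) for all $x\in\mathbb R^k$. A tuple of continuous functions is a viscosity solution if it is both a viscosity supersolution and a viscosity subsolution. *)

(* Defs.v *)
From mathcomp Require Export all_boot all_order all_algebra.
From mathcomp Require Export all_classical all_reals all_analysis.
Set Implicit Arguments.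
Unset Strict Implicit.
Unset Printing Implicit Defensive.
Import Order.TTheory GRing.Theory Num.Theory.
Import numFieldNormedType.Exports.
Local Open Scope classical_set_scope.
Local Open Scope ring_scope.

(* Functions on [0,T] x R^k are total functions on R * 'cV[R]_k of which only
   the values on [strip T] are ever constrained or used. *)
Definition strip (R : realType) (k : nat) (T : R) : set (R * 'cV[R]_k) :=
  `[0, T] `*` setT.
Arguments strip {R k} T.

(* Euclidean norm of a vector, Frobenius norm of a matrix; the library norm on
   'M[R]_(a, b) is the sup norm. *)
Definition enorm (R : realType) (a b : nat) (A : 'M[R]_(a, b)) : R :=
  Num.sqrt (\sum_i \sum_j A i j ^+ 2).

Definition dotv (R : realType) (k : nat) (u v : 'cV[R]_k) : R :=
  \sum_i u i 0 * v i 0.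

Definition poly_growth (R : realType) (k : nat) (h : 'cV[R]_k -> R) : Prop :=
  exists C gamma : R, [/\ 0 <= C, 0 <= gamma &
    forall x, `|h x| <= C * (1 + enorm x `^ gamma)].

Definition poly_growth_strip (R : realType) (k : nat) (T : R)
    (phi : R * 'cV[R]_k -> R) : Prop :=
  exists C gamma : R, [/\ 0 <= C, 0 <= gamma &
    forall t x, 0 <= t <= T -> `|phi (t, x)| <= C * (1 + enorm x `^ gamma)].

(* Measurability on [0,T] x R^k for the Borel sigma-algebra of R x R^k, i.e. the
   one generated by the open sets of the product topology. *)
Definition borel_measurable_strip (R : realType) (k : nat) (T : R)
    (phi : R * 'cV[R]_k -> R) : Prop :=
  @measurable_fun _ _ (g_sigma_algebraType (@open (R * 'cV[R]_k)%type)) R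
    (strip T) phi.

Definition lsc_strip (R : realType) (k : nat) (T : R)
    (u : R * 'cV[R]_k -> R) : Prop :=
  @lower_semicontinuous (subspace (@strip R k T)) R (fun tx => (u tx)%:E).

Definition usc_strip (R : realType) (k : nat) (T : R)
    (u : R * 'cV[R]_k -> R) : Prop :=
  lsc_strip T (fun tx => - u tx).

Definition jet_expansion (R : realType) (k : nat) (u : R * 'cV[R]_k -> R)
    (t : R) (x : 'cV[R]_k) (p : R) (q : 'cV[R]_k) (M : 'M[R]_k)
    (t' : R) (x' : 'cV[R]_k) : R :=
  u (t, x) + p * (t' - t) + dotv q (x' - x)
  + 2^-1 * dotv (x' - x) (M *m (x' - x)).

(* (p, q, M) \in J^- u(t,x); the one-sided o(...) is spelled out. *)
Definition subjet (R : realType) (k : nat) (T : R) (u : R * 'cV[R]_k -> R)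
    (t : R) (x : 'cV[R]_k) (p : R) (q : 'cV[R]_k) (M : 'M[R]_k) : Prop :=
  [/\ 0 <= t <= T, M^T = M &
    forall e : R, 0 < e -> \forall tx' \near within (strip T) (nbhs (t, x)),
      jet_expansion u t x p q M tx'.1 tx'.2
        - e * (`|tx'.1 - t| + enorm (tx'.2 - x) ^+ 2) <= u tx'].

Definition superjet (R : realType) (k : nat) (T : R) (u : R * 'cV[R]_k -> R)
    (t : R) (x : 'cV[R]_k) (p : R) (q : 'cV[R]_k) (M : 'M[R]_k) : Prop :=
  [/\ 0 <= t <= T, M^T = M &
    forall e : R, 0 < e -> \forall tx' \near within (strip T) (nbhs (t, x)),
      u tx' <= jet_expansion u t x p q M tx'.1 tx'.2
        + e * (`|tx'.1 - t| + enorm (tx'.2 - x) ^+ 2)].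

(* Closure of a family of jets [J t x p q M], along points at which the values
   of u converge too. *)
Definition limiting_jet (R : realType) (k : nat) (u : R * 'cV[R]_k -> R)
    (J : R -> 'cV[R]_k -> R -> 'cV[R]_k -> 'M[R]_k -> Prop)
    (t : R) (x : 'cV[R]_k) (p : R) (q : 'cV[R]_k) (M : 'M[R]_k) : Prop :=
  exists (t_ : nat -> R) (x_ : nat -> 'cV[R]_k)
         (p_ : nat -> R) (q_ : nat -> 'cV[R]_k) (M_ : nat -> 'M[R]_k),
    (forall n, J (t_ n) (x_ n) (p_ n) (q_ n) (M_ n)) /\
    [/\ t_ n @[n --> \oo] --> t, x_ n @[n --> \oo] --> x &
        u (t_ n, x_ n) @[n --> \oo] --> u (t, x)] /\
    [/\ p_ n @[n --> \oo] --> p, q_ n @[n --> \oo] --> q &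
        M_ n @[n --> \oo] --> M].

Definition limiting_subjet (R : realType) (k : nat) (T : R)
    (u : R * 'cV[R]_k -> R) :=
  limiting_jet u (subjet T u).

Definition limiting_superjet (R : realType) (k : nat) (T : R)
    (u : R * 'cV[R]_k -> R) :=
  limiting_jet u (superjet T u).

(* max_(j != i) (y_j - c_j), equal to -oo when there is no j != i. *)
Definition obstacle (R : realType) (m : nat) (i : 'I_m) (y c : 'I_m -> R)
    : \bar R :=
  \big[maxe/-oo%E]_(j < m | j != i) (y j - c j)%:E.

(* The left-hand side of the i-th equation at (t,x), with (p, q, M) in place of
   the derivatives (d_t v_i, D_x v_i, D^2_xx v_i). *)
Definition system_lhs (R : realType) (k d m : nat)
    (b : R * 'cV[R]_k -> 'cV[R]_k) (sigma : R * 'cV[R]_k -> 'M[R]_(k, d))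
    (f : 'I_m -> R * 'cV[R]_k -> 'cV[R]_m -> 'cV[R]_d -> R)
    (g : 'I_m -> 'I_m -> R * 'cV[R]_k -> R)
    (v : 'I_m -> R * 'cV[R]_k -> R) (i : 'I_m) (tx : R * 'cV[R]_k)
    (p : R) (q : 'cV[R]_k) (M : 'M[R]_k) : \bar R :=
  mine ((v i tx)%:E - obstacle i (fun j => v j tx) (fun j => g i j tx))%E
       (- p - dotv (b tx) q - 2^-1 * \tr (sigma tx *m (sigma tx)^T *m M)
        - f i tx (\col_j v j tx) ((sigma tx)^T *m q))%:E.

Definition viscosity_supersolution (R : realType) (k d m : nat) (T : R)
    (b : R * 'cV[R]_k -> 'cV[R]_k) (sigma : R * 'cV[R]_k -> 'M[R]_(k, d))
    (f : 'I_m -> R * 'cV[R]_k -> 'cV[R]_m -> 'cV[R]_d -> R)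
    (g : 'I_m -> 'I_m -> R * 'cV[R]_k -> R) (h : 'I_m -> 'cV[R]_k -> R)
    (v : 'I_m -> R * 'cV[R]_k -> R) : Prop :=
  [/\ forall i, lsc_strip T (v i),
      forall i t x p q M, 0 <= t < T -> limiting_subjet T (v i) t x p q M ->
        (0 <= system_lhs b sigma f g v i (t, x) p q M)%E &
      forall i x, h i x <= v i (T, x)].

Definition viscosity_subsolution (R : realType) (k d m : nat) (T : R)
    (b : R * 'cV[R]_k -> 'cV[R]_k) (sigma : R * 'cV[R]_k -> 'M[R]_(k, d))
    (f : 'I_m -> R * 'cV[R]_k -> 'cV[R]_m -> 'cV[R]_d -> R)
    (g : 'I_m -> 'I_m -> R * 'cV[R]_k -> R) (h : 'I_m -> 'cV[R]_k -> R)
    (v : 'I_m -> R * 'cV[R]_k -> R) : Prop :=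
  [/\ forall i, usc_strip T (v i),
      forall i t x p q M, 0 <= t < T -> limiting_superjet T (v i) t x p q M ->
        (system_lhs b sigma f g v i (t, x) p q M <= 0)%E &
      forall i x, v i (T, x) <= h i x].

Definition viscosity_solution (R : realType) (k d m : nat) (T : R)
    (b : R * 'cV[R]_k -> 'cV[R]_k) (sigma : R * 'cV[R]_k -> 'M[R]_(k, d))
    (f : 'I_m -> R * 'cV[R]_k -> 'cV[R]_m -> 'cV[R]_d -> R)
    (g : 'I_m -> 'I_m -> R * 'cV[R]_k -> R) (h : 'I_m -> 'cV[R]_k -> R)
    (v : 'I_m -> R * 'cV[R]_k -> R) : Prop :=
  [/\ forall i, {within strip T, continuous (v i)},
      viscosity_supersolution T b sigma f g h v &
      viscosity_subsolution T b sigma f g h v].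

(* Every cyclic switching sequence i_1, ..., i_N = i_1 without other repetition
   has positive total cost at every point of [0,T] x R^k. Only c 1, ..., c N are
   used. *)
Definition no_free_loop (R : realType) (k m : nat) (T : R)
    (g : 'I_m -> 'I_m -> R * 'cV[R]_k -> R) : Prop :=
  forall tx, strip T tx -> forall (N : nat) (c : nat -> 'I_m),
    (3 <= N)%N -> c 1%N = c N ->
    #|[set c n.+1 | n : 'I_N]%SET| = (N - 1)%N ->
    0 < \sum_(1 <= n < N) g (c n) (c n.+1) tx.

(* Main.v *)
(* The solution is a limit of explicit monotone schemes. With time step [dt] and a noise [xi] uniform
   on the [2 d] vectors [+/- sqrt d e_a], one step replaces [u_i] by the largest of
   [E u_j(x + b dt + sqrt dt sigma xi) + dt f_j(x, u, Z_j) - g_ij], where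
   [Z_j = E[u_j(..) xi] / sqrt dt] and [g_ii = 0].

   The bound [|u| <= B (1 + |x|^2)^p] is uniform in [dt], and so is equicontinuity, by doubling of the
   variables. The difficulty there is that each switch costs the modulus of continuity of [g_ij],
   while the number of switches is not under control. So [u_i] is first tilted into
   [u_i + theta ((u_i + V)^2 - chi_i)]. Here [chi_i] is [eta] times the rank of [i] for the relation
   "[i] switches cheaply to [j]", which has no cycle because there are no free loops; an
   inf-convolution in [(t, x)] makes [chi_i] semiconcave, hence harmless in a step without switch.
   Each switch gains at least [theta eta / 2], which pays for the modulus of [g_ij], and the variance
   created by the square pays for the terms in [Z].

   A limit along an ultrafilter of step numbers is then locally uniform. Monotonicity of the scheme
   and an approximate minimum of [v_i] minus a paraboloid give the viscosity inequalities. *)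
Require Import Defs.
From mathcomp Require Import ring lra.
Import Order.TTheory GRing.Theory Num.Theory.
Import numFieldNormedType.Exports.
Local Open Scope classical_set_scope.
Local Open Scope ring_scope.
Set Implicit Arguments.
Unset Strict Implicit.
Unset Printing Implicit Defensive.

(** * Dot product and squared Frobenius norm, polynomial in the entries *)

Section VectorAlgebra.
Context {R : realType}.

(** A Lipschitz term [C * enorm Z] is neither small nor of one sign, but it equals [dotv b Z] for
    some [b] of norm at most [C], and adding [dt * dotv b Z] to a mean only changes the uniform
    weights into [wt dt b]. These are non-negative once [dt * d * C^2 <= 1], so monotonicity always
    means a mean against such weights.

    In the doubling, the square has a second use: on the range of the scheme [(a + V)^2] has slope
    at least 1, so a switch of cost [g] gains [theta * g] by itself. The potential may then satisfy
    only [chi_j - chi_i <= g_ij - eta], and its ranks have to order the cheap switches alone.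

    The estimate is two-sided: the generators see the absolute differences of all components, so the
    bound with the first copy tilted and the bound with the second copy tilted are propagated
    together.

    Equicontinuity in time comes from the same estimate as in space, by comparing the scheme with a
    copy of itself that first rests at [h] for some steps. *)

Definition frob (a b : nat) (A : 'M[R]_(a, b)) : R := \sum_i \sum_j A i j ^+ 2.

Lemma frob_ge0 a b (A : 'M[R]_(a, b)) : 0 <= frob A.
Proof. by apply: sumr_ge0 => i _; apply: sumr_ge0 => j _; exact: sqr_ge0. Qed.

Lemma enorm_sqr a b (A : 'M[R]_(a, b)) : enorm A ^+ 2 = frob A.
Proof. by rewrite sqr_sqrtr // frob_ge0. Qed.

Lemma enorm_ge0 a b (A : 'M[R]_(a, b)) : 0 <= enorm A.
Proof. exact: sqrtr_ge0. Qed.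

Lemma frob0 a b : frob (0 : 'M[R]_(a, b)) = 0.
Proof. by apply: big1 => i _; apply: big1 => j _; rewrite mxE expr0n. Qed.

Lemma enorm0 a b : enorm (0 : 'M[R]_(a, b)) = 0.
Proof. by rewrite /enorm -/(frob _) frob0 sqrtr0. Qed.

Lemma frobN a b (A : 'M[R]_(a, b)) : frob (- A) = frob A.
Proof. by apply: eq_bigr => i _; apply: eq_bigr => j _; rewrite mxE sqrrN. Qed.

Lemma frobB_sym a b (A B : 'M[R]_(a, b)) : frob (A - B) = frob (B - A).
Proof. by rewrite -frobN opprB. Qed.

Lemma frobZ a b c (A : 'M[R]_(a, b)) : frob (c *: A) = c ^+ 2 * frob A.
Proof.
rewrite mulr_sumr; apply: eq_bigr => i _; rewrite mulr_sumr; apply: eq_bigr => j _.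
by rewrite mxE exprMn.
Qed.

Lemma frobD_le a b (A B : 'M[R]_(a, b)) : frob (A + B) <= 2 * frob A + 2 * frob B.
Proof.
rewrite !mulr_sumr -big_split; apply: ler_sum => i _ /=.
rewrite !mulr_sumr -big_split; apply: ler_sum => j _ /=.
rewrite mxE; have := sqr_ge0 (A i j - B i j); lra.
Qed.

Lemma frob_tr a b (A : 'M[R]_(a, b)) : frob A^T = frob A.
Proof.
rewrite /frob exchange_big; apply: eq_bigr => i _; apply: eq_bigr => j _.
by rewrite mxE.
Qed.

Lemma coord_frob a b (A : 'M[R]_(a, b)) i j : A i j ^+ 2 <= frob A.
Proof.
rewrite /frob (bigD1 i) //= (bigD1 j) //= -addrA lerDl addr_ge0 //.
  by apply: sumr_ge0 => ? _; exact: sqr_ge0.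
by apply: sumr_ge0 => ? _; apply: sumr_ge0 => ? _; exact: sqr_ge0.
Qed.

Lemma frob_coord_le a b (A : 'M[R]_(a, b)) e :
  (forall i j, A i j ^+ 2 <= e) -> frob A <= a%:R * b%:R * e.
Proof.
move=> H; rewrite /frob.
apply: (le_trans (y := \sum_(i < a) \sum_(j < b) e)).
  by apply: ler_sum => i _; apply: ler_sum.
by rewrite !sumr_const !card_ord -mulrnA mulnC -[e *+ _]mulr_natl natrM.
Qed.

Section Dot.
Variable k : nat.
Implicit Types u v w : 'cV[R]_k.

Lemma dotvC u v : dotv u v = dotv v u.
Proof. by apply: eq_bigr => i _; rewrite mulrC. Qed.

Lemma dotvDl u v w : dotv (u + v) w = dotv u w + dotv v w.
Proof. by rewrite /dotv -big_split; apply: eq_bigr => i _; rewrite mxE mulrDl. Qed.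

Lemma dotvDr u v w : dotv w (u + v) = dotv w u + dotv w v.
Proof. by rewrite dotvC dotvDl !(dotvC w). Qed.

Lemma dotvZl c u v : dotv (c *: u) v = c * dotv u v.
Proof. by rewrite /dotv mulr_sumr; apply: eq_bigr => i _; rewrite mxE mulrA. Qed.

Lemma dotvZr c u v : dotv u (c *: v) = c * dotv u v.
Proof. by rewrite dotvC dotvZl dotvC. Qed.

Lemma dotvNl u v : dotv (- u) v = - dotv u v.
Proof. by rewrite -scaleN1r dotvZl mulN1r. Qed.

Lemma dotvNr u v : dotv u (- v) = - dotv u v.
Proof. by rewrite dotvC dotvNl dotvC. Qed.

Lemma dotv0l v : dotv 0 v = 0.
Proof. by rewrite -(scale0r v) dotvZl mul0r. Qed.

Lemma dotv0r v : dotv v 0 = 0.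
Proof. by rewrite dotvC dotv0l. Qed.

Lemma dotvv v : dotv v v = frob v.
Proof. by apply: eq_bigr => i _; rewrite big_ord1 expr2. Qed.

Lemma frobD u v : frob (u + v) = frob u + 2 * dotv u v + frob v.
Proof. rewrite -!dotvv dotvDl !dotvDr (dotvC v u); ring. Qed.

Lemma dotv_le2 u v : 2 * dotv u v <= frob u + frob v.
Proof.
have := frob_ge0 (u - v); rewrite frobD dotvNr frobN; lra.
Qed.

Lemma cauchy_dotv u v : dotv u v ^+ 2 <= frob u * frob v.
Proof.
have [u0|un0] := eqVneq (frob u) 0.
  have -> : u = 0.
    apply/matrixP => i j; rewrite mxE; apply/eqP.
    by rewrite -sqrf_eq0 eq_le sqr_ge0 andbT -u0 coord_frob.
  by rewrite dotv0l frob0 expr0n mul0r.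
have u_gt0 : 0 < frob u by rewrite lt_def un0 frob_ge0.
(* This squared norm is [frob u] times the defect of the inequality. *)
have := frob_ge0 (frob u *: v - dotv u v *: u).
rewrite frobD frobN !frobZ dotvNr dotvZl dotvZr (dotvC v u) => H.
have : 0 <= frob u * (frob u * frob v - dotv u v ^+ 2).
  by apply: le_trans H _; rewrite le_eqVlt; apply/orP; left; apply/eqP; ring.
by rewrite pmulr_rge0 // subr_ge0.
Qed.

Lemma dotv_delta v i : dotv v (delta_mx i 0) = v i 0.
Proof.
rewrite /dotv (bigD1 i) //= big1 ?addr0; first by rewrite !mxE !eqxx mulr1.
by move=> j ji; rewrite !mxE (negbTE ji) mulr0.
Qed.

End Dot.

Lemma dotv_mulmx k d (A : 'M[R]_(k, d)) (u : 'cV_k) (v : 'cV_d) :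
  dotv u (A *m v) = dotv (A^T *m u) v.
Proof.
rewrite /dotv; under eq_bigr do rewrite mxE mulr_sumr.
under [RHS]eq_bigr do rewrite mxE mulr_suml.
rewrite exchange_big; apply: eq_bigr => i _; apply: eq_bigr => j _.
by rewrite !mxE; ring.
Qed.

Lemma frob_mulmx k d (A : 'M[R]_(k, d)) (v : 'cV_d) : frob (A *m v) <= frob A * frob v.
Proof.
rewrite -dotvv /dotv /frob mulr_suml; apply: ler_sum => i _.
rewrite -expr2 -/(frob v).
have -> : (A *m v) i 0 = dotv (row i A)^T v.
  by rewrite mxE; apply: eq_bigr => j _; rewrite !mxE.
apply: le_trans (cauchy_dotv _ _) _.
rewrite ler_wpM2r ?frob_ge0 // frob_tr /frob big_ord1.
by under eq_bigr do rewrite mxE.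
Qed.

(* Turns a Lipschitz error in [Z] into a change [wt] of the noise weights. *)
Lemma enorm_linear k (z : 'cV[R]_k) (C : R) : 0 <= C ->
  exists2 b : 'cV[R]_k, frob b <= C ^+ 2 & C * enorm z = dotv b z.
Proof.
move=> C0; have [z0|zn0] := eqVneq (enorm z) 0.
  exists 0; first by rewrite frob0 sqr_ge0.
  by rewrite z0 mulr0 dotv0l.
exists ((C / enorm z) *: z).
  by rewrite frobZ -enorm_sqr -exprMn mulfVK.
by rewrite dotvZl dotvv -enorm_sqr expr2 mulrA mulfVK.
Qed.

End VectorAlgebra.

(** * A symmetric finite noise with identity covariance *)

Section Noise.
Context {R : realType} {d : nat}.
Hypothesis d_gt0 : (0 < d)%N.

Definition mean (phi : 'I_d * bool -> R) : R := (2 * d%:R)^-1 * \sum_w phi w.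

(** The factor [sqrt d] compensates for the choice of one axis out of [d], so that the covariance is
    the identity. The finite support makes every expectation a finite sum and the noise bounded. *)
Definition xi (w : 'I_d * bool) : 'cV[R]_d :=
  ((if w.2 then 1 else -1) * Num.sqrt d%:R) *: delta_mx w.1 0.

Let dR : (d%:R : R) != 0. Proof. by rewrite pnatr_eq0 -lt0n. Qed.

Lemma meanE phi : mean phi = (2 * d%:R)^-1 * \sum_i (phi (i, true) + phi (i, false)).
Proof.
rewrite /mean; congr (_ * _).
transitivity (\sum_i \sum_s phi (i, s)); last by apply: eq_bigr => i _; rewrite big_bool.
by rewrite pair_bigA; apply: eq_bigr => -[].
Qed.

Lemma mean_cst c : mean (fun=> c) = c.
Proof.
rewrite meanE sumr_const card_ord -mulr_natl; field; exact: dR.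
Qed.

Lemma meanD f g : mean (fun w => f w + g w) = mean f + mean g.
Proof. by rewrite /mean big_split mulrDr. Qed.

Lemma meanZ c f : mean (fun w => c * f w) = c * mean f.
Proof. by rewrite /mean -mulr_sumr mulrCA. Qed.

Lemma meanN f : mean (fun w => - f w) = - mean f.
Proof. by rewrite -mulN1r -meanZ; congr mean; apply/funext => w; rewrite mulN1r. Qed.

Lemma meanB f g : mean (fun w => f w - g w) = mean f - mean g.
Proof. by rewrite meanD meanN. Qed.

Lemma mean_le f g : (forall w, f w <= g w) -> mean f <= mean g.
Proof.
by move=> H; rewrite ler_wpM2l ?invr_ge0 ?mulr_ge0 // ler_sum.
Qed.

Lemma eq_mean f g : f =1 g -> mean f = mean g.
Proof. by move=> /funext ->. Qed.

Lemma dotv_xi v w :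
  dotv v (xi w) = (if w.2 then 1 else -1) * Num.sqrt d%:R * v w.1 0.
Proof. by rewrite /xi dotvZr dotv_delta. Qed.

Lemma mean_xi v : mean (fun w => dotv v (xi w)) = 0.
Proof.
rewrite meanE big1 ?mulr0 // => i _; rewrite !dotv_xi /=; ring.
Qed.

Lemma mean_xi2 u v : mean (fun w => dotv u (xi w) * dotv v (xi w)) = dotv u v.
Proof.
rewrite meanE [RHS]/dotv mulr_sumr; apply: eq_bigr => i _; rewrite !dotv_xi /=.
have E : Num.sqrt (d%:R : R) ^+ 2 = d%:R by rewrite sqr_sqrtr.
have -> : 1 * Num.sqrt d%:R * u i 0 * (1 * Num.sqrt d%:R * v i 0) +
   -1 * Num.sqrt d%:R * u i 0 * (-1 * Num.sqrt d%:R * v i 0) =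
   2 * (Num.sqrt d%:R ^+ 2) * (u i 0 * v i 0) by ring.
by rewrite E; field; exact: dR.
Qed.

Let sgn2 (w : 'I_d * bool) : (if w.2 then 1 else -1) ^+ 2 = 1 :> R.
Proof. by case: w.2; rewrite ?sqrrN expr1n. Qed.

Lemma dotv_xi_sqr v w : dotv v (xi w) ^+ 2 <= d%:R * frob v.
Proof.
by rewrite dotv_xi !exprMn sqr_sqrtr // sgn2 mul1r ler_wpM2l // coord_frob.
Qed.

Lemma mul_xi k (A : 'M[R]_(k, d)) w :
  A *m xi w = ((if w.2 then 1 else -1) * Num.sqrt d%:R) *: col w.1 A.
Proof. by rewrite /xi -scalemxAr -colE. Qed.

Lemma frob_mul_xi k (A : 'M[R]_(k, d)) w : frob (A *m xi w) <= d%:R * frob A.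
Proof.
rewrite mul_xi frobZ exprMn sqr_sqrtr //.
rewrite sgn2 mul1r ler_wpM2l // /frob; apply: ler_sum => i _.
rewrite big_ord1 mxE (bigD1 w.1) //= lerDl.
by apply: sumr_ge0 => ? _; exact: sqr_ge0.
Qed.

Lemma mean_quad k (A : 'M[R]_(k, d)) (M : 'M[R]_k) :
  mean (fun w => dotv (A *m xi w) (M *m (A *m xi w))) = \tr (A *m A^T *m M).
Proof.
have -> : \tr (A *m A^T *m M) = \sum_i dotv (col i A) (M *m col i A).
  rewrite -mulmxA mxtrace_mulC /mxtrace; apply: eq_bigr => i _.
  rewrite -mulmxA mxE; apply: eq_bigr => j _.
  rewrite !mxE; congr (_ * _); by apply: eq_bigr => l _; rewrite !mxE.
rewrite meanE mulr_sumr; apply: eq_bigr => i _; rewrite !mul_xi /=.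
rewrite -!scalemxAr !dotvZl !dotvZr.
have E : Num.sqrt (d%:R : R) * Num.sqrt (d%:R : R) = d%:R by rewrite -expr2 sqr_sqrtr.
set z := dotv _ _.
have -> : 1 * Num.sqrt d%:R * (1 * Num.sqrt d%:R * z) +
   -1 * Num.sqrt d%:R * (-1 * Num.sqrt d%:R * z) =
   2 * (Num.sqrt d%:R * Num.sqrt d%:R) * z by ring.
by rewrite E; field; exact: dR.
Qed.

(** Opposite noise values cancel: the part of a function that is quadratic in the noise does not
    contribute to its discrete gradient. *)
Lemma mean_quad_odd k (A : 'M[R]_(k, d)) (M : 'M[R]_k) v :
  mean (fun w => dotv (A *m xi w) (M *m (A *m xi w)) * dotv v (xi w)) = 0.
Proof.
rewrite meanE big1 ?mulr0 // => i _; rewrite !mul_xi !dotv_xi /=.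
rewrite -!scalemxAr !dotvZl !dotvZr; ring.
Qed.

End Noise.

(** * One Euler step and its changes of weights *)

Section OneStep.
Context {R : realType} {d : nat}.
Hypothesis d_gt0 : (0 < d)%N.

(** A discrete Girsanov density: it has mean 1 and moves the mean of the noise to
    [sqrt dt * beta]. *)
Definition wt (dt : R) (beta : 'cV[R]_d) (w : 'I_d * bool) : R :=
  1 + Num.sqrt dt * dotv beta (xi w).

Definition incr k (dt : R) (b : 'cV[R]_k) (s : 'M[R]_(k, d)) (w : 'I_d * bool) : 'cV[R]_k :=
  dt *: b + Num.sqrt dt *: (s *m xi w).

(** The discrete [sigma^T D u]. Since the covariance is the identity, it is exact on functions that
    are affine in the noise. *)
Definition zvec (dt : R) (phi : 'I_d * bool -> R) : 'cV[R]_d :=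
  \col_a (mean (fun w => phi w * (xi w : 'cV[R]_d) a 0) / Num.sqrt dt).

Lemma dotv_zvec dt beta phi :
  dotv beta (zvec dt phi) = mean (fun w => phi w * dotv beta (xi w)) / Num.sqrt dt.
Proof.
rewrite {1}/dotv; under eq_bigr do rewrite mxE mulrA -meanZ.
rewrite -mulr_suml; congr (_ / _).
rewrite /mean -mulr_sumr exchange_big; congr (_ * _); apply: eq_bigr => w _ /=.
by rewrite mulr_sumr; apply: eq_bigr => a _; rewrite mulrCA.
Qed.

Lemma mean_wtE (dt : R) beta phi : 0 < dt ->
  mean (fun w => wt dt beta w * phi w) = mean phi + dt * dotv beta (zvec dt phi).
Proof.
move=> dt0; rewrite dotv_zvec.
have -> : dt * (mean (fun w => phi w * dotv beta (xi w)) / Num.sqrt dt)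
  = Num.sqrt dt * mean (fun w => phi w * dotv beta (xi w)).
  rewrite -{1}[dt]sqr_sqrtr ?ltW //; field.
  by rewrite gt_eqF // sqrtr_gt0.
rewrite -meanZ -meanD; apply: eq_mean => w; rewrite /wt; ring.
Qed.

Lemma zvecN dt phi : zvec dt (fun w => - phi w) = - zvec dt phi.
Proof.
apply/matrixP => a j; rewrite !mxE -mulNr -meanN; congr (_ / _).
by apply: eq_mean => w; rewrite mulNr.
Qed.

Lemma zvecB dt f g : zvec dt (fun w => f w - g w) = zvec dt f - zvec dt g.
Proof.
apply/matrixP => a j; rewrite !mxE -mulrBl -meanB; congr (_ / _).
by apply: eq_mean => w; rewrite mulrBl.
Qed.

Lemma mean_wt1 dt beta : mean (wt dt beta) = 1.
Proof. by rewrite /wt meanD mean_cst // meanZ mean_xi // mulr0 addr0. Qed.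

Lemma mean_wt_cst dt beta c : mean (fun w => wt dt beta w * c) = c.
Proof.
rewrite (eq_mean (g := fun w => c * wt dt beta w)); last by move=> w; rewrite mulrC.
by rewrite meanZ mean_wt1 mulr1.
Qed.

Lemma mean_wt_xi dt beta v :
  mean (fun w => wt dt beta w * dotv v (xi w)) = Num.sqrt dt * dotv beta v.
Proof.
rewrite (eq_mean (g := fun w => dotv v (xi w) + Num.sqrt dt * (dotv beta (xi w) * dotv v (xi w)))).
  by rewrite meanD mean_xi // meanZ mean_xi2 // add0r.
by move=> w; rewrite /wt; ring.
Qed.

(** Every noise vector has squared norm [d], whence the restriction [dt * d * B <= 1]: it keeps the
    scheme monotone in spite of its dependence on the gradient. *)
Lemma wt_tilt (dt B : R) (beta : 'cV[R]_d) w : 0 <= dt -> frob beta <= B -> dt * d%:R * B <= 1 ->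
  `|Num.sqrt dt * dotv beta (xi w)| <= 1.
Proof.
move=> dt0 bB dtB; rewrite -[leRHS]sqrtr1 -sqrtr_sqr ler_wsqrtr // exprMn sqr_sqrtr //.
apply: le_trans dtB; rewrite -mulrA ler_wpM2l //.
by apply: le_trans (dotv_xi_sqr _ _) _; rewrite ler_wpM2l.
Qed.

Lemma wt_ge0 (dt B : R) (beta : 'cV[R]_d) w : 0 <= dt -> frob beta <= B -> dt * d%:R * B <= 1 ->
  0 <= wt dt beta w.
Proof.
by move=> dt0 bB dtB; have := wt_tilt w dt0 bB dtB; rewrite ler_norml /wt; lra.
Qed.

Lemma mean_wt_le (dt B : R) (beta : 'cV[R]_d) f g : 0 <= dt -> frob beta <= B -> dt * d%:R * B <= 1 ->
  (forall w, f w <= g w) ->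
  mean (fun w => wt dt beta w * f w) <= mean (fun w => wt dt beta w * g w).
Proof.
move=> dt0 bB dtB H; apply: mean_le => w; rewrite ler_wpM2l //.
exact: (wt_ge0 _ dt0 bB dtB).
Qed.

(** Bessel's inequality: the coordinates of the noise are orthonormal and orthogonal to constants,
    and [sqrt dt *: zvec dt phi] lists the coefficients of [phi] on them. So the variance of one
    step can pay for terms of size [dt * frob Z]. *)
Lemma zvec_bessel (dt : R) phi : 0 < dt ->
  dt * frob (zvec dt phi) <= mean (fun w => (phi w - mean phi) ^+ 2).
Proof.
move=> dt0; move: (mean phi) => m; set z := zvec dt phi.
have s0 : 0 < Num.sqrt dt by rewrite sqrtr_gt0.
have sE : Num.sqrt dt ^+ 2 = dt by rewrite sqr_sqrtr // ltW.
have H : 0 <= mean (fun w => (phi w - m - Num.sqrt dt * dotv z (xi w)) ^+ 2).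
  by rewrite -[leLHS](mean_cst d_gt0 0); apply: mean_le => w; exact: sqr_ge0.
have E : mean (fun w => (phi w - m - Num.sqrt dt * dotv z (xi w)) ^+ 2) =
    mean (fun w => (phi w - m) ^+ 2)
    - 2 * Num.sqrt dt * (mean (fun w => phi w * dotv z (xi w)))
    + 2 * Num.sqrt dt * m * mean (fun w => dotv z (xi w))
    + Num.sqrt dt ^+ 2 * mean (fun w => dotv z (xi w) * dotv z (xi w)).
  rewrite -!meanZ -meanB -!meanD.
  by apply: eq_mean => w; ring.
have E2 : dotv z z = mean (fun w => phi w * dotv z (xi w)) / Num.sqrt dt.
  by rewrite {2}/z dotv_zvec.
rewrite mean_xi // mean_xi2 // dotvv sE in E.
rewrite dotvv in E2.
have E3 : mean (fun w => phi w * dotv z (xi w)) = Num.sqrt dt * frob z.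
  by rewrite E2; field; rewrite gt_eqF.
rewrite E3 in E.
have E4 : 2 * Num.sqrt dt * (Num.sqrt dt * frob z) = 2 * dt * frob z.
  by rewrite -!mulrA [Num.sqrt _ * _]mulrA -expr2 sE.
rewrite E4 in E; lra.
Qed.

Section Shift.
Variable k : nat.

Lemma frob_incr (dt S : R) (b : 'cV[R]_k) (s : 'M[R]_(k, d)) w : 0 <= dt <= 1 ->
  frob b <= S -> frob s <= S -> frob (incr dt b s w) <= dt * ((2 + 2 * d%:R) * S).
Proof.
move=> /andP[dt0 dt1] bS sS; apply: le_trans (frobD_le _ _) _.
rewrite !frobZ sqr_sqrtr //.
have H1 : frob (s *m xi w) <= d%:R * S.
  by apply: le_trans (frob_mul_xi _ _) _; rewrite ler_wpM2l.
have H2 : dt ^+ 2 * frob b <= dt * S.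
  rewrite expr2 -mulrA ler_wpM2l //; apply: le_trans bS.
  by rewrite ler_piMl // frob_ge0.
have H3 : dt * frob (s *m xi w) <= dt * (d%:R * S) by rewrite ler_wpM2l.
lra.
Qed.

(** The part of the increment of order [sqrt dt] has mean zero, so it enters only through its square
    and its correlation with the weights, both of order [dt]. *)
Lemma mean_wt_frob (dt B S : R) (beta : 'cV_d) (D b : 'cV[R]_k) (s : 'M[R]_(k, d)) :
  0 < dt <= 1 -> frob beta <= B -> dt * d%:R * B <= 1 -> frob b <= S -> frob s <= S ->
  mean (fun w => wt dt beta w * frob (D + incr dt b s w)) <=
    frob D + dt * (2 * frob D + (3 + B + 2 * d%:R) * S).
Proof.
move=> /andP[dt0 dt1] bB dtB bS sS.
have s0 : 0 < Num.sqrt dt by rewrite sqrtr_gt0.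
have sE : Num.sqrt dt * Num.sqrt dt = dt by rewrite -expr2 sqr_sqrtr // ltW.
have E w : wt dt beta w * frob (D + incr dt b s w) = wt dt beta w * (frob D + 2 * dt * dotv D b)
   + 2 * Num.sqrt dt * (wt dt beta w * dotv (s^T *m D) (xi w))
   + wt dt beta w * frob (incr dt b s w).
  have -> : frob (D + incr dt b s w) = frob D + 2 * (dt * dotv D b
      + Num.sqrt dt * dotv (s^T *m D) (xi w)) + frob (incr dt b s w).
    by rewrite frobD /incr dotvDr (dotvZr dt) (dotvZr (Num.sqrt dt)) dotv_mulmx.
  ring.
rewrite (eq_mean E) !meanD mean_wt_cst meanZ mean_wt_xi.
have H1 : mean (fun w => wt dt beta w * frob (incr dt b s w)) <= dt * ((2 + 2 * d%:R) * S).
  rewrite -[leRHS](mean_wt_cst dt beta).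
  apply: (mean_wt_le (ltW dt0) bB dtB) => w; apply: frob_incr => //.
  by rewrite ltW.
have -> : dotv beta (s^T *m D) = dotv D (s *m beta) by rewrite [RHS]dotv_mulmx dotvC.
have H2 : 2 * dotv D (s *m beta) <= frob D + S * B.
  apply: le_trans (dotv_le2 _ _) _; rewrite lerD2l.
  apply: le_trans (frob_mulmx _ _) _; apply: ler_pM => //; exact: frob_ge0.
have H3 : 2 * dotv D b <= frob D + S.
  by apply: le_trans (dotv_le2 _ _) _; rewrite lerD2l.
have -> : 2 * Num.sqrt dt * (Num.sqrt dt * dotv D (s *m beta)) = dt * (2 * dotv D (s *m beta)).
  by rewrite -[in RHS]sE; ring.
have H4 : dt * (2 * dotv D (s *m beta)) <= dt * (frob D + S * B) by rewrite ler_pM2l.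
have H5 : dt * (2 * dotv D b) <= dt * (frob D + S) by rewrite ler_pM2l.
lra.
Qed.

(** A Taylor bound with one constant for all [e] of a bounded range; the lower limit -1 keeps the
    factor [1 + e] of the induction non-negative. *)
Lemma expr1D_le (M : R) p : 0 <= M ->
  exists2 c : R, 0 <= c & forall e, -1 <= e <= M -> (1 + e) ^+ p <= 1 + p%:R * e + c * e ^+ 2.
Proof.
move=> M0; elim: p => [|p [c c0 IH]].
  by exists 0 => // e _; rewrite expr0; lra.
exists (p%:R + c + c * M); first by rewrite !addr_ge0 // mulr_ge0.
move=> e /andP[e1 eM]; rewrite exprS.
have H : (1 + e) * (1 + e) ^+ p <= (1 + e) * (1 + p%:R * e + c * e ^+ 2).
  by rewrite ler_wpM2l ?IH ?e1 //; lra.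
apply: le_trans H _.
have : c * e ^+ 2 * e <= c * e ^+ 2 * M by rewrite ler_wpM2l // mulr_ge0 // sqr_ge0.
rewrite -[in X in _ -> _ <= X]natr1; lra.
Qed.

Definition poly (p : nat) (x : 'cV[R]_k) : R := (1 + frob x) ^+ p.

Lemma poly_ge1 p x : 1 <= poly p x.
Proof. by rewrite exprn_ege1 // lerDl frob_ge0. Qed.

Lemma poly_gt0 p x : 0 < poly p x.
Proof. exact: lt_le_trans (poly_ge1 p x). Qed.

(** The relative increment [e] of [1 + frob x] has a square of order [dt] and, under the weights, a
    mean at most of order [dt]; hence its p-th power gains at most a factor [1 + c * dt]. *)
Lemma poly_growth_step (C : R) p : 0 <= C ->
  exists2 c : R, 0 <= c & forall dt (beta : 'cV_d) (x b : 'cV[R]_k) (s : 'M[R]_(k, d)),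
    0 < dt <= 1 -> frob beta <= C ^+ 2 -> dt * d%:R * C ^+ 2 <= 1 ->
    frob b <= C * (1 + frob x) -> frob s <= C * (1 + frob x) ->
    mean (fun w => wt dt beta w * poly p (x + incr dt b s w)) <= (1 + c * dt) * poly p x.
Proof.
move=> C0; pose A := (2 + 2 * d%:R) * C; pose D := 2 + (3 + C ^+ 2 + 2 * d%:R) * C.
have A0 : 0 <= A by rewrite mulr_ge0 // addr_ge0 // mulr_ge0.
have D0 : 0 <= D by rewrite addr_ge0 // mulr_ge0 // !addr_ge0 // ?sqr_ge0 ?mulr_ge0.
(* [1 + 2 * A] is the upper bound of the relative increment [e] below. *)
have [c c0 Hc] := @expr1D_le (1 + 2 * A) p ltac:(lra).
exists (p%:R * D + c * (8 * A + 2 * A ^+ 2)).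
  by rewrite addr_ge0 // mulr_ge0 // ?addr_ge0 ?mulr_ge0 ?sqr_ge0.
move=> dt beta x b s /andP[dt0 dt1] bB dtB bS sS.
set Q := 1 + frob x; have Q1 : 1 <= Q by rewrite lerDl frob_ge0.
have Q0 : 0 < Q by apply: lt_le_trans Q1.
pose U w := incr dt b s w.
pose e w := (frob (x + U w) - frob x) / Q.
have UA w : frob (U w) <= dt * (A * Q).
  by rewrite /A -mulrA; apply: frob_incr; rewrite ?(ltW dt0).
have eE w : 1 + frob (x + U w) = Q * (1 + e w).
  by rewrite /e /Q; field; exact: lt0r_neq0.
have e_ge w : -1 <= e w.
  by rewrite -subr_ge0 opprK -(pmulr_rge0 _ Q0) addrC -eE addr_ge0 // frob_ge0.
have eU w : frob (x + U w) - frob x = 2 * dotv x (U w) + frob (U w).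
  by rewrite frobD; ring.
have Ax w : (2 * dotv x (U w)) ^+ 2 <= 4 * dt * A * Q ^+ 2.
  rewrite exprMn; have := cauchy_dotv x (U w) => H.
  have : frob x * frob (U w) <= Q * (dt * (A * Q)).
    by apply: ler_pM => //; rewrite ?frob_ge0 // /Q lerDr.
  lra.
have eM w : e w <= 1 + 2 * A.
  rewrite /e ler_pdivrMr // eU.
  have h1 : 2 * dotv x (U w) <= frob x + frob (U w) by exact: dotv_le2.
  have h2 := UA w.
  have h3 : dt * (A * Q) <= A * Q by rewrite ler_piMl // mulr_ge0 // ltW.
  have h4 : frob x <= Q by rewrite /Q lerDr.
  lra.
have e2 w : e w ^+ 2 <= (8 * A + 2 * A ^+ 2) * dt.
  rewrite /e expr_div_n ler_pdivrMr ?exprn_gt0 // eU.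
  have h1 : (2 * dotv x (U w) + frob (U w)) ^+ 2 <=
     2 * (2 * dotv x (U w)) ^+ 2 + 2 * frob (U w) ^+ 2.
    have := sqr_ge0 (2 * dotv x (U w) - frob (U w)); lra.
  have h2 : frob (U w) ^+ 2 <= dt * (A ^+ 2 * Q ^+ 2).
    apply: (le_trans (y := (dt * (A * Q)) ^+ 2)).
      by rewrite lerXn2r // nnegrE ?frob_ge0 // !mulr_ge0 // ltW.
    rewrite exprMn [(A * Q) ^+ 2]exprMn ler_wpM2r ?mulr_ge0 ?sqr_ge0 ?(ltW Q0) //.
    by rewrite expr2 ler_piMl // ltW.
  have h3 := Ax w; lra.
have polyE w : poly p (x + incr dt b s w) = poly p x * (1 + e w) ^+ p.
  by rewrite /poly -/(U w) eE exprMn.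
have H1 : mean (fun w => wt dt beta w * poly p (x + incr dt b s w)) <=
    mean (fun w => wt dt beta w * (poly p x * (1 + p%:R * e w + c * ((8 * A + 2 * A ^+ 2) * dt)))).
  apply: (mean_wt_le (ltW dt0) bB dtB) => w; rewrite polyE ler_pM2l ?poly_gt0 //.
  apply: le_trans (Hc _ _) _; first by rewrite e_ge eM.
  by rewrite lerD2l ler_wpM2l.
apply: le_trans H1 _.
have E w : wt dt beta w * (poly p x * (1 + p%:R * e w + c * ((8 * A + 2 * A ^+ 2) * dt))) =
   wt dt beta w * (poly p x * (1 + c * ((8 * A + 2 * A ^+ 2) * dt) - p%:R * frob x / Q))
   + (poly p x * p%:R / Q) * (wt dt beta w * frob (x + U w)).
  by rewrite /e; field; exact: lt0r_neq0.
rewrite (eq_mean E) meanD mean_wt_cst meanZ.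
have H2 := mean_wt_frob x (introT andP (conj dt0 dt1)) bB dtB bS sS.
have H3 : frob x + dt * (2 * frob x + (3 + C ^+ 2 + 2 * d%:R) * (C * Q)) <= frob x + dt * (D * Q).
  rewrite lerD2l ler_pM2l // /D; have : frob x <= Q by rewrite /Q lerDr.
  lra.
have {H3}H2 := le_trans H2 H3.
have pq : 0 <= poly p x * p%:R / Q by rewrite divr_ge0 ?mulr_ge0 // ?ltW ?poly_gt0.
have := ler_wpM2l pq H2 => {}H2.
apply: le_trans (lerD (lexx _) H2) _.
by rewrite le_eqVlt; apply/orP; left; apply/eqP; field; exact: lt0r_neq0.
Qed.

End Shift.
End OneStep.

(** * The scheme: one monotone step and its growth *)

Section Scheme.
Context {R : realType} {k d m : nat}.
Hypothesis d_gt0 : (0 < d)%N.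

(** Coefficients frozen at one time. A record rather than a time parameter, because the doubling
    also compares with coefficients that are not those of the equation. *)
Record coef := Coef {
  drift : 'cV[R]_k -> 'cV[R]_k;
  vol : 'cV[R]_k -> 'M[R]_(k, d);
  gen : 'I_m -> 'cV[R]_k -> 'cV[R]_m -> 'cV[R]_d -> R;
  cost : 'I_m -> 'I_m -> 'cV[R]_k -> R }.

Record wf_coef (C : R) (p : nat) (c : coef) : Prop := WfCoef {
  wf_drift : forall x, frob (drift c x) <= C * (1 + frob x);
  wf_vol : forall x, frob (vol c x) <= C * (1 + frob x);
  wf_gen0 : forall i x, `|gen c i x 0 0| <= C * poly p x;
  wf_lip : forall i x y z y' z', `|gen c i x y z - gen c i x y' z'|
     <= C * (\sum_j `|y j 0 - y' j 0| + enorm (z - z'));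
  wf_cost : forall i j x, j != i -> 0 <= cost c i j x }.

Implicit Types (c : coef) (u : 'I_m -> 'cV[R]_k -> R) (dt : R).

Definition next c dt x (w : 'I_d * bool) : 'cV[R]_k := x + incr dt (drift c x) (vol c x) w.

Definition slope c dt u i x : 'cV[R]_d := zvec dt (fun w => u i (next c dt x w)).

Definition genu c dt u i x : R := gen c i x (\col_j u j x) (slope c dt u i x).

Definition pre c dt u i x : R := mean (fun w => u i (next c dt x w)) + dt * genu c dt u i x.

Definition step c dt u (i : 'I_m) x : R :=
  \big[Num.max/pre c dt u i x]_(j | j != i) (pre c dt u j x - cost c i j x).

Lemma step_ge_pre c dt u i x : pre c dt u i x <= step c dt u i x.
Proof. by rewrite /step; elim/big_rec: _ => // j y _ H; rewrite le_max H orbT. Qed.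

Lemma step_ge_switch c dt u i j x : j != i ->
  pre c dt u j x - cost c i j x <= step c dt u i x.
Proof. by move=> ji; rewrite /step (bigmaxD1 j) // le_max lexx. Qed.

Lemma step_cases c dt u i x : step c dt u i x = pre c dt u i x \/
  exists2 j, j != i & step c dt u i x = pre c dt u j x - cost c i j x.
Proof.
rewrite /step; elim/big_rec: _ => [|j y ji IH]; first by left.
by rewrite maxEle; case: ifP => _; [exact: IH | right; exists j].
Qed.

Lemma gen_le C p c i x y z : wf_coef C p c ->
  `|gen c i x y z| <= C * poly p x + C * (\sum_j `|y j 0| + enorm z).
Proof.
move=> wf; have := wf_lip wf i x y z 0 0; have := wf_gen0 wf i x.
under eq_bigr do rewrite mxE subr0.
rewrite subr0 => h1 h2.
rewrite -[gen c i x y z](subrK (gen c i x 0 0)).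
by apply: le_trans (ler_normD _ _) _; rewrite addrC lerD.
Qed.

(** A step is at least its own branch and, the costs being non-negative, at most the largest branch,
    so bounds on [pre] suffice. As [lam] does not depend on [B], iteration gives an exponential in
    time. *)
Lemma step_growth (C : R) p : 1 <= C -> exists2 lam : R, 0 <= lam &
  forall c dt u B, wf_coef C p c -> 0 < dt <= 1 -> dt * d%:R * C ^+ 2 <= 1 -> 1 <= B ->
  (forall i x, `|u i x| <= B * poly p x) ->
  forall i x, `|step c dt u i x| <= B * (1 + lam * dt) * poly p x.
Proof.
move=> C1; have C0 : 0 <= C by lra.
have [g g0 Hg] := @poly_growth_step R d d_gt0 k C p C0.
exists (g + C + C * m%:R); first by rewrite !addr_ge0 // mulr_ge0.
move=> c dt u B wf /andP[dt0 dt1] dtC B1 uB i x.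
have P0 := poly_gt0 p x.
have B0 : 0 <= B by lra.
suff H j : `|pre c dt u j x| <= B * (1 + (g + C + C * m%:R) * dt) * poly p x.
  have Hi := H i; rewrite ler_norml in Hi; case/andP: Hi => Hi _.
  rewrite ler_norml (le_trans Hi (step_ge_pre _ _ _ _ _)) /=.
  case: (step_cases c dt u i x) => [->|[j ji ->]].
    by have := H i; rewrite ler_norml => /andP[].
  have := H j; rewrite ler_norml => /andP[_ Hj]; apply: le_trans Hj.
  by rewrite gerBl; apply: wf_cost wf _ _ _ ji.
set phi := fun w => u j (next c dt x w).
have Hm (b : 'cV[R]_d) (psi : _ -> R) : frob b <= C ^+ 2 ->
    (forall w, psi w <= `|phi w|) ->
    mean (fun w => wt dt b w * psi w) <= B * ((1 + g * dt) * poly p x).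
  move=> bC psi_le.
  apply: (le_trans (y := mean (fun w => wt dt b w * (B * poly p (next c dt x w))))).
    apply: (mean_wt_le (ltW dt0) bC dtC) => w.
    exact: le_trans (psi_le w) (uB _ _).
  rewrite (eq_mean (g := fun w => B * (wt dt b w * poly p (next c dt x w)))); last first.
    by move=> w; ring.
  rewrite meanZ ler_wpM2l //; apply: Hg; rewrite ?dt0 //.
    exact: wf_drift wf _.
  exact: wf_vol wf _.
(* One [b] serves both signs: [pre] is bounded above with the weights of [b] and below with those of
   [- b]. *)
have [b bC bE] := enorm_linear (slope c dt u j x) C0.
have Hgen : `|genu c dt u j x| <= C * poly p x + C * m%:R * (B * poly p x) + dotv b (slope c dt u j x).
  apply: le_trans (gen_le _ _ _ _ wf) _; rewrite mulrDr bE addrA lerD2r lerD2l -mulrA ler_wpM2l //.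
  apply: (le_trans (y := \sum_(l < m) B * poly p x)).
    by apply: ler_sum => l _; rewrite mxE.
  by rewrite sumr_const card_ord mulr_natl.
have Hp := Hm b phi bC (fun w => ler_norm _).
have bN : frob (- b) <= C ^+ 2 by rewrite frobN.
have phiN w : - phi w <= `|phi w| by rewrite -normrN ler_norm.
have Hn := Hm (- b) (fun w => - phi w) bN phiN.
rewrite !mean_wtE // meanN zvecN dotvNr dotvNl opprK in Hp Hn.
rewrite -/(slope c dt u j x) in Hp Hn.
have CB : C * poly p x <= C * (B * poly p x) by rewrite ler_wpM2l // ler_peMl // ltW.
have Hd : dt * `|genu c dt u j x| <=
   dt * (C * (B * poly p x) + C * m%:R * (B * poly p x) + dotv b (slope c dt u j x)).
  by rewrite ler_pM2l //; apply: le_trans Hgen _; rewrite !lerD2r.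
have h1 : dt * genu c dt u j x <= dt * `|genu c dt u j x| by rewrite ler_pM2l // ler_norm.
have h2 : - (dt * genu c dt u j x) <= dt * `|genu c dt u j x|.
  by rewrite -mulrN ler_pM2l // -normrN ler_norm.
rewrite /pre -/phi ler_norml.
move: Hp Hn Hd h1 h2; set a1 := mean phi; set a2 := dotv b _ ; set a3 := poly p x.
by move=> *; apply/andP; split; lra.
Qed.

(* The square [(L + V)^2] is a submartingale up to its variance, which absorbs every error that is
   linear in the gradient of [L]. *)
Lemma pre_double (C V Bf ef Cchi theta chi' dt : R) p (cL cR : coef) (L Rf : 'I_m -> 'cV[R]_k -> R)
    (chi : 'cV[R]_k -> R) (psi : 'I_d * bool -> R) j x x' :
  1 <= C -> 0 < dt <= 1 -> dt * d%:R * C ^+ 2 <= 1 -> 8 * dt * C ^+ 2 <= 1 ->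
  wf_coef C p cL -> 0 <= theta -> 0 <= V -> 0 <= Bf ->
  (forall w, `|L j (next cL dt x w)| <= V) ->
  `|gen cL j x (\col_i L i x) 0| <= Bf ->
  genu cL dt L j x - genu cR dt Rf j x' <=
    ef + C * enorm (slope cL dt L j x - slope cR dt Rf j x') ->
  (forall b : 'cV[R]_d, frob b <= C ^+ 2 ->
     mean (fun w => wt dt b w * chi (next cL dt x w)) <= chi' + Cchi * dt) ->
  (forall w, L j (next cL dt x w) + theta * ((L j (next cL dt x w) + V) ^+ 2 - chi (next cL dt x w))
      - Rf j (next cR dt x' w) <= psi w) ->
  exists2 b : 'cV[R]_d, frob b <= C ^+ 2 &
    pre cL dt L j x + theta * ((pre cL dt L j x + V) ^+ 2 - chi') - pre cR dt Rf j x' <=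
    mean (fun w => wt dt b w * psi w) + dt * ef
    + theta * dt * (Cchi + 16 * V ^+ 2 * (d%:R * C ^+ 2) + 4 * V * Bf + 16 * V ^+ 2 * C ^+ 2
                     + 2 * Bf ^+ 2).
Proof.
move=> C1 /andP[dt0 dt1] dtC dtC8 wf th0 V0 Bf0 LV Bf_le hF hchi hpsi.
have C0 : 0 <= C by lra.
set phi := fun w => L j (next cL dt x w); set phi' := fun w => Rf j (next cR dt x' w).
have zE : slope cL dt L j x - slope cR dt Rf j x' = zvec dt (fun w => phi w - phi' w).
  by rewrite zvecB.
have [b bC bE] := enorm_linear (slope cL dt L j x - slope cR dt Rf j x') C0.
exists b => //.
have Ediff := mean_wtE b (fun w => phi w - phi' w) dt0.
rewrite -zE meanB -bE in Ediff.
set mu := mean phi in Ediff *.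
set var := mean (fun w => (phi w - mu) ^+ 2).
have muV : `|mu| <= V.
  rewrite ler_norml -(mean_cst d_gt0 (- V)) -{2}(mean_cst d_gt0 V).
  by apply/andP; split; apply: mean_le => w; have := LV w; rewrite ler_norml => /andP[].
have Esq : mean (fun w => (phi w + V) ^+ 2) = (mu + V) ^+ 2 + var.
  have E w : (phi w + V) ^+ 2 = (phi w - mu) ^+ 2 + (2 * (mu + V) * phi w + (V ^+ 2 - mu ^+ 2)).
    ring.
  rewrite (eq_mean E) meanD meanD mean_cst // meanZ -/mu -/var; ring.
(* The change of weights costs the square at most a quarter of its variance: with [t] the weight
   minus 1, the product [t * y * s] is completed to the square of [2^-1 * y + t * s]. *)
have Ewsq : mean (fun w => (phi w + V) ^+ 2) - 4^-1 * var - 16 * V ^+ 2 * (d%:R * C ^+ 2) * dt <=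
    mean (fun w => wt dt b w * (phi w + V) ^+ 2).
  have E w : wt dt b w * (phi w + V) ^+ 2 = (phi w + V) ^+ 2 +
     (Num.sqrt dt * dotv b (xi w) * ((phi w + V) ^+ 2 - (mu + V) ^+ 2)
      + Num.sqrt dt * (mu + V) ^+ 2 * dotv b (xi w)).
    by rewrite /wt; ring.
  rewrite (eq_mean E) !meanD meanZ mean_xi mulr0 addr0.
  rewrite -addrA lerD2l -opprD.
  rewrite -[16 * _ * _ * dt](mean_cst d_gt0) /var -meanZ -meanD -meanN.
  apply: mean_le => w.
  have ht : (Num.sqrt dt * dotv b (xi w)) ^+ 2 <= dt * (d%:R * C ^+ 2).
    rewrite exprMn sqr_sqrtr ?(ltW dt0) // ler_pM2l //.
    by apply: le_trans (dotv_xi_sqr _ _) _; rewrite ler_wpM2l.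
  set t := Num.sqrt dt * dotv b (xi w) in ht *.
  have := LV w; rewrite -/(phi w); move: muV; rewrite !ler_norml => /andP[m1 m2] /andP[p1 p2].
  set y := phi w - mu; set s := phi w + mu + 2 * V.
  have -> : (phi w + V) ^+ 2 - (mu + V) ^+ 2 = y * s by rewrite /y /s; ring.
  have s2 : s ^+ 2 <= 16 * V ^+ 2.
    have -> : 16 * V ^+ 2 = (4 * V) ^+ 2 :> R by ring.
    by rewrite lerXn2r // ?nnegrE /s; lra.
  have := sqr_ge0 (2^-1 * y + t * s).
  have : t ^+ 2 * s ^+ 2 <= dt * (d%:R * C ^+ 2) * (16 * V ^+ 2).
    by apply: ler_pM => //; rewrite sqr_ge0.
  lra.
have Hz := zvec_bessel d_gt0 phi dt0; rewrite -/mu -/var in Hz.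
set F := genu cL dt L j x in hF *.
set z := enorm (slope cL dt L j x).
have z0 : 0 <= z by exact: enorm_ge0.
have zvar : dt * z ^+ 2 <= var by rewrite /z enorm_sqr.
have HF : `|F| <= Bf + C * z.
  have := wf_lip wf j x (\col_i L i x) (slope cL dt L j x) (\col_i L i x) 0.
  under eq_bigr do rewrite subrr normr0.
  rewrite big1 // add0r subr0 -/z => H.
  rewrite /F /genu -[gen _ _ _ _ _](subrK (gen cL j x (\col_i L i x) 0)).
  by apply: le_trans (ler_normD _ _) _; rewrite addrC lerD.
have var0 : 0 <= var by apply: le_trans zvar; rewrite mulr_ge0 ?sqr_ge0 // ltW.
(* The generator costs half of the variance, a quarter for each of [h4] and [h8]. With the quarter
   lost to the weights, three quarters of the variance created by the square are spent. *)
have H1 : (pre cL dt L j x + V) ^+ 2 <= (mu + V) ^+ 2 + 2^-1 * var +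
   dt * (4 * V * Bf + 16 * V ^+ 2 * C ^+ 2 + 2 * Bf ^+ 2).
  have -> : pre cL dt L j x = mu + dt * F by [].
  have -> : (mu + dt * F + V) ^+ 2 = (mu + V) ^+ 2 + dt * (2 * F * (mu + V)) + dt * (dt * F ^+ 2) by ring.
  have h1 : 2 * F * (mu + V) <= 4 * V * (Bf + C * z).
    apply: le_trans (ler_norm _) _; rewrite !normrM normr_nat.
    have -> : 4 * V * (Bf + C * z) = 2 * (Bf + C * z) * (2 * V) by ring.
    apply: ler_pM; rewrite ?mulr_ge0 //.
      by rewrite ler_pM2l.
    by apply: le_trans (ler_normD _ _) _; rewrite (ger0_norm V0); lra.
  have h2 : F ^+ 2 <= 2 * Bf ^+ 2 + 2 * C ^+ 2 * z ^+ 2.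
    rewrite -real_normK ?num_real //.
    apply: (le_trans (y := (Bf + C * z) ^+ 2)).
      by rewrite lerXn2r // nnegrE // addr_ge0 // mulr_ge0.
    have := sqr_ge0 (Bf - C * z); lra.
  have h3 : dt * (2 * F * (mu + V)) <= dt * (4 * V * (Bf + C * z)) by rewrite ler_pM2l.
  have h4 : dt * (dt * F ^+ 2) <= dt * (2 * Bf ^+ 2) + 4^-1 * (dt * z ^+ 2).
    have h5 : dt * F ^+ 2 <= dt * (2 * Bf ^+ 2) + dt * (2 * C ^+ 2 * z ^+ 2).
      by rewrite -mulrDr ler_pM2l.
    have h6 : dt * (2 * Bf ^+ 2) <= 2 * Bf ^+ 2 by rewrite ler_piMl // mulr_ge0 // sqr_ge0.
    have h7 : dt * (2 * C ^+ 2 * z ^+ 2) <= 4^-1 * z ^+ 2.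
      have : 8 * dt * C ^+ 2 * z ^+ 2 <= 1 * z ^+ 2 by rewrite ler_wpM2r // sqr_ge0.
      lra.
    have := ler_wpM2l (ltW dt0) (le_trans h5 (lerD h6 h7)); lra.
  have h8 : dt * (4 * V * (C * z)) <= 4^-1 * (dt * z ^+ 2) + dt * (16 * V ^+ 2 * C ^+ 2).
    have : 0 <= dt * (2^-1 * z - 4 * V * C) ^+ 2 by rewrite mulr_ge0 ?sqr_ge0 // ltW.
    lra.
  lra.
have H2 : pre cL dt L j x - pre cR dt Rf j x' <=
    mean (fun w => wt dt b w * (phi w - phi' w)) + dt * ef.
  have := ler_wpM2l (ltW dt0) hF.
  rewrite Ediff /pre -/F -/phi -/phi' -/mu; lra.
have H3 : mean (fun w => wt dt b w * (phi w - phi' w)) <=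
    mean (fun w => wt dt b w * psi w) - theta * mean (fun w => wt dt b w * (phi w + V) ^+ 2)
    + theta * mean (fun w => wt dt b w * chi (next cL dt x w)).
  rewrite -!meanZ -meanB -meanD; apply: mean_le => w.
  have w0 := wt_ge0 w (ltW dt0) bC dtC.
  have := ler_wpM2l w0 (hpsi w); rewrite -/(phi w) -/(phi' w); lra.
have H4 := ler_wpM2l th0 (hchi b bC).
have H5 := ler_wpM2l th0 Ewsq.
have H6 := ler_wpM2l th0 H1.
have tv : 0 <= theta * var by rewrite mulr_ge0.
rewrite Esq in H5; lra.
Qed.

End Scheme.

(** * Doubling of the variables over one step *)

Section Doubling.
Context {R : realType} {k d m : nat}.
Hypothesis d_gt0 : (0 < d)%N.
Local Notation coef := (@coef R k d m).
Local Notation family := ('I_m -> 'cV[R]_k -> R).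
Implicit Types (c cL cR : coef) (u L Rf chi : family) (dt : R).

Definition tilt (theta V : R) chi u i x : R := u i x + theta * ((u i x + V) ^+ 2 - chi i x).

Lemma next_frob (C dt rho : R) p c x w : wf_coef C p c -> 0 <= C -> 0 <= dt <= 1 ->
  frob x <= rho -> frob (next c dt x w) <= 2 * rho + 2 * ((2 + 2 * d%:R) * (C * (1 + rho))).
Proof.
move=> wf C0 dt01 xr; have /andP[dt0 dt1] := dt01.
apply: le_trans (frobD_le _ _) _.
have xC : C * (1 + frob x) <= C * (1 + rho) by rewrite ler_wpM2l // lerD2l.
have h := frob_incr w dt01 (le_trans (wf_drift wf x) xC) (le_trans (wf_vol wf x) xC).
have : dt * ((2 + 2 * d%:R) * (C * (1 + rho))) <= (2 + 2 * d%:R) * (C * (1 + rho)).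
  have rho0 : 0 <= rho by exact: le_trans (frob_ge0 x) xr.
  by rewrite ler_piMl // !(mulr_ge0, addr_ge0).
lra.
Qed.

Lemma nextB cL cR dt x x' w : next cL dt x w - next cR dt x' w =
  (x - x') + incr dt (drift cL x - drift cR x') (vol cL x - vol cR x') w.
Proof.
rewrite /next /incr opprD addrACA; congr (_ + _).
by rewrite opprD addrACA -!scalerBr mulmxBl.
Qed.

(** If the left copy switches to [j], the right copy is at least the value of the same switch, at a
    cost that differs by at most [theta * eta]. The square yields [theta * g], the potential takes
    back at most [theta * (g - eta)], and the remaining [theta * eta] covers the difference of the
    costs. *)
Lemma switch_step (C V Bf ef Cchi theta eta dt : R) p cL cR L Rf (chi : family)
    (chi' : 'I_m -> R) (psi : 'I_d * bool -> R) x x' :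
  1 <= C -> 0 < dt <= 1 -> dt * d%:R * C ^+ 2 <= 1 -> 8 * dt * C ^+ 2 <= 1 ->
  wf_coef C p cL -> 0 <= theta -> 0 <= V -> 0 <= Bf ->
  (forall j w, `|L j (next cL dt x w)| <= V) ->
  (forall j, `|step cL dt L j x| <= V - 1) ->
  (forall j, `|gen cL j x (\col_i L i x) 0| <= Bf) ->
  (forall j, genu cL dt L j x - genu cR dt Rf j x' <=
    ef + C * enorm (slope cL dt L j x - slope cR dt Rf j x')) ->
  (forall j (b : 'cV[R]_d), frob b <= C ^+ 2 ->
     mean (fun w => wt dt b w * chi j (next cL dt x w)) <= chi' j + Cchi * dt) ->
  (forall i j, j != i -> chi' j - chi' i <= cost cL i j x - eta) ->
  (forall i j, j != i -> `|cost cL i j x - cost cR i j x'| <= theta * eta) ->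
  (forall j w, tilt theta V chi L j (next cL dt x w) - Rf j (next cR dt x' w) <= psi w) ->
  forall i, exists2 b : 'cV[R]_d, frob b <= C ^+ 2 &
    step cL dt L i x + theta * ((step cL dt L i x + V) ^+ 2 - chi' i) - step cR dt Rf i x' <=
    mean (fun w => wt dt b w * psi w) + dt * ef
    + theta * dt * (Cchi + 16 * V ^+ 2 * (d%:R * C ^+ 2) + 4 * V * Bf + 16 * V ^+ 2 * C ^+ 2
                     + 2 * Bf ^+ 2).
Proof.
move=> C1 dt01 dtC dtC8 wf th0 V0 Bf0 LV SV Bf_le hF hchi hsw hcost hpsi i.
have H j := @pre_double R k d m d_gt0 C V Bf ef Cchi theta (chi' j) dt p cL cR L Rf (chi j) psi
  j x x' C1 dt01 dtC dtC8 wf th0 V0 Bf0 (LV j) (Bf_le j) (hF j) (hchi j) (hpsi j).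
case: (step_cases cL dt L i x) => [E|[j ji E]].
  have [b bC Hb] := H i; exists b => //; apply: le_trans Hb.
  by rewrite E lerD2l lerN2 step_ge_pre.
have [b bC Hb] := H j; exists b => //; apply: le_trans Hb.
have S1 := step_ge_switch cR dt Rf x' ji.
have S2 := SV i; rewrite ler_norml in S2; case/andP: S2 => S2 _.
have g0 := wf_cost wf x ji.
have G := hcost _ _ ji; rewrite ler_norml in G; case/andP: G => G1 G2.
have X := ler_wpM2l th0 (hsw _ _ ji).
move: S2; rewrite E; move: S1 g0 G1 G2 X.
set a := pre cL dt L j x; set g := cost cL i j x; set g' := cost cR i j x'.
move=> S1 g0 G1 G2 X S2.
(* [(a - g + V)^2 = (a + V)^2 - g ((a + V) + (a - g + V))], both terms of the last sum being at least 1 *)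
have : theta * (g * (a + V + (a - g + V))) >= theta * g.
  by rewrite ler_wpM2l // ler_peMr //; lra.
lra.
Qed.

(** [K] penalizes the separation of the points, [kap] confines them to a ball, [e] collects the
    errors and [a] the exponential growth in time. *)
Definition barrier (K kap : R) q (a e : R) (x x' : 'cV[R]_k) : R :=
  a * (e + K * frob (x - x') + kap * (poly q x + poly q x')).

Lemma barrierC K kap q a e x x' : barrier K kap q a e x x' = barrier K kap q a e x' x.
Proof. by rewrite /barrier frobB_sym [poly q x + _]addrC. Qed.

(** The same noise drives both copies, so their separation evolves with the differences of the
    coefficients. *)
Lemma barrier_step (C K kap a e om g dt : R) p q cL cR (b : 'cV[R]_d) x x' :
  1 <= C -> 0 < dt <= 1 -> dt * d%:R * C ^+ 2 <= 1 -> wf_coef C p cL -> wf_coef C p cR ->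
  0 <= K -> 0 <= kap -> 0 <= a -> 0 <= om ->
  (forall dt (beta : 'cV_d) (x b : 'cV[R]_k) (s : 'M[R]_(k, d)),
    0 < dt <= 1 -> frob beta <= C ^+ 2 -> dt * d%:R * C ^+ 2 <= 1 ->
    frob b <= C * (1 + frob x) -> frob s <= C * (1 + frob x) ->
    mean (fun w => wt dt beta w * poly q (x + incr dt b s w)) <= (1 + g * dt) * poly q x) ->
  frob (drift cL x - drift cR x') <= C * frob (x - x') + om ->
  frob (vol cL x - vol cR x') <= C * frob (x - x') + om ->
  frob b <= C ^+ 2 ->
  mean (fun w => wt dt b w * barrier K kap q a e (next cL dt x w) (next cR dt x' w)) <=
  a * (e + K * (frob (x - x') + dt * (2 * frob (x - x')
                     + (3 + C ^+ 2 + 2 * d%:R) * (C * frob (x - x') + om)))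
         + kap * ((1 + g * dt) * (poly q x + poly q x'))).
Proof.
move=> C1 dt01 dtC wfL wfR K0 kap0 a0 om0 Hg Hb Hs bC.
have E w : wt dt b w * barrier K kap q a e (next cL dt x w) (next cR dt x' w) =
  a * (wt dt b w * e + K * (wt dt b w * frob (next cL dt x w - next cR dt x' w))
   + kap * (wt dt b w * poly q (next cL dt x w) + wt dt b w * poly q (next cR dt x' w))).
  by rewrite /barrier; ring.
rewrite (eq_mean E) meanZ ler_wpM2l // !meanD !meanZ meanD mean_wt_cst //.
apply: lerD.
  rewrite lerD2l ler_wpM2l //.
  under eq_mean do rewrite nextB.
  exact: mean_wt_frob.
rewrite ler_wpM2l // mulrDr lerD //.
  apply: Hg => //; [exact: wf_drift wfL _ | exact: wf_vol wfL _].
apply: Hg => //; [exact: wf_drift wfR _ | exact: wf_vol wfR _].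
Qed.

(** For pairs that are not near, growth bounds suffice. Beyond [rho] the exponent [p + p + 1] of the
    barrier beats the exponent [p + p] produced by the square of the tilt; within [rho], a squared
    distance above [r] makes the term in [K] exceed the oscillation [2 * V]. *)
Lemma crude_bound (B kap rho r V K theta a e : R) p L Rf chi i x x' :
  1 <= B -> 0 <= kap -> 0 <= K -> 6 * B ^+ 2 <= kap * rho -> 2 * V <= K * r -> 0 <= theta <= 1 -> 1 <= a ->
  4 * theta * V ^+ 2 <= e -> 0 <= V ->
  (forall y : 'cV[R]_k, frob y <= rho -> B * poly p y <= V) ->
  (forall y, `|L i y| <= B * poly p y) -> (forall y, `|Rf i y| <= B * poly p y) ->
  (forall y, 0 <= chi i y) ->
  ~ [/\ frob x <= rho, frob x' <= rho & frob (x - x') <= r] ->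
  tilt theta V chi L i x - Rf i x' <= barrier K kap (p + p).+1 a e x x'.
Proof.
move=> B1 kap0 K0 Hrho Hr /andP[th0 th1] a1 He V0 HV LB RB chi0 bad.
have B0 : 0 <= B by lra.
have P q y : 0 <= poly q y by exact: ltW (poly_gt0 q y).
have tV : 0 <= theta * V ^+ 2 by rewrite mulr_ge0 // sqr_ge0.
have e0 : 0 <= e by apply: le_trans He; lra.
rewrite /barrier; set s := e + _ + _.
have S1 : e + K * frob (x - x') + kap * (poly (p + p).+1 x + poly (p + p).+1 x') <= a * s.
  have Kf0 : 0 <= K * frob (x - x') by rewrite mulr_ge0 // frob_ge0.
  apply: ler_peMl => //; rewrite /s; apply: addr_ge0; first exact: addr_ge0.
  by apply: mulr_ge0 => //; apply: addr_ge0; exact: P.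
apply: le_trans S1 => {s}.
have tl : tilt theta V chi L i x <= `|L i x| + 2 * theta * `|L i x| ^+ 2 + 2 * theta * V ^+ 2.
  rewrite /tilt real_normK ?num_real //.
  have h1 := ler_norm (L i x).
  have h2 : 0 <= theta * chi i x by rewrite mulr_ge0.
  have h3 : 0 <= theta * (L i x - V) ^+ 2 by rewrite mulr_ge0 // sqr_ge0.
  lra.
have RN : - Rf i x' <= `|Rf i x'| by rewrite -normrN ler_norm.
have Kf : 0 <= K * frob (x - x') by rewrite mulr_ge0 // frob_ge0.
have PE (y : 'cV[R]_k) : poly p y ^+ 2 = poly (p + p) y by rewrite /poly -exprM muln2 addnn.
have PM (y : 'cV[R]_k) : poly p y <= poly (p + p) y by rewrite -PE ler_eXnr // poly_ge1.
have BB : B <= B ^+ 2 by rewrite ler_eXnr.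
have L1 : `|L i x| <= B ^+ 2 * poly (p + p) x.
  by apply: le_trans (LB x) _; apply: ler_pM; rewrite ?P ?PM.
have R1 : `|Rf i x'| <= B ^+ 2 * poly (p + p) x'.
  by apply: le_trans (RB x') _; apply: ler_pM; rewrite ?P ?PM.
have L2 : `|L i x| ^+ 2 <= B ^+ 2 * poly (p + p) x.
  by rewrite -PE -exprMn lerXn2r // nnegrE // mulr_ge0 // P.
have L2t : theta * `|L i x| ^+ 2 <= B ^+ 2 * poly (p + p) x.
  by apply: le_trans L2; rewrite ler_piMl // sqr_ge0.
(* the larger of the two points pays for both *)
have pay (y y' : 'cV[R]_k) : frob y <= frob y' -> rho < frob y' ->
    3 * B ^+ 2 * (poly (p + p) y + poly (p + p) y') <=
    kap * (poly (p + p).+1 y + poly (p + p).+1 y').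
  move=> yy' ry'.
  have h1 : poly (p + p) y <= poly (p + p) y'.
    by rewrite lerXn2r // ?nnegrE ?lerD2l // addr_ge0 // frob_ge0.
  have h2 : 6 * B ^+ 2 * poly (p + p) y' <= kap * poly (p + p).+1 y'.
    rewrite [poly _.+1 _]exprS mulrA ler_wpM2r ?P //.
    apply: le_trans Hrho _; rewrite ler_wpM2l //; lra.
  have h3 : 0 <= kap * poly (p + p).+1 y by rewrite mulr_ge0 // P.
  have h4 : 3 * B ^+ 2 * poly (p + p) y <= 3 * B ^+ 2 * poly (p + p) y'.
    by rewrite ler_wpM2l // mulr_ge0 // sqr_ge0.
  lra.
have far : rho < frob x \/ rho < frob x' ->
    tilt theta V chi L i x - Rf i x' <= e + K * frob (x - x')
      + kap * (poly (p + p).+1 x + poly (p + p).+1 x').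
  move=> H.
  suff : 3 * B ^+ 2 * (poly (p + p) x + poly (p + p) x') <=
      kap * (poly (p + p).+1 x + poly (p + p).+1 x').
    have : 0 <= B ^+ 2 * poly (p + p) x' by rewrite mulr_ge0 ?sqr_ge0 // P.
    lra.
  have [xx'|/ltW xx'] := leP (frob x) (frob x').
    by apply: pay => //; case: H => // /lt_le_trans; apply.
  rewrite [poly _ x + _]addrC [poly (p + p).+1 x + _]addrC.
  by apply: pay => //; case: H => // /lt_le_trans; apply.
have [xr|xr] := leP (frob x) rho; last by apply: far; left.
have [xr'|xr'] := leP (frob x') rho; last by apply: far; right.
have xx' : r < frob (x - x') by rewrite ltNge; apply/negP => xx'; apply: bad.
have LV := le_trans (LB x) (HV x xr).
have RV := le_trans (RB x') (HV x' xr').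
have LV2 : theta * `|L i x| ^+ 2 <= theta * V ^+ 2.
  by rewrite ler_wpM2l // lerXn2r // nnegrE.
have Kr : K * r <= K * frob (x - x') by rewrite ler_wpM2l // ltW.
have : 0 <= kap * (poly (p + p).+1 x + poly (p + p).+1 x').
  by rewrite mulr_ge0 // addr_ge0 // P.
lra.
Qed.
End Doubling.

(** * Propagation of the doubling estimate along two runs *)

Section Sequences.
Context {R : realType} {k d m : nat}.
Hypothesis d_gt0 : (0 < d)%N.
Local Notation coef := (@coef R k d m).
Local Notation family := ('I_m -> 'cV[R]_k -> R).
Variables (C B kap rho r V K theta eta X0 Cchi dt g : R) (p : nat).
(** The radius in [V_ge] is that of [next_frob], so it covers all points one step away from the
    ball. The margin 1 keeps [u + V] at least 1, as the gain of the square at a switch requires. *)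
Hypotheses (C1 : 1 <= C) (dt01 : 0 < dt <= 1) (dtC : dt * d%:R * C ^+ 2 <= 1)
  (dtC8 : 8 * dt * C ^+ 2 <= 1) (B1 : 1 <= B) (kap0 : 0 <= kap) (K0 : 0 <= K)
  (rho0 : 0 <= rho) (Cchi_ge0 : 0 <= Cchi) (rho_ge : 6 * B ^+ 2 <= kap * rho)
  (Kr : 2 * V <= K * r) (th01 : 0 <= theta <= 1)
  (V_ge : forall y : 'cV[R]_k, frob y <= 2 * rho + 2 * ((2 + 2 * d%:R) * (C * (1 + rho))) ->
     B * poly p y <= V - 1)
  (g0 : 0 <= g)
  (poly_step : forall dt (beta : 'cV[R]_d) (x b : 'cV[R]_k) (s : 'M[R]_(k, d)),
    0 < dt <= 1 -> frob beta <= C ^+ 2 -> dt * d%:R * C ^+ 2 <= 1 ->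
    frob b <= C * (1 + frob x) -> frob s <= C * (1 + frob x) ->
    mean (fun w => wt dt beta w * poly (p + p).+1 (x + incr dt b s w))
      <= (1 + g * dt) * poly (p + p).+1 x).

Ltac clear_local := clear - R k d m d_gt0 C B kap rho r V K theta eta X0 Cchi dt g p C1 dt01 dtC dtC8 B1 kap0 K0
  rho0 Cchi_ge0 rho_ge Kr th01 V_ge g0 poly_step.

Definition near_pair (x x' : 'cV[R]_k) := [/\ frob x <= rho, frob x' <= rho & frob (x - x') <= r].

(** The generators are compared along the actual runs, so coefficients that are far apart are
    compatible too, with a larger [ef]. *)
Record compat (om ef : R) (cL cR : coef) (L Rf : family) : Prop := Compat {
  compat_drift : forall x x', near_pair x x' ->
    frob (drift cL x - drift cR x') <= C * frob (x - x') + om;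
  compat_vol : forall x x', near_pair x x' ->
    frob (vol cL x - vol cR x') <= C * frob (x - x') + om;
  compat_gen : forall x x' j, near_pair x x' ->
    `|genu cL dt L j x - genu cR dt Rf j x'| <=
    ef + C * (\sum_i `|L i x - Rf i x'|) + C * enorm (slope cL dt L j x - slope cR dt Rf j x');
  compat_cost : forall x x' i j, near_pair x x' -> j != i ->
    `|cost cL i j x - cost cR i j x'| <= theta * eta }.

(** [chi] goes with the values that enter a step, [chi'] with those that leave it. *)
Record potential (c : coef) (chi chi' : family) : Prop := Potential {
  potential_ge0 : forall i x, 0 <= chi i x;
  potential_ge0' : forall i x, 0 <= chi' i x;
  potential_le : forall i x, frob x <= rho -> chi i x <= X0;
  potential_step : forall j x (b : 'cV[R]_d), frob x <= rho -> frob b <= C ^+ 2 ->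
    mean (fun w => wt dt b w * chi j (next c dt x w)) <= chi' j x + Cchi * dt;
  potential_cost : forall i j x, frob x <= rho -> j != i ->
    chi' j x - chi' i x <= cost c i j x - eta }.

Lemma near_pairC x x' : near_pair x x' -> near_pair x' x.
Proof. by case=> ? ? ?; split => //; rewrite frobB_sym. Qed.

Lemma compatC om ef cL cR L Rf : compat om ef cL cR L Rf -> compat om ef cR cL Rf L.
Proof.
case=> h1 h2 h3 h4; split => x x'.
- by move=> /near_pairC H; rewrite frobB_sym [frob (x - _)]frobB_sym; exact: h1.
- by move=> /near_pairC H; rewrite frobB_sym [frob (x - _)]frobB_sym; exact: h2.
- move=> j /near_pairC H; rewrite distrC.
  rewrite /enorm -!/(frob _) [frob (slope cR _ _ _ _ - _)]frobB_sym.
  by under eq_bigr do rewrite distrC; exact: h3.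
- by move=> i j /near_pairC H ji; rewrite distrC; exact: h4.
Qed.

(** Rates of growth, in this order, of the squared separation, of the weight [poly], and of the
    differences of the components as seen by the generators. *)
Definition growth_exp : R :=
  2 + (3 + C ^+ 2 + 2 * d%:R) * C + g + C * m%:R.

Definition tilt_cost : R :=
  Cchi + 16 * V ^+ 2 * (d%:R * C ^+ 2) + 4 * V * (C * (1 + rho) ^+ p + C * m%:R * V)
  + 16 * V ^+ 2 * C ^+ 2 + 2 * (C * (1 + rho) ^+ p + C * m%:R * V) ^+ 2.

Definition step_error (om ef : R) : R :=
  K * ((3 + C ^+ 2 + 2 * d%:R) * om) + ef + C * m%:R * (theta * X0) + theta * tilt_cost.

(** Only one of the two inequalities is concluded, but both are assumed: together they bound the
    absolute differences [|L j x - Rf j x'|] that enter the generators. *)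
Lemma half_step (cL cR : coef) (L Rf chi chiR chi' : family) (a e a' e' om ef : R) :
  wf_coef C p cL -> wf_coef C p cR -> compat om ef cL cR L Rf -> potential cL chi chi' ->
  (forall i x, 0 <= chiR i x) -> (forall i x, frob x <= rho -> chiR i x <= X0) ->
  (forall i x, `|L i x| <= B * poly p x) -> (forall i x, `|Rf i x| <= B * poly p x) ->
  (forall i x, `|step cL dt L i x| <= B * poly p x) ->
  (forall i x, `|step cR dt Rf i x| <= B * poly p x) ->
  1 <= a -> 0 <= om -> 0 <= e -> 0 <= ef -> a * (1 + growth_exp * dt) <= a' ->
  e + dt * step_error om ef <= e' -> 4 * theta * V ^+ 2 <= e' ->
  (forall i x x', tilt theta V chi L i x - Rf i x' <= barrier K kap (p + p).+1 a e x x') ->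
  (forall i x x', tilt theta V chiR Rf i x - L i x' <= barrier K kap (p + p).+1 a e x x') ->
  forall i x x', tilt theta V chi' (step cL dt L) i x - step cR dt Rf i x'
     <= barrier K kap (p + p).+1 a' e' x x'.
Proof.
move=> wfL wfR cmp pot chiR0 chiRX LB RB SLB SRB a1 om0 e0 ef0 aa' ee' thV H1 H2 i x x'.
have /andP[dt0 dt1] := dt01.
have /andP[th0 th1] := th01.
have C0 : 0 <= C := le_trans ler01 C1.
pose rho' := 2 * rho + 2 * ((2 + 2 * d%:R) * (C * (1 + rho))).
have Vr (y : 'cV[R]_k) : frob y <= rho' -> B * poly p y <= V - 1 by exact: V_ge.
have rr' : rho <= rho'.
  have : 0 <= (2 + 2 * d%:R) * (C * (1 + rho)) by rewrite !(mulr_ge0, addr_ge0).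
  by rewrite /rho'; have := rho0; lra.
have V1 : 1 <= V.
  have := Vr 0; rewrite frob0 => /(_ (le_trans rho0 rr')).
  have : 0 <= B * poly p (0 : 'cV[R]_k).
    by rewrite mulr_ge0 ?(ltW (poly_gt0 _ _)) // (le_trans ler01 B1).
  lra.
have V0 : 0 <= V by lra.
have X0_ge0 : 0 <= X0.
  by apply: le_trans (chiR0 i 0) (chiRX _ _ _); rewrite frob0.
have a'1 : 1 <= a'.
  apply: (le_trans a1 (le_trans _ aa')).
  apply: ler_peMr; first by lra.
  by rewrite lerDl mulr_ge0 // ?(ltW dt0) // /growth_exp !(addr_ge0, mulr_ge0, sqr_ge0).
have [gp|bad] := pselect (near_pair x x'); last first.
  apply: (crude_bound (B := B) (rho := rho) (r := r)) => //.
  - move=> y yr; have := Vr _ (le_trans yr rr'); lra.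
  - by move=> y; exact: (potential_ge0' pot).
have [xr xr' xx'] := gp.
have Bf_le j : `|gen cL j x (\col_i L i x) 0| <= C * (1 + rho) ^+ p + C * m%:R * V.
  apply: le_trans (gen_le _ _ _ _ wfL) _.
  rewrite enorm0 addr0 -mulrA -mulrDr -mulrDr ler_wpM2l //.
  apply: lerD.
    by rewrite lerXn2r // ?nnegrE ?addr_ge0 ?frob_ge0 // lerD2l.
  apply: (le_trans (y := \sum_(l < m) V)).
    apply: ler_sum => l _; rewrite mxE; apply: le_trans (LB _ _) _.
    by have := Vr _ (le_trans xr rr'); lra.
  by rewrite sumr_const card_ord mulr_natl.
have sumY : \sum_j `|L j x - Rf j x'| <=
    m%:R * (barrier K kap (p + p).+1 a e x x' + theta * X0).
  apply: (le_trans (y := \sum_(j < m) (barrier K kap (p + p).+1 a e x x' + theta * X0))).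
    apply: ler_sum => j _; rewrite ler_norml.
    have h1 := H1 j x x'; have h2 := H2 j x' x; rewrite barrierC in h2.
    have q1 : 0 <= theta * (L j x + V) ^+ 2 by rewrite mulr_ge0 // sqr_ge0.
    have q2 : 0 <= theta * (Rf j x' + V) ^+ 2 by rewrite mulr_ge0 // sqr_ge0.
    have q3 := ler_wpM2l th0 (potential_le pot j xr).
    have q4 := ler_wpM2l th0 (chiRX j _ xr').
    move: h1 h2; rewrite /tilt; move: q1 q2 q3 q4; clear_local => *; apply/andP; split; lra.
  by rewrite sumr_const card_ord mulr_natl.
set S := \sum_j `|L j x - Rf j x'| in sumY.
have next_r (c : coef) w : wf_coef C p c -> frob (next c dt x w) <= rho'.
  by move=> wf; apply: (next_frob w wf C0 _ xr); rewrite (ltW dt0).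
have [b bC Hb] := @switch_step R k d m d_gt0 C V (C * (1 + rho) ^+ p + C * m%:R * V)
   (ef + C * S) Cchi theta eta dt p cL cR L Rf chi (chi' ^~ x)
   (fun w => barrier K kap (p + p).+1 a e (next cL dt x w) (next cR dt x' w)) x x' C1 dt01 dtC dtC8 wfL
   th0 V0 ltac:(by rewrite !(addr_ge0, mulr_ge0, exprn_ge0))
   ltac:(by move=> j w; apply: le_trans (LB _ _) _; have := Vr _ (next_r cL w wfL); lra)
   ltac:(by move=> j; apply: le_trans (SLB _ _) _; apply: Vr; apply: le_trans rr')
   Bf_le
   ltac:(by move=> j; apply: le_trans (ler_norm _) _; apply: compat_gen cmp _ _ _ gp)
   ltac:(by move=> j b' bC; apply: potential_step pot _ _ _ xr bC)
   ltac:(by move=> i' j ji; apply: potential_cost pot _ _ _ xr ji)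
   ltac:(by move=> i' j ji; apply: compat_cost cmp _ _ _ _ gp ji)
   ltac:(by move=> j w; apply: H1) i.
apply: le_trans Hb _.
have := @barrier_step R k d m d_gt0 C K kap a e om g dt p (p + p).+1 cL cR b x x' C1 dt01 dtC wfL wfR
   K0 kap0 ltac:(lra) om0 poly_step (compat_drift cmp gp) (compat_vol cmp gp) bC.
set M := mean _ => HM.
set D := frob (x - x') in HM sumY *.
have D0 : 0 <= D by exact: frob_ge0.
set P := poly _ x + _ in HM *.
have P0 : 0 <= P by rewrite addr_ge0 // ltW // poly_gt0.
have hS := ler_wpM2l C0 sumY.
have hS2 := ler_wpM2l (ltW dt0) hS.
have bE : barrier K kap (p + p).+1 a e x x' = a * (e + K * D + kap * P) by [].
rewrite bE in hS2.
rewrite -/tilt_cost.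
set s := e + K * D + kap * P in bE hS2.
have KD : 0 <= K * D by rewrite mulr_ge0.
have kP : 0 <= kap * P by rewrite mulr_ge0.
have s0 : 0 <= s by rewrite /s !addr_ge0.
have G0 : 0 <= growth_exp.
  by rewrite /growth_exp !(addr_ge0, mulr_ge0, sqr_ge0).
pose c3 : R := 3 + C ^+ 2 + 2 * d%:R.
have c30 : 0 <= c3 by rewrite /c3 !(addr_ge0, mulr_ge0, sqr_ge0).
have Cchi0 : 0 <= tilt_cost - Cchi.
  rewrite /tilt_cost; set bf := _ + C * m%:R * V.
  have bf0 : 0 <= bf by rewrite /bf !(addr_ge0, mulr_ge0, exprn_ge0).
  have t1 : 0 <= 16 * V ^+ 2 * (d%:R * C ^+ 2) by rewrite !(mulr_ge0, sqr_ge0).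
  have t2 : 0 <= 4 * V * bf by rewrite !(mulr_ge0, sqr_ge0).
  have t3 : 0 <= 16 * V ^+ 2 * C ^+ 2 by rewrite !(mulr_ge0, sqr_ge0).
  have h := sqr_ge0 bf; move: h t1 t2 t3; clear_local; lra.
have Cc : 0 <= Cchi by exact: Cchi_ge0.
pose rest := ef + C * m%:R * (theta * X0) + theta * tilt_cost.
have rest0 : 0 <= rest.
  have tc0 : 0 <= tilt_cost by move: Cchi0 Cc; clear_local; lra.
  apply: addr_ge0; last exact: mulr_ge0.
  by apply: addr_ge0 => //; rewrite !mulr_ge0.
have SE : step_error om ef = K * (c3 * om) + rest by rewrite /step_error /rest /c3; ring.
have se0 : 0 <= step_error om ef.
  by rewrite SE; apply: addr_ge0 => //; rewrite !mulr_ge0.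
have GE : growth_exp = 2 + c3 * C + g + C * m%:R by [].
(* It is enough to stay below the product of the two updated factors, whose cross term of order
   [dt ^ 2] is non-negative. *)
have RHS : a * (1 + growth_exp * dt) * (s + dt * step_error om ef) <=
    barrier K kap (p + p).+1 a' e' x x'.
  rewrite /barrier -/D -/P; apply: ler_pM => //; last by rewrite /s; move: ee'; clear_local; lra.
  - by rewrite mulr_ge0 ?addr_ge0 ?mulr_ge0 ?(ltW dt0) // (le_trans ler01).
  - by rewrite addr_ge0 // mulr_ge0 // ltW.
apply: le_trans RHS.
have a0 : 0 <= a := le_trans ler01 a1.
have adt : 0 <= a * dt by rewrite mulr_ge0 // ltW.
have h2 : dt * rest <= a * dt * rest by rewrite -mulrA ler_peMl // mulr_ge0 // ltW.
have h3 : (2 + c3 * C) * (K * D) + g * (kap * P) + C * m%:R * s <= growth_exp * s.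
  have i1 : (2 + c3 * C) * (K * D) <= (2 + c3 * C) * s.
    by rewrite ler_wpM2l ?addr_ge0 ?mulr_ge0 // /s; move: e0 KD kP; clear_local; lra.
  have i2 : g * (kap * P) <= g * s by rewrite ler_wpM2l // /s; move: e0 KD kP; clear_local; lra.
  rewrite GE; move: i1 i2; clear_local; lra.
have h4 := ler_wpM2l adt h3.
have h5 : 0 <= a * dt * (growth_exp * (dt * step_error om ef)).
  by rewrite !mulr_ge0 // ltW.
apply: (le_trans (y := M + dt * (C * (m%:R * (a * s + theta * X0))) + dt * ef
    + theta * dt * tilt_cost)).
  by rewrite /tilt_cost; move: HM hS2; clear_local; lra.
move: h2 h5; rewrite SE /rest => h2 h5.
rewrite -/c3 in HM.
move: HM h2 h4 h5; clear_local => HM h2 h4 h5; rewrite /s in h4 *; lra.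
Qed.

Lemma seq_double (N : nat) (cL cR : nat -> coef) (L Rf chiL chiR : nat -> family)
    (om ef e : nat -> R) (eps1 : R) :
  (forall l, (l < N)%N -> [/\ wf_coef C p (cL l), wf_coef C p (cR l),
     compat (om l) (ef l) (cL l) (cR l) (L l) (Rf l), potential (cL l) (chiL l) (chiL l.+1) &
     potential (cR l) (chiR l) (chiR l.+1)]) ->
  (forall i x, 0 <= chiL 0%N i x) -> (forall i x, 0 <= chiR 0%N i x) ->
  (forall l, L l.+1 = step (cL l) dt (L l)) -> (forall l, Rf l.+1 = step (cR l) dt (Rf l)) ->
  (forall l i x, (l <= N)%N -> `|L l i x| <= B * poly p x) ->
  (forall l i x, (l <= N)%N -> `|Rf l i x| <= B * poly p x) ->
  (forall l, [/\ 0 <= om l, 0 <= ef l & e l + dt * step_error (om l) (ef l) <= e l.+1]) ->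
  (forall l, 4 * theta * V ^+ 2 <= e l) -> eps1 + 4 * theta * V ^+ 2 <= e 0%N ->
  (forall i x x', near_pair x x' -> `|L 0%N i x - Rf 0%N i x'| <= eps1) ->
  forall l, (l <= N)%N -> forall i x x',
    tilt theta V (chiL l) (L l) i x - Rf l i x'
      <= barrier K kap (p + p).+1 (expR (growth_exp * dt * l%:R)) (e l) x x' /\
    tilt theta V (chiR l) (Rf l) i x - L l i x'
      <= barrier K kap (p + p).+1 (expR (growth_exp * dt * l%:R)) (e l) x x'.
Proof.
move=> data chiL0 chiR0 LS RS LB RB err e_ge e0_ge init.
have /andP[dt0 dt1] := dt01.
have /andP[th0 th1] := th01.
have C0 : 0 <= C := le_trans ler01 C1.
have B0 : 0 <= B := le_trans ler01 B1.
have G0 : 0 <= growth_exp by rewrite /growth_exp !(addr_ge0, mulr_ge0, sqr_ge0).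
have thV : 0 <= 4 * theta * V ^+ 2 by rewrite mulr_ge0 ?sqr_ge0 // mulr_ge0.
have rr : rho <= 2 * rho + 2 * ((2 + 2 * d%:R) * (C * (1 + rho))).
  have : 0 <= (2 + 2 * d%:R) * (C * (1 + rho)) by rewrite !(mulr_ge0, addr_ge0).
  by have := rho0; lra.
have BV (y : 'cV[R]_k) : frob y <= rho -> B * poly p y <= V.
  by move=> yr; have := V_ge (le_trans yr rr); lra.
have V0 : 0 <= V.
  apply: (le_trans _ (BV 0 _)); last by rewrite frob0.
  by rewrite mulr_ge0 // ltW // poly_gt0.
have base (U W chi : family) i x x' :
    (forall i x, `|U i x| <= B * poly p x) -> (forall i x, `|W i x| <= B * poly p x) ->
    (forall i x, 0 <= chi i x) ->
    (forall x x', near_pair x x' -> `|U i x - W i x'| <= eps1) ->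
    tilt theta V chi U i x - W i x' <= barrier K kap (p + p).+1 1 (e 0%N) x x'.
  move=> UB WB chi0 UW.
  have [gp|bad] := pselect (near_pair x x'); last first.
    by apply: (crude_bound (B := B) (rho := rho) (r := r)).
  have [xr xr' _] := gp.
  have h1 : 0 <= K * frob (x - x') by rewrite mulr_ge0 // frob_ge0.
  have h2 : 0 <= kap * (poly (p + p).+1 x + poly (p + p).+1 x').
    by rewrite mulr_ge0 // addr_ge0 // ltW // poly_gt0.
  have h3 := le_trans (ler_norm _) (UW _ _ gp).
  have h4 : theta * (U i x + V) ^+ 2 <= theta * (4 * V ^+ 2).
    rewrite ler_wpM2l //; have := le_trans (UB i x) (BV _ xr).
    rewrite ler_norml => /andP[u1 u2].
    have -> : 4 * V ^+ 2 = (2 * V) ^+ 2 by ring.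
    by rewrite lerXn2r // ?nnegrE; move: u1 u2 V0; clear_local; lra.
  have h5 : 0 <= theta * chi i x by rewrite mulr_ge0.
  move: e0_ge; rewrite /tilt /barrier => e0_ge; lra.
elim=> [|l IH] lN i x x'.
  rewrite mulr0 expR0; split.
    apply: base => //; [by move=> ? ?; exact: LB| by move=> ? ?; exact: RB|].
    by move=> y y'; exact: init.
  apply: base => //; [by move=> ? ?; exact: RB| by move=> ? ?; exact: LB|].
  by move=> y y' /near_pairC yy'; rewrite distrC; exact: init.
have [wfL wfR cmp potL potR] := data l lN.
have [om0 ef0 ee] := err l.
have {}IH := IH (ltnW lN).
(* The exponential absorbs the factor of each step, so the final bound depends on the elapsed time
   and not on the number of steps. *)
have aE : expR (growth_exp * dt * l%:R) * (1 + growth_exp * dt) <= expR (growth_exp * dt * l.+1%:R).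
  have -> : expR (growth_exp * dt * l.+1%:R) =
      expR (growth_exp * dt * l%:R) * expR (growth_exp * dt).
    by rewrite -expRD -natr1 [in LHS]mulrDr mulr1.
  by rewrite ler_wpM2l ?expR_ge0 // expR_ge1Dx.
have a1 : 1 <= expR (growth_exp * dt * l%:R).
  by rewrite -expR0 ler_expR !mulr_ge0 // ltW.
have e0 : 0 <= e l := le_trans thV (e_ge l).
have LBl := fun i x => LB l i x (ltnW lN).
have RBl := fun i x => RB l i x (ltnW lN).
have LBS := fun i x => LB l.+1 i x lN.
have RBS := fun i x => RB l.+1 i x lN.
rewrite LS in LBS *; rewrite RS in RBS *.
split.
  apply: (half_step wfL wfR cmp potL (potential_ge0 potR) (potential_le potR) LBl RBl LBS RBS
    a1 om0 e0 ef0 aE ee (e_ge _)) => j y y'; [exact: (IH j y y').1 | exact: (IH j y y').2].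
apply: (half_step wfR wfL (compatC cmp) potR (potential_ge0 potL) (potential_le potL) RBl LBl RBS LBS
    a1 om0 e0 ef0 aE ee (e_ge _)) => j y y'; [exact: (IH j y y').2 | exact: (IH j y y').1].
Qed.

End Sequences.

(** * Neighbourhoods and compactness in the strip *)

Section Topology.
Context {R : realType}.

Lemma nbhs_frobP a b (t : R) (x : 'M[R]_(a, b)) (A : set (R * 'M[R]_(a, b))) :
  nbhs (t, x) A <-> exists2 r : R, 0 < r &
    forall t' x', `|t' - t| < r -> frob (x' - x) < r -> A (t', x').
Proof.
split.
  case/nbhs_ballP => e /= e0 eA; exists (Num.min e (e ^+ 2)).
    by rewrite lt_min e0 exprn_gt0.
  move=> t' x'; rewrite !lt_min => /andP[te _] /andP[_ xe]; apply: eA; split => /=.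
    by rewrite /ball /= distrC.
  split => // i j; rewrite /ball /= distrC.
  have := le_lt_trans (coord_frob (x' - x) i j) xe.
  rewrite !mxE -(real_normK (num_real (x' i j - x i j))) => h.
  by rewrite -(ltr_pXn2r (n := 2)) ?nnegrE ?normr_ge0 ?(ltW e0).
case=> r r0 H; apply/nbhs_ballP.
pose n : R := a%:R * b%:R.
have n0 : 0 <= n by rewrite mulr_ge0.
pose e := Num.min 1 (r / (n + 2)).
have e0 : 0 < e by rewrite lt_min ltr01 divr_gt0 // ltr_wpDl.
have e1 : e <= 1 by rewrite ge_min lexx.
have er : e * (n + 2) <= r.
  by rewrite -ler_pdivlMr ?ltr_wpDl // ge_min lexx orbT.
exists e => // -[t' x'] [/= bt [_ bx]]; apply: H.
  move: bt; rewrite /ball /= distrC => bt; apply: lt_le_trans bt _.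
  have : 0 <= e * n by rewrite mulr_ge0 // ltW.
  lra.
apply: (@le_lt_trans _ _ (n * e)).
  apply: frob_coord_le => i j; rewrite !mxE -real_normK ?num_real //.
  have := bx i j; rewrite /ball /= distrC => h.
  have h2 : `|x' i j - x i j| ^+ 2 <= `|x' i j - x i j|.
    by rewrite expr2 ler_piMl // (le_trans (ltW h)).
  by apply: le_trans h2 (ltW h).
by apply: lt_le_trans er; rewrite mulrC ltr_pM2l // ltrDl.
Qed.

Lemma near_stripP k (T t : R) (x : 'cV[R]_k) (P : R * 'cV[R]_k -> Prop) :
  (\forall tx' \near within (strip T) (nbhs (t, x)), P tx') <->
  exists2 r : R, 0 < r & forall t' x', 0 <= t' <= T -> `|t' - t| < r -> frob (x' - x) < r ->
    P (t', x').
Proof.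
rewrite near_withinE; split.
  case/nbhs_frobP => r r0 H; exists r => // t' x' t'T tr xr; apply: H => //.
case=> r r0 H; apply/nbhs_frobP; exists r => // t' x' tr xr [/= t'T _].
by apply: H => //; move: t'T; rewrite in_itv.
Qed.

(** Compactness turns a property that holds eventually near each point into one that holds
    eventually on the whole ball. The filter is arbitrary because it serves both for radii tending
    to 0 and for step numbers along an ultrafilter. *)
Lemma strip_cover k (T rho : R) (I : Type) (F : set_system I) (FF : Filter F)
    (P : I -> R -> 'cV[R]_k -> Prop) :
  (forall t x, 0 <= t <= T -> exists2 r : R, 0 < r & \forall i \near F, forall t' x',
     0 <= t' <= T -> `|t' - t| < r -> frob (x' - x) < r -> P i t' x') ->
  \forall i \near F, forall t x, 0 <= t <= T -> frob x <= rho -> P i t x.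
Proof.
(* [1 + |rho|] dominates the square root of [rho], hence all coordinates of a point of the ball; the
   box is made of row vectors, and points are transposed into it. *)
move=> H; pose c : R := 1 + `|rho|.
pose K : set (R * 'rV[R]_k) := `[0, T]%classic `*` [set v : 'rV[R]_k | forall i, `[(- c), c]%classic (v ord0 i)].
have cK : compact K.
  apply: compact_setX; first exact: segment_compact.
  by apply: (@rV_compact _ _ (fun=> `[(- c), c]%classic)) => _; exact: segment_compact.
move/compact_near_coveringP/near_covering_withinP: cK.
move=> /(_ I F (fun i tv => P i tv.1 tv.2^T) FF) cK.
suff h0 : forall tv, K tv -> \forall tv' \near tv & i \near F, K tv' -> P i tv'.1 tv'.2^T.
  apply: (filterS _ (cK h0)) => i Hi t x tT xr.
  rewrite -[x]trmxK; apply: (Hi (t, x^T)); split => /=; first by rewrite in_itv.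
  move=> j; rewrite /= in_itv /= -ler_norml mxE.
  have h1 : `|x j 0| ^+ 2 <= `|rho|.
    rewrite real_normK ?num_real //; apply: le_trans (coord_frob _ _ _) _.
    exact: le_trans xr (ler_norm _).
  rewrite /c; have := sqr_ge0 (`|x j 0| - 1); have := normr_ge0 (x j 0).
  have [//|h] := leP `|x j 0| (1 + `|rho|).
  have : `|x j 0| * `|x j 0| <= `|rho| by rewrite -expr2.
  have : `|x j 0| * 1 <= `|x j 0| * `|x j 0|.
    by rewrite ler_wpM2l // (le_trans _ (ltW h)) // lerDl.
  lra.
move=> [t v] [/= tT _]; rewrite in_itv /= in tT.
have [r r0 Hr] := H t v^T tT.
exists ([set tv : R * 'rV[R]_k | `|tv.1 - t| < r /\ frob (tv.2 - v) < r],
   [set i | forall t' x', 0 <= t' <= T -> `|t' - t| < r -> frob (x' - v^T) < r -> P i t' x']).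
  by split; [apply/nbhs_frobP; exists r | exact: Hr].
move=> [[t' v'] i] [/= [h1 h2] Hi] [/= t'T _].
rewrite /= in_itv /= in t'T.
by apply: Hi => //; rewrite -linearB /= frob_tr.
Qed.

Lemma near0_ex (P : R -> Prop) : (\forall r \near (0 : R)^'+, P r) -> exists2 r, 0 < r & P r.
Proof.
move=> H; near ((0 : R)^'+) => r; exists r; near: r; [exact: nbhs_right_gt | exact: H].
Unshelve. all: by end_near. Qed.

(** The index set may be infinite: continuity of [f] uniformly in [(y, z)] is one instance,
    continuity of the finitely many entries or costs another. *)
Definition equicontinuous_strip k (T : R) (J : Type) (F : J -> R * 'cV[R]_k -> R) : Prop :=
  forall t x, 0 <= t <= T -> forall e : R, 0 < e -> exists2 r : R, 0 < r &
    forall t' x', 0 <= t' <= T -> `|t' - t| < r -> frob (x' - x) < r ->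
    forall j, `|F j (t', x') - F j (t, x)| <= e.

Lemma frob_triangle a b (x y z : 'M[R]_(a, b)) :
  frob (x - z) <= 2 * frob (x - y) + 2 * frob (y - z).
Proof. by apply: le_trans (frobD_le _ _); rewrite addrA subrK. Qed.

Lemma uniform_on_strip k (T : R) (J : Type) (F : J -> R * 'cV[R]_k -> R) (rho e : R) :
  equicontinuous_strip T F -> 0 < e ->
  exists2 r : R, 0 < r & forall t t' x x', 0 <= t <= T -> 0 <= t' <= T -> frob x <= rho ->
    `|t - t'| <= r -> frob (x - x') <= r -> forall j, `|F j (t, x) - F j (t', x')| <= e.
Proof.
move=> Fc e0.
suff /near0_ex[r r0 Hr] : \forall r \near (0 : R)^'+, forall t x, 0 <= t <= T -> frob x <= rho ->
    forall t' x', 0 <= t' <= T ->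
    `|t - t'| <= r -> frob (x - x') <= r -> forall j, `|F j (t, x) - F j (t', x')| <= e.
  by exists r => // t t' x x' tT t'T xr; exact: Hr.
apply: strip_cover => t0 x0 t0T.
have e20 : 0 < e / 2 by rewrite divr_gt0.
have [r r0 Hr] := Fc t0 x0 t0T _ e20.
exists (r / 4); first by rewrite divr_gt0.
near=> q.
have qr : q <= r / 4 by near: q; apply: nbhs_right_le; rewrite divr_gt0.
move=> t x tT tr xr t' x' t'T tt' xx' j.
have h1 : `|F j (t, x) - F j (t0, x0)| <= e / 2 by apply: Hr => //; lra.
have h2 : `|F j (t', x') - F j (t0, x0)| <= e / 2.
  apply: Hr => //.
    have := ler_distD t t' t0; rewrite (distrC t' t); lra.
  have := frob_triangle x' x x0; rewrite (frobB_sym x' x); lra.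
have := ler_distD (F j (t0, x0)) (F j (t, x)) (F j (t', x')).
rewrite (distrC (F j (t0, x0))); lra.
Unshelve. all: by end_near. Qed.

End Topology.

(** * A potential that decreases along cheap switches *)

Section SwitchingPotential.
Context {R : realType}.

(** The rank counts the vertices that can be reached: along an edge this set shrinks, and strictly,
    since the source of the edge is lost. *)
Lemma acyclic_rank (I : finType) (e : rel I) :
  (forall i j, e i j -> ~~ connect e j i) ->
  exists2 rk : I -> nat, (forall i, (rk i <= #|I|)%N) & forall i j, e i j -> (rk j < rk i)%N.
Proof.
move=> acyc; exists (fun i => #|[set j | connect e i j]%SET|) => [i|i j eij].
  exact: max_card.
apply: proper_card; apply/properP; split.
  apply/fintype.subsetP => l; rewrite !inE => jl.
  exact: connect_trans (connect1 eij) jl.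
by exists i; rewrite !inE ?connect0 // acyc.
Qed.

(** A way back along free edges, made simple by [shortenP] and closed by the edge from [i] to [j],
    would be a loop of total cost 0. *)
Lemma free_edges_acyclic m (g : 'I_m -> 'I_m -> R) :
  (forall (N : nat) (c : nat -> 'I_m), (3 <= N)%N -> c 1%N = c N ->
    #|[set c n.+1 | n : 'I_N]%SET| = (N - 1)%N -> 0 < \sum_(1 <= n < N) g (c n) (c n.+1)) ->
  forall i j, (i != j) && (g i j == 0) ->
    ~~ connect (fun i j => (i != j) && (g i j == 0)) j i.
Proof.
set e := fun i j => (i != j) && (g i j == 0).
move=> loop i j eij; apply/negP => /connectP[p0 pth0 lst0].
case/shortenP: pth0 lst0 => p pth uq _ lst.
pose s := j :: p.
(* Positions count from 1 as in the loop condition: [c 1] is [i], and [c 2, ..., c N] run through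
   [s] with [N = size p + 2]. *)
pose c n := nth i (i :: s) n.-1.
have p_gt0 : (0 < size p)%N.
  case: p pth lst {uq s c} => //= _ ij.
  by case/andP: eij => /eqP; rewrite ij.
have := loop (size p).+2 c.
have cN : c 1%N = c (size p).+2.
  by rewrite /c /= -[size p]/((size s).-1) nth_last.
have cset : [set c n.+1 | n : 'I_(size p).+2]%SET = [set x in s]%SET.
  apply/setP => x; rewrite inE; apply/imsetP/idP.
    move=> [[[|n] nlt] _ ->]; rewrite /c /=.
      by rewrite lst /= mem_last.
    by apply: mem_nth; rewrite ltnS in nlt.
  move=> xs; have lt : ((index x s).+1 < (size p).+2)%N by rewrite ltnS index_mem.
  by exists (Ordinal lt) => //; rewrite /c /= nth_index.
rewrite cset cardsE (card_uniqP uq) /= subn1 => /(_ _ cN erefl).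
rewrite !ltnS p_gt0 => /(_ isT).
rewrite big_nat big1 ?ltxx // => n /andP[n1 n2].
have pth' : path e i s by rewrite /= pth andbT.
have := @pathP _ e i s i; move/elimT => /(_ pth' n.-1).
rewrite /= prednK // => /(_ n2).
by rewrite /c; case: n n1 {n2} => // n _ /= /andP[_ /eqP].
Qed.

Variables (k m : nat) (T : R) (g : 'I_m -> 'I_m -> R * 'cV[R]_k -> R).
Hypotheses (T0 : 0 <= T)
  (g_cont : equicontinuous_strip T (fun (ij : 'I_m * 'I_m) tx =>
      if ij.1 != ij.2 then g ij.1 ij.2 tx else 0))
  (g_ge0 : forall i j t x, i != j -> 0 <= t <= T -> 0 <= g i j (t, x))
  (g_loop : no_free_loop T g).

(** The rank has to drop across cheap edges only. The factor [m + 1] lets the cost of any other edge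
    exceed the whole range [eta * m] of the potential, with [eta] to spare. *)
Definition rank_at (eta : R) (t : R) (x : 'cV[R]_k) (rk : 'I_m -> nat) : Prop :=
  (forall i, (rk i <= m)%N) /\
  (forall i j, i != j -> (rk j < rk i)%N \/ (m.+1)%:R * eta <= g i j (t, x)).

(** A ranking of the free edges at one point remains valid around it, where the positive costs stay
    above half of their minimum. Compactness makes [eta] uniform, while the ranking still varies
    with the point. *)
Lemma rank_exists (rho : R) : exists2 eta : R, 0 < eta &
  forall t x, 0 <= t <= T -> frob x <= rho -> exists rk, rank_at eta t x rk.
Proof.
apply: near0_ex; apply: strip_cover => t0 x0 t0T.
have t0s : strip T (t0, x0) by split => //=; rewrite in_itv.
have [rk rkm rklt] := @acyclic_rank _ _ (@free_edges_acyclic m (fun i j => g i j (t0, x0)) (g_loop t0s)).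
rewrite card_ord in rkm.
(* The default value 1 replaces loops and free edges and keeps the minimum positive. *)
pose gg (ij : 'I_m * 'I_m) := if (ij.1 != ij.2) && (0 < g ij.1 ij.2 (t0, x0)) then g ij.1 ij.2 (t0, x0) else 1.
pose mu := \big[Num.min/1]_ij gg ij.
have mu0 : 0 < mu.
  rewrite /mu; elim/big_rec: _ => // ij y _ y0; rewrite lt_min y0 andbT /gg.
  by case: ifP => // /andP[].
have mu_le i j : i != j -> 0 < g i j (t0, x0) -> mu <= g i j (t0, x0).
  move=> ij gij; have : mu <= gg (i, j) by exact: bigmin_le_cond.
  by rewrite /gg /= ij gij.
have mu2 : 0 < mu / 2 by rewrite divr_gt0.
have [r r0 Hr] := g_cont x0 t0T mu2.
exists r => //; near=> eta => t x tT tr xr.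
exists rk; split => // i j ij.
have [g0|gn0] := eqVneq (g i j (t0, x0)) 0.
  by left; apply: rklt; rewrite ij g0 eqxx.
right; have gpos : 0 < g i j (t0, x0) by rewrite lt_def gn0 g_ge0.
have := Hr t x tT tr xr (i, j); rewrite /= ij ler_norml => /andP[h _].
have := mu_le _ _ ij gpos.
have : m.+1%:R * eta <= mu / 2.
  rewrite mulrC -ler_pdivlMr ?ltr0Sn //; near: eta; apply: nbhs_right_le.
  by rewrite divr_gt0 // ltr0Sn.
lra.
Unshelve. all: by end_near. Qed.

(* Unlike the ranks themselves, semiconcave in [(t, x)]. *)
Definition convolved (rho eta lc : R) (i : 'I_m) (t : R) (x : 'cV[R]_k) : R :=
  inf [set z | exists s y rk, [/\ 0 <= s <= T, frob y <= rho, rank_at eta s y rk &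
    z = eta * (rk i)%:R + lc * ((t - s) ^+ 2 + frob (x - y))]].

Section Convolved.
Variables (rho eta lc : R).
Hypotheses (rho0 : 0 <= rho) (eta0 : 0 < eta) (lc0 : 0 <= lc)
  (rkH : forall t x, 0 <= t <= T -> frob x <= rho -> exists rk, rank_at eta t x rk).

Let E i t x := [set z | exists s y rk, [/\ 0 <= s <= T, frob y <= rho, rank_at eta s y rk &
    z = eta * (rk i)%:R + lc * ((t - s) ^+ 2 + frob (x - y))]].

Let E_ge0 i t x : lbound (E i t x) 0.
Proof.
move=> _ [s [y [rk [_ _ _ ->]]]].
by rewrite addr_ge0 ?mulr_ge0 ?addr_ge0 ?sqr_ge0 ?frob_ge0 // ltW.
Qed.

Let E_inf i t x : has_inf (E i t x).
Proof.
split; last by exists 0; exact: E_ge0.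
have [rk Hrk] := @rkH 0 0 ltac:(by rewrite lexx T0) ltac:(by rewrite frob0).
exists (eta * (rk i)%:R + lc * ((t - 0) ^+ 2 + frob (x - 0))), 0, 0, rk; split => //.
  by rewrite lexx.
by rewrite frob0.
Qed.

Lemma convolved_ge0 i t x : 0 <= convolved rho eta lc i t x.
Proof. by apply: lb_le_inf; [exact: (E_inf i t x).1 | exact: E_ge0]. Qed.

Lemma convolved_le i t x s y rk : 0 <= s <= T -> frob y <= rho -> rank_at eta s y rk ->
  convolved rho eta lc i t x <= eta * (rk i)%:R + lc * ((t - s) ^+ 2 + frob (x - y)).
Proof.
move=> sT yr Hrk; apply: ge_inf; first by exists 0; exact: E_ge0.
by exists s, y, rk.
Qed.

Lemma convolved_near i t x (e : R) : 0 < e -> exists s y rk,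
  [/\ 0 <= s <= T, frob y <= rho, rank_at eta s y rk &
    eta * (rk i)%:R + lc * ((t - s) ^+ 2 + frob (x - y)) <= convolved rho eta lc i t x + e].
Proof.
move=> e0; have [_ [s [y [rk [sT yr Hrk ->]]]] lt] := inf_adherent e0 (E_inf i t x).
by exists s, y, rk; split => //; exact: ltW.
Qed.

Lemma convolved_bound i t x : 0 <= t <= T -> frob x <= rho ->
  convolved rho eta lc i t x <= eta * m%:R.
Proof.
move=> tT xr; have [rk Hrk] := rkH tT xr.
apply: le_trans (convolved_le i t x tT xr Hrk) _.
rewrite !subrr expr0n frob0 addr0 mulr0 addr0 ler_wpM2l ?(ltW eta0) // ler_nat.
exact: Hrk.1.
Qed.

(** A near minimizer for [i] is a competitor for [j] with the same quadratic term, so the potentials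
    differ by at most [eta * (rk j - rk i) + eta / 4]. The size of [lc] forces this point so close
    to [(t, x)] that the cost changes by at most [eta / 4] in between. *)
Lemma convolved_cost (r : R) i j t x : 0 < r -> 0 <= t <= T -> frob x <= rho -> j != i ->
  eta * m.+1%:R <= lc * r -> eta * m.+1%:R <= lc * r ^+ 2 ->
  (forall s y, 0 <= s <= T -> frob y <= rho -> `|t - s| <= r -> frob (x - y) <= r ->
     `|g i j (t, x) - g i j (s, y)| <= eta / 4) ->
  convolved rho eta lc j t x - convolved rho eta lc i t x <= g i j (t, x) - eta / 2.
Proof.
move=> r0 tT xr ji H1 H2 Hg.
have e4 : 0 < eta / 4 by rewrite divr_gt0.
have [s [y [rk [sT yr Hrk Hn]]]] := convolved_near i t x e4.
have Hj := convolved_le j t x sT yr Hrk.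
have Hb := convolved_bound i tT xr.
have rk0 : 0 <= eta * (rk i)%:R by rewrite mulr_ge0 // ltW.
have S : lc * ((t - s) ^+ 2 + frob (x - y)) <= eta * m.+1%:R by rewrite -natr1; lra.
have lc_gt0 : 0 < lc.
  rewrite lt_def lc0 andbT; apply/eqP => l0; move: H1; rewrite l0 mul0r.
  by rewrite leNgt mulr_gt0 // ltr0Sn.
have fr := frob_ge0 (x - y); have sq := sqr_ge0 (t - s).
have ts : `|t - s| <= r.
  rewrite -(ler_pXn2r (n := 2)) ?nnegrE ?(ltW r0) // real_normK ?num_real //.
  rewrite -(ler_pM2l lc_gt0); apply: le_trans H2; apply: le_trans S.
  by rewrite ler_pM2l // lerDl.
have xy : frob (x - y) <= r.
  rewrite -(ler_pM2l lc_gt0); apply: le_trans H1; apply: le_trans S.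
  by rewrite ler_pM2l // lerDr.
have := Hg s y sT yr ts xy; rewrite ler_norml => /andP[gl _].
have ij : i != j by rewrite eq_sym.
have gs0 := g_ge0 y ij sT.
case: (Hrk.2 i j ij) => [lt|ge].
  have : eta * ((rk j)%:R + 1) <= eta * (rk i)%:R.
    by rewrite ler_pM2l // natr1 ler_nat.
  lra.
have : eta * (rk j)%:R <= eta * m%:R by rewrite ler_pM2l // ler_nat; exact: Hrk.1.
move: ge; rewrite -natr1; lra.
Qed.

(** The competitor that is optimal up to [dt] at [(t, x)] is kept at all next points. Only its
    paraboloid changes, by order [dt] in mean: this is the use of semiconcavity. *)
Lemma convolved_step d (C dt : R) p (c : @coef R k d m) (b : 'cV[R]_d) j t t' x :
  (0 < d)%N -> 0 <= C -> 0 < dt <= 1 -> dt * d%:R * C ^+ 2 <= 1 -> wf_coef C p c ->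
  0 <= t <= T -> 0 <= t' <= T -> `|t' - t| <= dt -> frob x <= rho -> frob b <= C ^+ 2 ->
  mean (fun w => wt dt b w * convolved rho eta lc j t' (next c dt x w)) <=
  convolved rho eta lc j t x +
   (1 + lc * (2 * T + 8 * rho + (3 + C ^+ 2 + 2 * d%:R) * (C * (1 + rho)))) * dt.
Proof.
move=> d0 C0 dt01 dtC wf tT t'T tt xr bC.
have /andP[dt0 dt1] := dt01.
have [s [y [rk [sT yr Hrk Hn]]]] := convolved_near j t x dt0.
apply: (le_trans (y := mean (fun w => wt dt b w *
   (eta * (rk j)%:R + lc * ((t' - s) ^+ 2 + frob (next c dt x w - y)))))).
  by apply: (mean_wt_le (ltW dt0) bC dtC) => w; exact: convolved_le.
have EE w : wt dt b w * (eta * (rk j)%:R + lc * ((t' - s) ^+ 2 + frob (next c dt x w - y))) =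
   wt dt b w * (eta * (rk j)%:R + lc * (t' - s) ^+ 2) +
   lc * (wt dt b w * frob ((x - y) + incr dt (drift c x) (vol c x) w)).
  by rewrite /next addrAC; ring.
rewrite (eq_mean EE) meanD mean_wt_cst // meanZ.
have xC : C * (1 + frob x) <= C * (1 + rho) by rewrite ler_wpM2l // lerD2l.
have := mean_wt_frob d0 (x - y) dt01 bC dtC (le_trans (wf_drift wf x) xC) (le_trans (wf_vol wf x) xC).
set F := mean _ => HF.
have xy : frob (x - y) <= 4 * rho.
  apply: le_trans (frobD_le _ _) _; rewrite frobN; lra.
have ts : (t' - s) ^+ 2 <= (t - s) ^+ 2 + dt * (2 * T).
  have -> : (t' - s) ^+ 2 = (t - s) ^+ 2 + (t' - t) * (t' + t - 2 * s) by ring.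
  rewrite lerD2l; apply: le_trans (ler_norm _) _; rewrite normrM ler_pM //.
  rewrite ler_norml; move: tT t'T sT => /andP[? ?] /andP[? ?] /andP[? ?].
  by apply/andP; split; lra.
have h1 := ler_wpM2l lc0 HF; have h2 := ler_wpM2l lc0 ts.
have h3 : lc * dt * (2 * frob (x - y)) <= lc * dt * (8 * rho).
  by rewrite ler_wpM2l ?mulr_ge0 ?(ltW dt0) //; lra.
lra.
Qed.

End Convolved.
End SwitchingPotential.

(** * The discrete solutions: bounds and equicontinuity *)

Section DiscreteSolution.
Context {R : realType}.
Variables (T : R) (k d m : nat) (b : R * 'cV[R]_k -> 'cV[R]_k)
  (sigma : R * 'cV[R]_k -> 'M[R]_(k, d))
  (f : 'I_m -> R * 'cV[R]_k -> 'cV[R]_m -> 'cV[R]_d -> R)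
  (g : 'I_m -> 'I_m -> R * 'cV[R]_k -> R) (h : 'I_m -> 'cV[R]_k -> R) (C : R) (p : nat).
(** The factor 2 in [b_lip] and [s_lip] anticipates the triangle inequality for squared norms. *)
Hypotheses (T0 : 0 < T) (d0 : (0 < d)%N) (C1 : 1 <= C)
  (b_growth : forall t x, 0 <= t <= T -> frob (b (t, x)) <= C * (1 + frob x))
  (s_growth : forall t x, 0 <= t <= T -> frob (sigma (t, x)) <= C * (1 + frob x))
  (b_lip : forall t x x', 0 <= t <= T -> 2 * frob (b (t, x) - b (t, x')) <= C * frob (x - x'))
  (s_lip : forall t x x', 0 <= t <= T ->
     2 * frob (sigma (t, x) - sigma (t, x')) <= C * frob (x - x'))
  (f_growth : forall i t x, 0 <= t <= T -> `|f i (t, x) 0 0| <= C * poly p x)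
  (f_lip : forall i t x y z y' z', 0 <= t <= T -> `|f i (t, x) y z - f i (t, x) y' z'|
     <= C * (\sum_j `|y j 0 - y' j 0| + enorm (z - z')))
  (h_growth : forall i x, `|h i x| <= C * poly p x)
  (b_cont : equicontinuous_strip T (fun i tx => b tx i 0))
  (s_cont : equicontinuous_strip T (fun ij tx => sigma tx ij.1 ij.2))
  (f_cont : equicontinuous_strip T (fun iyz tx => f iyz.1.1 tx iyz.1.2 iyz.2))
  (h_cont : equicontinuous_strip T (fun i tx => h i tx.2))
  (g_cont : equicontinuous_strip T (fun (ij : 'I_m * 'I_m) tx =>
      if ij.1 != ij.2 then g ij.1 ij.2 tx else 0))
  (g_ge0 : forall i j t x, i != j -> 0 <= t <= T -> 0 <= g i j (t, x))
  (g_loop : no_free_loop T g)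
  (h_obs : forall i j x, j != i -> h j x - g i j (T, x) <= h i x).

Let C0 : 0 <= C := le_trans ler01 C1.

Ltac clear_local := clear - R T k d m b sigma f g h C p T0 d0 C1 b_growth s_growth b_lip s_lip f_growth
  f_lip h_growth b_cont s_cont f_cont h_cont g_cont g_ge0 g_loop h_obs C0.

Definition coef_at (t : R) : coef := Coef (fun x => b (t, x)) (fun x => sigma (t, x))
  (fun i x y z => f i (t, x) y z) (fun i j x => g i j (t, x)).

(* the terminal datum [h] is a fixed point of the scheme with these coefficients *)
Definition coef_end : @coef R k d m := Coef (fun=> 0) (fun=> 0) (fun _ _ _ _ => 0)
  (fun i j x => g i j (T, x)).

(* [disc N l] has [l] steps left before the terminal time. *)
Definition tstep (N : nat) : R := T / N%:R.
(** The cut at 0 acts only for [l > N]; it keeps all clocks in [[0,T]], so the coefficients are well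
    formed for every [l]. *)
Definition clock (N l : nat) : R := Num.max 0 (T - l%:R * tstep N).
Fixpoint disc (N l : nat) : 'I_m -> 'cV[R]_k -> R :=
  if l is l'.+1 then step (coef_at (clock N l)) (tstep N) (disc N l') else h.

Lemma tstep_ge0 N : 0 <= tstep N.
Proof. by rewrite divr_ge0 // ltW. Qed.

Lemma clock_strip N l : 0 <= clock N l <= T.
Proof.
by rewrite /clock le_max lexx /= ge_max (ltW T0) /= gerBl mulr_ge0 // tstep_ge0.
Qed.

Lemma clock0 N : clock N 0 = T.
Proof. by rewrite /clock mul0r subr0 max_r // ltW. Qed.

Lemma clock_lip N l l' : `|clock N l - clock N l'| <= `|l%:R - l'%:R| * tstep N.
Proof.
have E : `|l%:R - l'%:R| * tstep N = `|(T - l%:R * tstep N) - (T - l'%:R * tstep N)|.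
  rewrite -{1}[tstep N]ger0_norm ?tstep_ge0 // -normrM -normrN; congr `|_|; ring.
rewrite E /clock; move: (T - _) (T - _) => u v.
rewrite !maxEle ler_norml; have := ler_norm (u - v); have := ler_norm (v - u); rewrite (distrC v u).
by case: (leP 0 u) => hu; case: (leP 0 v) => hv; move=> *; apply/andP; split; lra.
Qed.

Lemma wf_coef_at t : 0 <= t <= T -> wf_coef C p (coef_at t).
Proof.
move=> tT; split => //=.
- by move=> x; exact: b_growth.
- by move=> x; exact: s_growth.
- by move=> i x; exact: f_growth.
- by move=> i x y z y' z'; exact: f_lip.
- by move=> i j x ji; apply: g_ge0 => //; rewrite eq_sym.
Qed.

Lemma TT : 0 <= T <= T. Proof. by rewrite ltW ?lexx. Qed.

Lemma wf_coef_end : wf_coef C p coef_end.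
Proof.
have P x : 0 <= C * (1 + frob (x : 'cV[R]_k)) by rewrite mulr_ge0 // addr_ge0 // frob_ge0.
split => //=.
- by move=> x; rewrite frob0.
- by move=> x; rewrite frob0.
- by move=> i x; rewrite normr0 mulr_ge0 // ltW // poly_gt0.
- move=> i x y z y' z'; rewrite subrr normr0 mulr_ge0 // addr_ge0 ?enorm_ge0 //.
  exact: sumr_ge0.
- by move=> i j x ji; apply: g_ge0; rewrite ?TT // eq_sym.
Qed.

Lemma next_end dt x w : next coef_end dt x w = x.
Proof. by rewrite /next /incr /= mul0mx !scaler0 !addr0. Qed.

Lemma slope_end dt u i x : slope coef_end dt u i x = 0.
Proof.
apply/matrixP => a j; rewrite !mxE /=.
under eq_mean do rewrite next_end.
have := mean_xi (R := R) (d := d) (delta_mx a 0); under eq_mean do rewrite dotvC dotv_delta.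
by move=> mx; rewrite meanZ mx mulr0 mul0r.
Qed.

Lemma genu_end dt u i x : genu coef_end dt u i x = 0.
Proof. by []. Qed.

Lemma pre_end dt u i x : pre coef_end dt u i x = u i x.
Proof.
rewrite /pre genu_end mulr0 addr0; under eq_mean do rewrite next_end.
by rewrite mean_cst.
Qed.

(** The obstacle condition on [h] says that no switch at time [T] is profitable. *)
Lemma step_end dt : step coef_end dt h = h.
Proof.
apply/funext => i; apply/funext => x.
apply/eqP; rewrite eq_le; apply/andP; split; last by rewrite -[leLHS](pre_end dt) step_ge_pre.
case: (step_cases coef_end dt h i x) => [->|[j ji ->]]; rewrite pre_end // /=.
exact: h_obs.
Qed.

Lemma near_tstep (e : R) : 0 < e -> \forall N \near \oo, 0 < tstep N <= e.
Proof.
move=> e0; near=> N.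
have N0 : (0 < N)%N by near: N; exact: nbhs_infty_gt.
rewrite /tstep divr_gt0 ?ltr0n //= ler_pdivrMr ?ltr0n // mulrC -ler_pdivrMr //.
by near: N; exact: nbhs_infty_ger.
Unshelve. all: by end_near. Qed.

Lemma near_tstep_small : \forall N \near \oo,
  [/\ 0 < tstep N <= 1, tstep N * d%:R * C ^+ 2 <= 1, 8 * tstep N * C ^+ 2 <= 1 & (0 < N)%N].
Proof.
have D : 0 < (d%:R + 8) * C ^+ 2 + 1 by rewrite ltr_wpDl // mulr_ge0 ?sqr_ge0 // addr_ge0.
have D1 : 0 < ((d%:R + 8) * C ^+ 2 + 1)^-1 by rewrite invr_gt0.
near=> N.
have : 0 < tstep N <= ((d%:R + 8) * C ^+ 2 + 1)^-1 by near: N; exact: near_tstep.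
move=> /andP[t0]; rewrite -[_^-1]mul1r ler_pdivlMr // => tD.
have h1 : 0 <= tstep N * (d%:R * C ^+ 2) by rewrite !mulr_ge0 ?sqr_ge0 // ltW.
have h2 : 0 <= tstep N * (C ^+ 2) by rewrite !mulr_ge0 ?sqr_ge0 // ltW.
split; [apply/andP; split => // | | |]; try lra.
by near: N; exact: nbhs_infty_gt.
Unshelve. all: by end_near. Qed.

Lemma steps_le N l : (0 < N)%N -> (l <= N)%N -> tstep N * l%:R <= T.
Proof.
move=> N0 lN; rewrite /tstep mulrAC ler_pdivrMr ?ltr0n //.
by rewrite ler_pM2l // ler_nat.
Qed.

Lemma disc_bound : exists2 B : R, 1 <= B &
  \forall N \near \oo, forall l, (l <= N)%N -> forall i x, `|disc N l i x| <= B * poly p x.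
Proof.
have [lam lam0 H] := @step_growth R k d m d0 C p C1.
have e1 (y : R) : 0 <= y -> 1 <= expR y by move=> y0; rewrite -expR0 ler_expR.
exists (C * expR (lam * T)).
  by rewrite mulr_ege1 // e1 // mulr_ge0 // ltW.
near=> N.
have [t01 tC _ N0] : [/\ 0 < tstep N <= 1, tstep N * d%:R * C ^+ 2 <= 1,
    8 * tstep N * C ^+ 2 <= 1 & (0 < N)%N] by near: N; exact: near_tstep_small.
suff S l : forall i x, `|disc N l i x| <= C * expR (lam * tstep N * l%:R) * poly p x.
  move=> l lN i x; apply: le_trans (S l i x) _.
  rewrite ler_wpM2r ?(ltW (poly_gt0 _ _)) // ler_wpM2l // ler_expR -mulrA ler_wpM2l //.
  exact: steps_le.
elim: l => [|l IH] i x; first by rewrite mulr0 expR0 mulr1; exact: h_growth.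
rewrite /=; apply: le_trans (H _ _ _ _ (wf_coef_at (clock_strip N l.+1)) t01 tC _ IH i x) _.
  apply: mulr_ege1 => //; apply: e1; rewrite !mulr_ge0 ?tstep_ge0 ?(ltW T0) //.
rewrite ler_wpM2r ?(ltW (poly_gt0 _ _)) // -[C * _ * _]mulrA ler_wpM2l //.
have -> : lam * tstep N * l.+1%:R = lam * tstep N * l%:R + lam * tstep N.
  by rewrite -natr1; ring.
by rewrite expRD ler_wpM2l ?expR_ge0 // expR_ge1Dx.
Unshelve. all: by end_near. Qed.

(** A run that rests at [h] for [s] steps. With the truncated index [l - s], both runs make the same
    number of steps, and comparing two times becomes comparing two sets of coefficients. *)
Definition delayed_coef N s l : coef :=
  if (l < s)%N then coef_end else coef_at (clock N (l.+1 - s)).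

Lemma disc_delayed N s l :
  disc N (l.+1 - s) = step (delayed_coef N s l) (tstep N) (disc N (l - s)).
Proof.
rewrite /delayed_coef; case: ltnP => ls.
  by rewrite (eqP ls) (eqP (ltnW ls)) /= step_end.
by rewrite subSn.
Qed.

Lemma wf_delayed N s l : wf_coef C p (delayed_coef N s l).
Proof.
by rewrite /delayed_coef; case: ltnP => _; [exact: wf_coef_end | exact: wf_coef_at (clock_strip _ _)].
Qed.

Lemma cost_delayed N s l i j x :
  cost (delayed_coef N s l) i j x = g i j (clock N (l.+1 - s), x).
Proof. by rewrite /delayed_coef; case: ltnP => // ls; rewrite (eqP ls) clock0. Qed.


Lemma clock_delay N s l : `|clock N (l.+1 - 0) - clock N (l.+1 - s)| <= s%:R * tstep N.
Proof.
apply: le_trans (clock_lip _ _ _) _; rewrite ler_wpM2r ?tstep_ge0 // subn0.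
have [ls|ls] := leqP s l.+1.
  by rewrite natrB // opprB addrCA subrr addr0 ger0_norm.
by rewrite (eqP (ltnW ls)) subr0 ger0_norm // ler_nat ltnW.
Qed.

Lemma clock_next N s l : `|clock N (l - s) - clock N (l.+1 - s)| <= tstep N.
Proof.
apply: le_trans (clock_lip _ _ _) _; rewrite -[leRHS]mul1r ler_wpM2r ?tstep_ge0 //.
have [ls|ls] := leqP s l.
  rewrite subSn // -natr1 opprD addrA subrr add0r normrN normr1 //.
by rewrite (eqP ls) (eqP (ltnW ls)) subrr normr0.
Qed.

(** While the second run waits, its drift, noise and generator vanish and the mismatch is merely
    bounded on the ball, but this lasts a time [s * dt] only. The costs are close throughout,
    because the waiting run uses those of time [T]. *)
Lemma compat_delayed (N s l : nat) (rho r V theta eta om ef rt : R) :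
  0 <= rho -> 0 <= V -> 0 <= om -> 0 <= ef ->
  (forall t t' x, 0 <= t <= T -> 0 <= t' <= T -> frob x <= rho -> `|t - t'| <= rt ->
     2 * frob (b (t, x) - b (t', x)) <= om /\ 2 * frob (sigma (t, x) - sigma (t', x)) <= om) ->
  (forall t t' x x', 0 <= t <= T -> 0 <= t' <= T -> frob x <= rho -> `|t - t'| <= rt ->
     frob (x - x') <= r -> (forall i y z, `|f i (t, x) y z - f i (t', x') y z| <= ef) /\
     (forall i j, j != i -> `|g i j (t, x) - g i j (t', x')| <= theta * eta)) ->
  s%:R * tstep N <= rt ->
  (forall i x, frob x <= rho -> `|disc N l i x| <= V) ->
  compat C rho r theta eta (tstep N)
    (if (l < s)%N then C * (1 + rho) else om)
    (if (l < s)%N then C * (1 + rho) ^+ p + C * m%:R * V else ef)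
    (delayed_coef N 0 l) (delayed_coef N s l) (disc N (l - 0)) (disc N (l - s)).
Proof.
move=> rho0 V0 om0 ef0 Hbs Hfg srt LV.
have tt := le_trans (clock_delay N s l) srt.
set tL := clock N (l.+1 - 0) in tt; set tR := clock N (l.+1 - s) in tt.
have tLT : 0 <= tL <= T by exact: clock_strip.
have tRT : 0 <= tR <= T by exact: clock_strip.
have cost_ok x x' i j : near_pair rho r x x' -> j != i ->
    `|cost (delayed_coef N 0 l) i j x - cost (delayed_coef N s l) i j x'| <= theta * eta.
  by move=> [xr xr' xx'] ji; rewrite !cost_delayed; exact: (Hfg tL tR x x' _ _ _ _ _).2.
have EL : delayed_coef N 0 l = coef_at tL by [].
have [ls|ls] := ltnP l s.
  have ER : delayed_coef N s l = coef_end by rewrite /delayed_coef ls.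
  have xC (x : 'cV[R]_k) : frob x <= rho -> C * (1 + frob x) <= C * (1 + rho).
    by move=> xr; rewrite ler_wpM2l // lerD2l.
  split => //.
  - move=> x x' [xr _ _]; rewrite EL ER /= subr0.
    apply: le_trans (b_growth _ tLT) (le_trans (xC _ xr) _).
    by rewrite lerDr mulr_ge0 // frob_ge0.
  - move=> x x' [xr _ _]; rewrite EL ER /= subr0.
    apply: le_trans (s_growth _ tLT) (le_trans (xC _ xr) _).
    by rewrite lerDr mulr_ge0 // frob_ge0.
  move=> x x' j [xr xr' _]; rewrite EL ER genu_end slope_end !subr0.
  apply: le_trans (gen_le _ _ _ _ (wf_coef_at tLT)) _.
  rewrite mulrDr addrA lerD2r -addrA; apply: lerD.
    rewrite ler_wpM2l // lerXn2r // ?nnegrE ?addr_ge0 ?frob_ge0 //.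
    by rewrite lerD2l.
  have h1 : \sum_(j0 < m) `|(\col_i disc N (l - 0) i x) j0 0| <= m%:R * V.
    apply: (le_trans (y := \sum_(j0 < m) V)); last by rewrite sumr_const card_ord mulr_natl.
    by apply: ler_sum => i _; rewrite mxE subn0; exact: LV.
  have h2 : 0 <= C * (\sum_i `|disc N (l - 0) i x - disc N (l - s) i x'|).
    by rewrite mulr_ge0 // sumr_ge0.
  have := ler_wpM2l C0 h1; lra.
have ER : delayed_coef N s l = coef_at tR by rewrite /delayed_coef ltnNge ls.
split => //.
- move=> x x' [xr xr' _]; rewrite EL ER /=.
  have := (Hbs tL tR x' tLT tRT xr' tt).1; have := b_lip x x' tLT.
  have := frob_triangle (b (tL, x)) (b (tL, x')) (b (tR, x')); lra.
- move=> x x' [xr xr' _]; rewrite EL ER /=.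
  have := (Hbs tL tR x' tLT tRT xr' tt).2; have := s_lip x x' tLT.
  have := frob_triangle (sigma (tL, x)) (sigma (tL, x')) (sigma (tR, x')); lra.
move=> x x' j [xr xr' xx']; rewrite EL ER /genu /=.
set Y := \col_i _; set Y' := \col_i _; set Z := slope _ _ _ _ _; set Z' := slope _ _ _ _ _.
have h1 := (Hfg tL tR x x' tLT tRT xr tt xx').1 j Y Z.
have h2 := f_lip j x' Y Z Y' Z' tRT.
have := ler_distD (f j (tR, x') Y Z) (f j (tL, x) Y Z) (f j (tR, x') Y' Z').
have h3 : \sum_j0 `|Y j0 0 - Y' j0 0| = \sum_i `|disc N (l - 0) i x - disc N (l - s) i x'|.
  by apply: eq_bigr => i _; rewrite !mxE.
rewrite h3 in h2; lra.
Qed.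

Lemma potential_delayed (N s l : nat) (rho eta lc r : R) :
  0 <= rho -> 0 < eta -> 0 <= lc -> 0 < r ->
  (forall t x, 0 <= t <= T -> frob x <= rho -> exists rk, rank_at g eta t x rk) ->
  eta * m.+1%:R <= lc * r -> eta * m.+1%:R <= lc * r ^+ 2 ->
  (forall t t' x x', 0 <= t <= T -> 0 <= t' <= T -> frob x <= rho -> `|t - t'| <= r ->
     frob (x - x') <= r ->
     forall i j, j != i -> `|g i j (t, x) - g i j (t', x')| <= eta / 4) ->
  0 < tstep N <= 1 -> tstep N * d%:R * C ^+ 2 <= 1 ->
  potential C rho (eta / 2) (eta * m%:R)
    (1 + lc * (2 * T + 8 * rho + (3 + C ^+ 2 + 2 * d%:R) * (C * (1 + rho)))) (tstep N)
    (delayed_coef N s l)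
    (fun i x => convolved T g rho eta lc i (clock N (l - s)) x)
    (fun i x => convolved T g rho eta lc i (clock N (l.+1 - s)) x).
Proof.
move=> rho0 eta0 lc0 r0 Hrk H1 H2 Hg t01 tC; split.
- by move=> i x; apply: (convolved_ge0 (ltW T0) rho0 eta0 lc0 Hrk).
- by move=> i x; apply: (convolved_ge0 (ltW T0) rho0 eta0 lc0 Hrk).
- by move=> i x xr; apply: (convolved_bound eta0 lc0 Hrk) => //; exact: clock_strip.
- move=> j x bb xr bC.
  apply: (convolved_step (ltW T0) rho0 eta0 lc0 Hrk j d0 C0 t01 tC (wf_delayed N s l)) => //.
  + exact: clock_strip.
  + exact: clock_strip.
  + exact: clock_next.
- move=> i j x xr ji; rewrite cost_delayed.
  apply: (convolved_cost (ltW T0) g_ge0 rho0 eta0 lc0 Hrk r0) => //.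
    exact: clock_strip.
  by move=> t y tT yr ts xy; apply: Hg => //; exact: clock_strip.
Qed.


Lemma small_factor (M e : R) : 0 <= M -> 0 < e -> exists2 th : R, 0 < th <= 1 & th * M <= e.
Proof.
move=> M0 e0; exists (Num.min 1 (e / (M + 1))).
  by rewrite lt_min ltr01 divr_gt0 ?ltr_wpDl //= ge_min lexx.
have hm : Num.min 1 (e / (M + 1)) * (M + 1) <= e.
  by rewrite -ler_pdivlMr ?ltr_wpDl // ge_min lexx orbT.
apply: (le_trans _ hm); rewrite ler_wpM2l ?lerDl // le_min ler01 divr_ge0 // ?(ltW e0) // addr_ge0 //.
Qed.

Lemma coef_uniform (rho om : R) : 0 < om -> exists2 r : R, 0 < r &
  forall t t' x, 0 <= t <= T -> 0 <= t' <= T -> frob x <= rho -> `|t - t'| <= r ->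
     2 * frob (b (t, x) - b (t', x)) <= om /\ 2 * frob (sigma (t, x) - sigma (t', x)) <= om.
Proof.
move=> om0.
have M0 : 0 <= 2 * (k%:R * (1 + d%:R)) :> R by rewrite !(mulr_ge0, addr_ge0).
have [e /andP[e0 e1] eM] := small_factor M0 om0.
have [r1 r10 H1] := uniform_on_strip rho b_cont e0.
have [r2 r20 H2] := uniform_on_strip rho s_cont e0.
exists (Num.min r1 r2); first by rewrite lt_min r10.
move=> t t' x tT t'T xr; rewrite le_min => /andP[tt1 tt2].
have sq (y : R) : `|y| <= e -> y ^+ 2 <= e.
  move=> ye; rewrite -real_normK ?num_real // expr2; apply: (le_trans _ ye).
  by rewrite ler_piMl // (le_trans ye).
have z (r : R) : 0 < r -> frob (x - x) <= r by move=> r0; rewrite subrr frob0 ltW.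
have ke : 0 <= k%:R * e by rewrite mulr_ge0 // ltW.
have kd : 0 <= k%:R * d%:R * e by rewrite !mulr_ge0 // ltW.
split.
  have : frob (b (t, x) - b (t', x)) <= k%:R * 1%:R * e.
    apply: frob_coord_le => i j; rewrite !mxE ord1; apply: sq.
    exact: (H1 t t' x x tT t'T xr tt1 (z _ r10) i).
  lra.
have : frob (sigma (t, x) - sigma (t', x)) <= k%:R * d%:R * e.
  apply: frob_coord_le => i j; rewrite !mxE; apply: sq.
  exact: (H2 t t' x x tT t'T xr tt2 (z _ r20) (i, j)).
lra.
Qed.

Lemma cost_uniform (rho e : R) : 0 < e -> exists2 r : R, 0 < r &
  forall t t' x x', 0 <= t <= T -> 0 <= t' <= T -> frob x <= rho -> `|t - t'| <= r ->
     frob (x - x') <= r -> forall i j, j != i -> `|g i j (t, x) - g i j (t', x')| <= e.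
Proof.
move=> e0; have [r r0 H] := uniform_on_strip rho g_cont e0.
exists r => // t t' x x' tT t'T xr tt xx i j ji.
by have := H t t' x x' tT t'T xr tt xx (i, j); rewrite /= eq_sym ji.
Qed.

Lemma gen_uniform (rho e : R) : 0 < e -> exists2 r : R, 0 < r &
  forall t t' x x', 0 <= t <= T -> 0 <= t' <= T -> frob x <= rho -> `|t - t'| <= r ->
     frob (x - x') <= r -> forall i y z, `|f i (t, x) y z - f i (t', x') y z| <= e.
Proof.
move=> e0; have [r r0 H] := uniform_on_strip rho f_cont e0.
exists r => // t t' x x' tT t'T xr tt xx i y z.
by have := H t t' x x' tT t'T xr tt xx (i, y, z).
Qed.

(** The order of the choices matters: [kap] from [eps], then [rho] and [V], then [eta] and [lc] on
    that ball, then [theta], then the radius [r] within which costs vary by at most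
    [theta * eta / 2], then [K], then [om]. It is consistent because [tilt_cost], which limits
    [theta], does not involve [K]. *)
Lemma disc_equicontinuous (rho1 eps : R) : 0 <= rho1 -> 0 < eps -> exists2 r : R, 0 < r &
  \forall N \near \oo, forall l l' i x x', (l <= N)%N -> (l' <= N)%N ->
    `|l%:R - l'%:R| * tstep N <= r -> frob x <= rho1 -> frob x' <= rho1 -> frob (x - x') <= r ->
    `|disc N l i x - disc N l' i x'| <= eps.
Proof.
move=> rho10 eps0.
have [B B1 HB] := disc_bound.
have [gq gq0 Hgq] := @poly_growth_step R d d0 k C (p + p).+1 C0.
pose G := @growth_exp R d m C gq.
have G0 : 0 <= G by rewrite /G /growth_exp !(addr_ge0, mulr_ge0, sqr_ge0).
pose A := expR (G * T).
have A0 : 0 < A by exact: expR_gt0.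
have A1 : 1 <= A by rewrite -expR0 ler_expR mulr_ge0 // ltW.
pose Q1 : R := (1 + rho1) ^+ (p + p).+1.
have Q10 : 0 < Q1 by rewrite exprn_gt0 // ltr_wpDr.
(* In the final barrier [kap], [e1] and [rk] take a quarter of [eps] each; the last quarter is left
   for the potential. *)
pose kap := eps / (8 * (A * Q1)).
have kap0 : 0 < kap by rewrite divr_gt0 // !mulr_gt0.
have kapE : A * (kap * (Q1 + Q1)) = eps / 4.
  by rewrite /kap; field; rewrite !gt_eqF.
(* [3 + 4 * T] counts two shares of [e1] at the start, one for the waiting steps and four per unit
   of time. *)
pose e1 := eps / (4 * (A * (3 + 4 * T))).
have T3 : 0 < 3 + 4 * T by have := T0; lra.
have e10 : 0 < e1 by rewrite divr_gt0 // !mulr_gt0.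
have e1E : A * ((3 + 4 * T) * e1) = eps / 4.
  by rewrite /e1; field; rewrite !gt_eqF.
have e1eps : e1 <= eps / 4.
  rewrite -e1E; have h1 : e1 <= (3 + 4 * T) * e1 by rewrite ler_peMl ?(ltW e10) //; have := T0; lra.
  by apply: le_trans h1 _; rewrite ler_peMl // mulr_ge0 // ltW.
pose rho := 6 * B ^+ 2 / kap + rho1.
have rho_ge : 6 * B ^+ 2 <= kap * rho.
  by rewrite /rho mulrDr [kap * (_ / _)]mulrC mulfVK ?gt_eqF // lerDl mulr_ge0 // ltW.
have rho1_le : rho1 <= rho by rewrite lerDr divr_ge0 ?(ltW kap0) // mulr_ge0 ?sqr_ge0.
have rho0 : 0 <= rho by exact: le_trans rho1_le.
clearbody rho.
pose rho' := 2 * rho + 2 * ((2 + 2 * d%:R) * (C * (1 + rho))).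
have rho'0 : 0 <= (2 + 2 * d%:R) * (C * (1 + rho)) by rewrite !(mulr_ge0, addr_ge0).
have rho_rho' : rho <= rho' by rewrite /rho'; move: rho'0 rho0; clear_local; lra.
have B0 : 0 <= B := le_trans ler01 B1.
pose V := 1 + B * (1 + rho') ^+ p.
have HV (y : 'cV[R]_k) : frob y <= rho' -> B * poly p y <= V - 1.
  move=> yr; rewrite /V addrC addKr ler_wpM2l // lerXn2r ?nnegrE ?lerD2l // addr_ge0 ?frob_ge0 //.
  exact: le_trans (frob_ge0 y) yr.
have V0 : 0 <= V.
  by rewrite /V addr_ge0 // mulr_ge0 // exprn_ge0 // addr_ge0 // /rho'; lra.
clearbody V.
have [eta eta0 Hrk] := rank_exists g_cont g_ge0 g_loop rho.
have [rg rg0 Hg] : exists2 r : R, 0 < r & forall t t' x x', 0 <= t <= T -> 0 <= t' <= T ->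
     frob x <= rho -> `|t - t'| <= r -> frob (x - x') <= r ->
     forall i j, j != i -> `|g i j (t, x) - g i j (t', x')| <= eta / 4.
  by apply: cost_uniform; rewrite divr_gt0.
(* The two summands answer the two requirements of [convolved_cost], one for the distance in space
   and one for the distance in time. *)
pose lc := eta * m.+1%:R / rg + eta * m.+1%:R / rg ^+ 2.
have em : 0 <= eta * m.+1%:R by rewrite mulr_ge0 // ltW.
have lc0 : 0 <= lc by rewrite addr_ge0 // divr_ge0 ?exprn_ge0 // ltW.
have lc1 : eta * m.+1%:R <= lc * rg.
  by rewrite /lc mulrDl mulfVK ?gt_eqF // lerDl mulr_ge0 ?(ltW rg0) // divr_ge0 // exprn_ge0 // ltW //.
have lc2 : eta * m.+1%:R <= lc * rg ^+ 2.
  rewrite /lc mulrDl mulfVK ?gt_eqF ?exprn_gt0 // lerDr mulr_ge0 ?exprn_ge0 ?(ltW rg0) //.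
  by rewrite divr_ge0 // ltW.
clearbody lc.
pose Cchi := 1 + lc * (2 * T + 8 * rho + (3 + C ^+ 2 + 2 * d%:R) * (C * (1 + rho))).
have Cchi0 : 0 <= Cchi.
  by rewrite /Cchi !(addr_ge0, mulr_ge0, sqr_ge0) // ltW.
pose X0 := eta * m%:R.
have X00 : 0 <= X0 by rewrite mulr_ge0 // ltW.
pose tc := @tilt_cost R d m C rho V Cchi p.
have tcG cc : 0 <= cc -> 0 <= @tilt_cost R d m C rho V cc p.
  by move=> cc0; rewrite /tilt_cost !(addr_ge0, mulr_ge0, sqr_ge0, exprn_ge0).
have tc0 : 0 <= tc := tcG _ Cchi0.
have V40 : 0 <= 4 * V ^+ 2 by rewrite mulr_ge0 ?sqr_ge0.
have CX0 : 0 <= C * m%:R * X0 by rewrite mulr_ge0 // mulr_ge0.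
have M0 : 0 <= 4 * V ^+ 2 + C * m%:R * X0 + tc + X0 by lra.
have [theta th01 thM] := small_factor M0 e10.
have /andP[th_gt0 th1] := th01.
have th0 := ltW th_gt0.
have tV := mulr_ge0 th0 (sqr_ge0 V).
have tCX := mulr_ge0 th0 CX0.
have ttc := mulr_ge0 th0 tc0.
have tX := mulr_ge0 th0 X00.
have [th_V th_C th_tc th_X'] : [/\ 4 * theta * V ^+ 2 <= e1, C * m%:R * (theta * X0) <= e1,
    theta * tc <= e1 & theta * X0 <= e1].
  by move: thM tV tCX ttc tX; clear_local; move=> *; split; lra.
have th_X : theta * X0 <= eps / 4 := le_trans th_X' e1eps.
have [rh rh0 Hh] := uniform_on_strip rho h_cont e10.
(* [eta / 2] is the decrease that [convolved_cost] guarantees. *)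
have the : 0 < theta * (eta / 2) by rewrite mulr_gt0 // divr_gt0.
have [rc rc0 Hc] := cost_uniform rho the.
have [rf rf0 Hf] := gen_uniform rho e10.
pose r := Num.min rh (Num.min rc rf).
have r0 : 0 < r by rewrite !lt_min rh0 rc0.
have rrh : r <= rh by rewrite ge_min lexx.
have rrc : r <= rc by rewrite !ge_min lexx orbT.
have rrf : r <= rf by rewrite !ge_min lexx !orbT.
clearbody r.
pose K := 2 * V / r.
have K0 : 0 <= K by rewrite divr_ge0 ?mulr_ge0 // ltW.
have Kr : 2 * V <= K * r by rewrite /K mulfVK // gt_eqF.
pose c3 : R := 3 + C ^+ 2 + 2 * d%:R.
have c30 : 0 <= c3 by rewrite /c3 !(addr_ge0, mulr_ge0, sqr_ge0).
have Kc30 : 0 <= K * c3 by rewrite mulr_ge0.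
have [om /andP[om0 om1] Kom] := small_factor Kc30 e10.
have [rb rb0 Hb] := coef_uniform rho om0.
pose SE := @step_error R d m C rho V K theta X0 Cchi p.
pose omB := C * (1 + rho); pose efB := C * (1 + rho) ^+ p + C * m%:R * V.
have omB0 : 0 <= omB by rewrite !(mulr_ge0, addr_ge0).
have efB0 : 0 <= efB by rewrite !(mulr_ge0, addr_ge0, exprn_ge0).
have SE_ge0 o e : 0 <= o -> 0 <= e -> 0 <= SE o e.
  move=> o0 e0; rewrite /SE /step_error -/tc -/c3.
  by rewrite addr_ge0 // addr_ge0 // ?addr_ge0 // mulr_ge0 // mulr_ge0.
have SE_small : SE om e1 <= 4 * e1.
  rewrite /SE /step_error -/tc -/c3.
  have -> : K * (c3 * om) = om * (K * c3) by ring.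
  by move: Kom th_C th_tc; clear_local; lra.
have SEB0 := SE_ge0 _ _ omB0 efB0.
have [rt /andP[rt0 rt1] rtSE] := small_factor SEB0 e10.
have AK0 : 0 <= A * K by rewrite mulr_ge0 // ltW.
have eps4 : 0 < eps / 4 by rewrite divr_gt0.
have [rk /andP[rk0 rk1] rkAK] := small_factor AK0 eps4.
pose rr := Num.min rt (Num.min rb (Num.min r rk)).
have rr0 : 0 < rr by rewrite !lt_min rt0 rb0 r0.
have rr_t : rr <= rt by rewrite ge_min lexx.
have rr_b : rr <= rb by rewrite !ge_min lexx orbT.
have rr_r : rr <= r by rewrite !ge_min lexx !orbT.
have rr_k : rr <= rk by rewrite !ge_min lexx !orbT.
exists rr => //; near=> N.
have [t01 tC tC8 N0] : [/\ 0 < tstep N <= 1, tstep N * d%:R * C ^+ 2 <= 1,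
    8 * tstep N * C ^+ 2 <= 1 & (0 < N)%N] by near: N; exact: near_tstep_small.
have HBN : forall l, (l <= N)%N -> forall i x, `|disc N l i x| <= B * poly p x by near: N.
have t0 : 0 <= tstep N by exact: tstep_ge0.
(* the later index is written [l - s]: the second copy of the scheme is started [s] steps late *)
have main s l i x x' : (l <= N)%N -> s%:R * tstep N <= rr ->
    frob x <= rho1 -> frob x' <= rho1 -> frob (x - x') <= rr ->
    `|disc N l i x - disc N (l - s) i x'| <= eps.
  move=> lN srr xr xr' xx'.
  (* The large error rate applies during the [min n s] steps in which the second run waits, the
     small rate [4 * e1] is charged for all steps. *)
  pose e (n : nat) : R := 2 * e1 + tstep N * ((minn n s)%:R * SE omB efB) + tstep N * (n%:R * (4 * e1)).
  pose om_ (n : nat) := if (n < s)%N then omB else om.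
  pose ef_ (n : nat) := if (n < s)%N then efB else e1.
  pose chi q n (j : 'I_m) (y : 'cV[R]_k) := convolved T g rho eta lc j (clock N (n - q)) y.
  have chi0 q n j y : 0 <= chi q n j y.
    exact: (convolved_ge0 (ltW T0) rho0 eta0 lc0 Hrk).
  have e_ge n : 2 * e1 <= e n.
    have := mulr_ge0 t0 (mulr_ge0 (ler0n R (minn n s)) SEB0).
    have := mulr_ge0 t0 (mulr_ge0 (ler0n R n) (ltW e10)).
    by rewrite /e; clear_local; lra.
  have data n : (n < N)%N -> [/\ wf_coef C p (delayed_coef N 0 n), wf_coef C p (delayed_coef N s n),
     compat C rho r theta (eta / 2) (tstep N) (om_ n) (ef_ n) (delayed_coef N 0 n) (delayed_coef N s n)
        (disc N (n - 0)) (disc N (n - s)),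
     potential C rho (eta / 2) X0 Cchi (tstep N) (delayed_coef N 0 n) (chi 0%N n) (chi 0%N n.+1) &
     potential C rho (eta / 2) X0 Cchi (tstep N) (delayed_coef N s n) (chi s n) (chi s n.+1)].
    move=> nN; split; [exact: wf_delayed | exact: wf_delayed | | |].
    - apply: (compat_delayed (rt := rr)) => //; rewrite ?(ltW om0) ?(ltW e10) //.
      + by move=> u u' y uT u'T yr uu; apply: Hb => //; exact: le_trans uu rr_b.
      + move=> u u' y y' uT u'T yr uu yy; split.
          by apply: Hf => //; apply: le_trans rrf => //; exact: le_trans uu rr_r.
        by apply: Hc => //; apply: le_trans rrc => //; exact: le_trans uu rr_r.
      + move=> j y yr; apply: le_trans (HBN _ (ltnW nN) j y) _.
        by apply: le_trans (HV y (le_trans yr rho_rho')) _; rewrite gerBl.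
    - exact: (potential_delayed 0 n rho0 eta0 lc0 rg0 Hrk lc1 lc2 Hg t01 tC).
    - exact: (potential_delayed s n rho0 eta0 lc0 rg0 Hrk lc1 lc2 Hg t01 tC).
  have err n : [/\ 0 <= om_ n, 0 <= ef_ n & e n + tstep N * SE (om_ n) (ef_ n) <= e n.+1].
    rewrite /om_ /ef_ /e; case: ltnP => ns; split=> //; rewrite ?(ltW om0) ?(ltW e10) //.
      rewrite (minn_idPl ns) -!natr1.
      have := mulr_ge0 t0 (ltW e10).
      by rewrite -[SE omB efB]/(SE omB efB); move: (SE omB efB); clear_local; move=> *; lra.
    rewrite (minn_idPr (leqW ns)) -!natr1.
    by have := ler_wpM2l t0 SE_small; move: (SE omB efB) (SE om e1); clear_local; move=> *; lra.
  have init j y y' : near_pair rho r y y' -> `|disc N (0 - 0) j y - disc N (0 - s) j y'| <= e1.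
    move=> [yr yr' yy]; rewrite !sub0n /=.
    have h0 : `|T - T| <= rh by rewrite subrr normr0 ltW.
    exact: (Hh T T y y' TT TT yr h0 (le_trans yy rrh) j).
  have e0 : e1 + 4 * theta * V ^+ 2 <= e 0%N by apply: (le_trans _ (e_ge 0%N)); move: th_V; clear_local; lra.
  have eV n : 4 * theta * V ^+ 2 <= e n by apply: (le_trans _ (e_ge n)); move: th_V e10; clear_local; lra.
  have D := @seq_double R k d m d0 C B kap rho r V K theta (eta / 2) X0 Cchi (tstep N) gq p
    C1 t01 tC tC8 B1 (ltW kap0) K0 rho0 Cchi0 rho_ge Kr (introT andP (conj th0 th1)) HV gq0 Hgq
    N (delayed_coef N 0) (delayed_coef N s) (fun n => disc N (n - 0)) (fun n => disc N (n - s))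
    (chi 0%N) (chi s) om_ ef_ e e1 data (chi0 0%N 0%N) (chi0 s 0%N)
    (fun n => disc_delayed N 0 n) (fun n => disc_delayed N s n)
    (fun n j y nN => HBN _ (leq_trans (leq_subr 0 n) nN) j y)
    (fun n j y nN => HBN _ (leq_trans (leq_subr s n) nN) j y)
    err eV e0 init l lN i.
  have [D1 _] := D x x'; have [_ D2] := D x' x => {D}.
  rewrite barrierC in D2; rewrite -/G subn0 in D1 D2.
  set bar := barrier _ _ _ _ _ _ _ in D1 D2.
  have bar_le : bar <= 3 / 4 * eps.
    have polyQ (y : 'cV[R]_k) : frob y <= rho1 -> poly (p + p).+1 y <= Q1.
      by move=> yr; rewrite lerXn2r ?nnegrE ?lerD2l // addr_ge0 ?frob_ge0.
    have el : e l <= (3 + 4 * T) * e1.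
      have i1 : tstep N * ((minn l s)%:R * SE omB efB) <= e1.
        apply: (le_trans (y := rt * SE omB efB)) => //.
        rewrite mulrA ler_wpM2r //; apply: le_trans (le_trans srr rr_t).
        by rewrite mulrC ler_wpM2r // ler_nat geq_minr.
      have i2 : tstep N * (l%:R * (4 * e1)) <= T * (4 * e1).
        rewrite (mulrA (tstep N)); apply: (ler_wpM2r (mulr_ge0 (ler0n R 4) (ltW e10))).
        exact: steps_le.
      by rewrite /e; move: i1 i2; clear_local; lra.
    have Kxx : K * frob (x - x') <= K * rk.
      by rewrite ler_wpM2l //; exact: le_trans xx' rr_k.
    have kq : kap * (poly (p + p).+1 x + poly (p + p).+1 x') <= kap * (Q1 + Q1).
      by rewrite ler_wpM2l ?(ltW kap0) // lerD // polyQ.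
    have sum_le := lerD (lerD el Kxx) kq.
    apply: (le_trans (y := A * ((3 + 4 * T) * e1 + K * rk + kap * (Q1 + Q1)))).
      rewrite /bar /barrier; apply: ler_pM; last exact: sum_le.
      - exact: expR_ge0.
      - have el0 : 0 <= e l := le_trans (mulr_ge0 (ler0n R 2) (ltW e10)) (e_ge l).
        have kp0 : 0 <= kap * (poly (p + p).+1 x + poly (p + p).+1 x').
          by apply: mulr_ge0; [exact: ltW | apply: addr_ge0; exact: ltW (poly_gt0 _ _)].
        exact: addr_ge0 (addr_ge0 el0 (mulr_ge0 K0 (frob_ge0 _))) kp0.
      - rewrite ler_expR -[_ * tstep N * _]mulrA; apply: ler_wpM2l => //.
        exact: steps_le.
    rewrite !(mulrDr A) e1E kapE.
    have -> : A * (K * rk) = rk * (A * K) by ring.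
    by move: rkAK; clear_local; lra.
  (* As the squares are non-negative, removing the tilt costs no more than [theta * X0]. *)
  have tlX q n j y : frob y <= rho -> theta * chi q n j y <= theta * X0.
    move=> yr; rewrite ler_wpM2l //; apply: (convolved_bound eta0 lc0 Hrk) => //.
    exact: clock_strip.
  have q1 := tlX 0%N l i x (le_trans xr rho1_le).
  have q2 := tlX s l i x' (le_trans xr' rho1_le).
  have q3 : 0 <= theta * (disc N l i x + V) ^+ 2 by rewrite mulr_ge0 ?sqr_ge0.
  have q4 : 0 <= theta * (disc N (l - s) i x' + V) ^+ 2 by rewrite mulr_ge0 ?sqr_ge0.
  move: D1 D2 bar_le q1 q2 q3 q4 th_X; rewrite /tilt -!/(chi _ _ _ _) ler_norml; move: bar.
  by move: (chi 0%N l i x) (chi s l i x') (theta * X0); clear_local; move=> *; apply/andP; split; lra.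
move=> l l' i x x' lN l'N ll xr xr' xx'.
have [ll'|/ltnW ll'] := leqP l' l.
  rewrite -(subKn ll'); apply: main => //.
  by rewrite natrB // -(ger0_norm (_ : 0 <= l%:R - l'%:R)) // subr_ge0 ler_nat.
rewrite distrC -(subKn ll'); apply: main => //; last by rewrite frobB_sym.
by rewrite natrB // -(ger0_norm (_ : 0 <= l'%:R - l%:R)) 1?distrC // subr_ge0 ler_nat.
Unshelve. all: by end_near. Qed.
End DiscreteSolution.

(** * The limit along an ultrafilter *)

Section UltraLimit.
Context {R : realType}.

(** A bounded sequence has a cluster point, and along an ultrafilter a cluster point is a limit. One
    filter serves all points [(t, x)] at once, in place of a diagonal extraction. *)
Lemma ultra_limit (G : set_system nat) (u : nat -> R) (M : R) : UltraFilter G ->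
  (\forall n \near G, `|u n| <= M) -> exists l : R, forall e : R, 0 < e ->
    \forall n \near G, `|u n - l| <= e.
Proof.
move=> GU uM; have GP : ProperFilter G by exact: ultra_proper.
have cK : compact (`[(- M), M]%classic : set R) by exact: segment_compact.
have [|l [_ cl]] := cK (u @ G) _.
  by apply: filterS uM => n; rewrite /= in_itv /= ler_norml.
exists l => e e0.
have [//|H] := in_ultra_setVsetC [set n | `|u n - l| <= e] GU.
have F1 : (u @ G) (~` [set y | `|y - l| <= e]) by [].
have N1 : nbhs l [set y | `|y - l| <= e].
  apply/nbhs_ballP; exists e => //= y; rewrite /ball /= distrC => /ltW //.
by have [y []] := cl _ _ F1 N1.
Qed.

Variables (T : R) (k m : nat) (u : nat -> nat -> 'I_m -> 'cV[R]_k -> R) (h : 'I_m -> 'cV[R]_k -> R)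
  (B : R) (p : nat).
Hypotheses (T0 : 0 < T) (u0 : forall N i x, u N 0%N i x = h i x)
  (u_bound : \forall N \near \oo, forall l, (l <= N)%N -> forall i x, `|u N l i x| <= B * poly p x)
  (u_equi : forall rho1 eps : R, 0 <= rho1 -> 0 < eps -> exists2 r : R, 0 < r &
     \forall N \near \oo, forall l l' i x x', (l <= N)%N -> (l' <= N)%N ->
     `|l%:R - l'%:R| * tstep T N <= r -> frob x <= rho1 -> frob x' <= rho1 -> frob (x - x') <= r ->
     `|u N l i x - u N l' i x'| <= eps).

(** The truncation selects the first grid time at or after [t]; it never lies before [t], the only
    side that is explored when a paraboloid touches at [t]. *)
Definition index_at (N : nat) (t : R) : nat := Num.truncn ((T - t) / tstep T N).

Lemma tstep_gt0 N : (0 < N)%N -> 0 < tstep T N.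
Proof. by move=> N0; rewrite divr_gt0 // ltr0n. Qed.

Lemma tstepN N : (0 < N)%N -> N%:R * tstep T N = T.
Proof. by move=> N0; rewrite /tstep mulrCA mulfV ?mulr1 // pnatr_eq0 -lt0n. Qed.

Lemma index_atP N t : (0 < N)%N -> 0 <= t <= T ->
  [/\ (index_at N t <= N)%N, (index_at N t)%:R * tstep T N <= T - t &
    T - t < (index_at N t)%:R * tstep T N + tstep T N].
Proof.
move=> N0 /andP[t0 tT]; have s0 := tstep_gt0 N0.
have q0 : 0 <= (T - t) / tstep T N by rewrite divr_ge0 ?subr_ge0 // ltW.
have /andP[h1 h2] := truncn_itv q0; rewrite -/(index_at N t) in h1 h2.
rewrite ler_pdivlMr // in h1; rewrite ltr_pdivrMr // -natr1 mulrDl mul1r in h2.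
split => //; rewrite -(ler_nat R) -(ler_pM2r s0) tstepN //; lra.
Qed.

Lemma index_at_clock N l : (0 < N)%N -> (l <= N)%N -> index_at N (clock T N l) = l.
Proof.
move=> N0 lN; have s0 := tstep_gt0 N0.
have lT : l%:R * tstep T N <= T by rewrite -[leRHS](tstepN N0) ler_pM2r // ler_nat.
rewrite /index_at /clock max_r ?subr_ge0 // subKr mulfK ?gt_eqF // natrK //.
Qed.

Lemma index_at_lip N t t' : (0 < N)%N -> 0 <= t <= T -> 0 <= t' <= T ->
  `|(index_at N t)%:R - (index_at N t')%:R| * tstep T N <= `|t - t'| + tstep T N.
Proof.
move=> N0 tT t'T; have [_ a1 a2] := index_atP N0 tT; have [_ b1 b2] := index_atP N0 t'T.
rewrite -[X in _ * X]ger0_norm ?(ltW (tstep_gt0 N0)) // -normrM mulrBl ler_norml.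
by have := ler_norm (t - t'); have := ler_norm (t' - t); rewrite (distrC t') => *; apply/andP; split; lra.
Qed.

Ltac clear_local := clear - R T k m u h B p T0 u0 u_bound u_equi.

Lemma limit_exists : exists (U : set_system nat) (v : 'I_m -> R * 'cV[R]_k -> R),
  ProperFilter U /\ \oo `<=` U /\
  [/\ forall rho eps : R, 0 < eps -> \forall N \near U, forall l, (l <= N)%N ->
        forall i x, frob x <= rho -> `|u N l i x - v i (clock T N l, x)| <= eps,
      forall rho eps : R, 0 <= rho -> 0 < eps -> exists2 r : R, 0 < r & forall t t' x x', 0 <= t <= T ->
        0 <= t' <= T -> frob x <= rho -> frob x' <= rho -> `|t - t'| <= r -> frob (x - x') <= r ->
        forall i, `|v i (t, x) - v i (t', x')| <= eps,
      forall i t x, 0 <= t <= T -> `|v i (t, x)| <= B * poly p x &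
      forall i x, v i (T, x) = h i x].
Proof.
have [U [UU ooU]] := @ultraFilterLemma nat \oo _.
have PU : ProperFilter U by exact: ultra_proper.
have near_oo (P : nat -> Prop) : (\forall N \near \oo, P N) -> \forall N \near U, P N by exact: ooU.
(* The range condition stands under the existential, so that [cid] chooses a value at every point,
   an arbitrary one outside the strip. *)
have lim_ex i (tx : R * 'cV[R]_k) : exists l : R, 0 <= tx.1 <= T -> forall e : R, 0 < e ->
    \forall N \near U, `|u N (index_at N tx.1) i tx.2 - l| <= e.
  have [tT|] := boolP (0 <= tx.1 <= T); last by exists 0.
  have [|l Hl] := @ultra_limit U (fun N => u N (index_at N tx.1) i tx.2) (B * poly p tx.2) UU _.
    near=> N; have N0 : (0 < N)%N by near: N; apply: near_oo; exact: nbhs_infty_gt.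
    have [iN _ _] := index_atP N0 tT.
    move: (index_at N tx.1) iN i tx.2; near: N; apply: near_oo.
    by apply: filterS u_bound => N H l lN j x; exact: H.
  by exists l.
have [v Hv] : {v : 'I_m -> R * 'cV[R]_k -> R | forall i tx, 0 <= tx.1 <= T -> forall e : R, 0 < e ->
    \forall N \near U, `|u N (index_at N tx.1) i tx.2 - v i tx| <= e}.
  exists (fun i tx => projT1 (cid (lim_ex i tx))) => i tx.
  exact: projT2 (cid (lim_ex i tx)).
have v_equi (rho eps : R) : 0 <= rho -> 0 < eps -> exists2 r : R, 0 < r &
    forall t t' x x', 0 <= t <= T -> 0 <= t' <= T -> frob x <= rho -> frob x' <= rho ->
     `|t - t'| <= r -> frob (x - x') <= r -> forall i, `|v i (t, x) - v i (t', x')| <= eps.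
  move=> rho0 eps0; have e3 : 0 < eps / 3 by rewrite divr_gt0.
  have [r r0 Hr] := u_equi rho0 e3.
  (* The other half of [r] is for rounding the two times to the grid. *)
  exists (r / 2); first by rewrite divr_gt0.
  move=> t t' x x' tT t'T xr xr' tt xx i.
  near U => N.
  have N0 : (0 < N)%N by near: N; apply: near_oo; exact: nbhs_infty_gt.
  have ts : tstep T N <= r / 2.
    suff /andP[] : 0 < tstep T N <= r / 2 by [].
    by near: N; apply: near_oo; apply: near_tstep => //; rewrite divr_gt0.
  have h1 : `|u N (index_at N t) i x - v i (t, x)| <= eps / 3 by near: N; exact: (Hv i (t, x)).
  have h2 : `|u N (index_at N t') i x' - v i (t', x')| <= eps / 3 by near: N; exact: (Hv i (t', x')).
  have HrN : forall l l' i x x', (l <= N)%N -> (l' <= N)%N ->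
     `|l%:R - l'%:R| * tstep T N <= r -> frob x <= rho -> frob x' <= rho -> frob (x - x') <= r ->
     `|u N l i x - u N l' i x'| <= eps / 3 by near: N; exact: near_oo.
  have h3 : `|u N (index_at N t) i x - u N (index_at N t') i x'| <= eps / 3.
    have [iN _ _] := index_atP N0 tT; have [iN' _ _] := index_atP N0 t'T.
    apply: HrN => //; last by move: (r0) (xx); clear_local; lra.
    apply: le_trans (index_at_lip N0 tT t'T) _; move: (tt) (ts); clear_local; lra.
  move: h1 h2 h3; clear_local; rewrite !ler_norml => /andP[? ?] /andP[? ?] /andP[? ?].
  by apply/andP; split; lra.
exists U, v; split => //; split => //; split => //.
- move=> rho eps eps0.
  suff : \forall N \near U, forall t x, 0 <= t <= T -> frob x <= rho ->
      forall i, `|u N (index_at N t) i x - v i (t, x)| <= eps.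
    move=> H; near=> N => l lN i x xr.
    have N0 : (0 < N)%N by near: N; apply: near_oo; exact: nbhs_infty_gt.
    rewrite -{1}(index_at_clock N0 lN).
    move: i; move: xr; move: x; move: (clock_strip T0 N l); move: (clock T N l).
    suff : forall t, 0 <= t <= T -> forall x, frob x <= rho -> forall i, `|u N (index_at N t) i x - v i (t, x)| <= eps by [].
    by near: N; apply: filterS H => N H t tT x xr i; exact: H.
  apply: strip_cover => t0 x0 t0T.
  have e3 : 0 < eps / 3 by rewrite divr_gt0.
  pose rho1 := 2 * frob x0 + 2.
  have fx0 := frob_ge0 x0.
  have rho10 : 0 <= rho1 by rewrite /rho1; lra.
  have [r1 r10 Hr1] := u_equi rho10 e3.
  have [r2 r20 Hr2] := v_equi _ _ rho10 e3.
  exists (Num.min 1 (Num.min (r1 / 2) r2)).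
    by rewrite !lt_min ltr01 r20 divr_gt0.
  near=> N => t x tT; rewrite !lt_min => /andP[_ /andP[t1 t2]] /andP[x1 /andP[x2 x3]] i.
  have N0 : (0 < N)%N by near: N; apply: near_oo; exact: nbhs_infty_gt.
  have ts : tstep T N <= r1 / 2.
    suff /andP[] : 0 < tstep T N <= r1 / 2 by [].
    by near: N; apply: near_oo; apply: near_tstep => //; rewrite divr_gt0.
  have xr : frob x <= rho1.
    by have := frobD_le (x - x0) x0; rewrite subrK /rho1; lra.
  have x0r : frob x0 <= rho1 by rewrite /rho1; lra.
  have h1 : `|u N (index_at N t0) i x0 - v i (t0, x0)| <= eps / 3.
    by move: i; near: N; apply: filter_forall => i; exact: (Hv i (t0, x0)).
  have h2 : `|v i (t, x) - v i (t0, x0)| <= eps / 3 by apply: Hr2 => //; exact: ltW.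
  have HrN : forall l l' i x x', (l <= N)%N -> (l' <= N)%N ->
     `|l%:R - l'%:R| * tstep T N <= r1 -> frob x <= rho1 -> frob x' <= rho1 -> frob (x - x') <= r1 ->
     `|u N l i x - u N l' i x'| <= eps / 3 by near: N; exact: near_oo.
  have h3 : `|u N (index_at N t) i x - u N (index_at N t0) i x0| <= eps / 3.
    have [iN _ _] := index_atP N0 tT; have [iN' _ _] := index_atP N0 t0T.
    apply: HrN => //; last by move: (r10) (x2); clear_local; lra.
    apply: le_trans (index_at_lip N0 tT t0T) _; move: (t2) (t1) (ts); clear_local; lra.
  move: h1 h2 h3; clear_local; rewrite !ler_norml => /andP[? ?] /andP[? ?] /andP[? ?].
  by apply/andP; split; lra.
- move=> i t x tT; apply/ler_addgt0Pr => e e0; near U => N.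
  have N0 : (0 < N)%N by near: N; apply: near_oo; exact: nbhs_infty_gt.
  have h1 : `|u N (index_at N t) i x - v i (t, x)| <= e by near: N; exact: (Hv i (t, x)).
  have [iN _ _] := index_atP N0 tT.
  have HBN : forall l, (l <= N)%N -> forall i x, `|u N l i x| <= B * poly p x.
    by near: N; exact: near_oo.
  have := HBN _ iN i x.
  move: h1; rewrite !ler_norml => /andP[? ?] /andP[? ?]; apply/andP; split; lra.
- move=> i x; apply/eqP; rewrite -subr_eq0 -normr_le0; apply/ler_addgt0Pr => e e0; near U => N.
  have h1 : `|u N (index_at N T) i x - v i (T, x)| <= e.
    by near: N; apply: (Hv i (T, x)) => //=; rewrite lexx ltW.
  move: h1; rewrite /index_at subrr mul0r truncn0 u0 distrC add0r; exact.
Unshelve. all: by end_near. Qed.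

End UltraLimit.

(** * Exact action of one step on paraboloids *)

Section Quadratic.
Context {R : realType} {k d : nat}.
Hypothesis d0 : (0 < d)%N.

Definition paraboloid (c pt : R) (q : 'cV[R]_k) (M : 'M[R]_k) (t : R) (x : 'cV[R]_k)
    (t' : R) (x' : 'cV[R]_k) : R :=
  c + pt * (t' - t) + dotv q (x' - x) + 2^-1 * dotv (x' - x) (M *m (x' - x)).

Lemma paraboloid_next c pt q (M : 'M[R]_k) t x t' y (dt : R) b (s : 'M[R]_(k, d)) w :
  M^T = M -> 0 < dt ->
  paraboloid c pt q M t x (t' + dt) (y + incr dt b s w) =
  paraboloid c pt q M t x t' y + dt * (pt + dotv b (q + M *m (y - x)) + 2^-1 * dt * dotv b (M *m b))
  + Num.sqrt dt * dotv (s^T *m (q + M *m (y - x) + dt *: (M *m b))) (xi w)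
  + 2^-1 * dt * dotv (s *m xi w) (M *m (s *m xi w)).
Proof.
move=> MT dt0.
have sE : Num.sqrt dt * Num.sqrt dt = dt by rewrite -expr2 sqr_sqrtr // ltW.
have sym u v : dotv u (M *m v) = dotv v (M *m u) by rewrite dotv_mulmx MT dotvC.
rewrite /paraboloid.
have -> : y + incr dt b s w - x = (y - x) + incr dt b s w by rewrite addrAC.
move: (y - x) => z; set e := s *m xi w; set D := q + M *m z.
have e1 (i : 'cV[R]_k) : dotv q (z + i) + 2^-1 * dotv (z + i) (M *m (z + i)) =
    dotv q z + 2^-1 * dotv z (M *m z) + dotv D i + 2^-1 * dotv i (M *m i).
  rewrite mulmxDr !dotvDl !dotvDr (sym i z) (dotvC (M *m z)) (sym i z); by field.
have e2 : dotv D (incr dt b s w) = dt * dotv D b + Num.sqrt dt * dotv D e.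
  by rewrite dotvDr !dotvZr.
have e3 : dotv (incr dt b s w) (M *m incr dt b s w) =
    dt * dt * dotv b (M *m b) + 2 * (dt * Num.sqrt dt) * dotv (M *m b) e + dt * dotv e (M *m e).
  rewrite /incr -/e mulmxDr -!scalemxAr !dotvDl !dotvDr !dotvZl !dotvZr (sym b e) (dotvC (M *m b)).
  by rewrite -[in X in _ = _ + X * dotv e (M *m e)]sE; ring.
rewrite -addrA e1 e2 e3 (dotvC b D) -(dotv_mulmx s) -/e (dotvDl D) (dotvZl dt (M *m b)).
by field.
Qed.

(** The noise has the first two moments of a normalized Brownian increment, so the step is
    consistent without error except for the term [2^-1 * dt * dotv b (M *m b)]. *)
Lemma mean_paraboloid c pt q (M : 'M[R]_k) t x t' y (dt : R) b (s : 'M[R]_(k, d)) :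
  M^T = M -> 0 < dt ->
  mean (fun w => paraboloid c pt q M t x (t' + dt) (y + incr dt b s w)) =
  paraboloid c pt q M t x t' y + dt * (pt + dotv b (q + M *m (y - x))
     + 2^-1 * dt * dotv b (M *m b) + 2^-1 * \tr (s *m s^T *m M)).
Proof.
move=> MT dt0; under eq_mean do rewrite paraboloid_next //.
by rewrite meanD meanD mean_cst // !meanZ mean_xi mulr0 mean_quad //; ring.
Qed.

(** The quadratic part of the noise drops out by symmetry. What remains is [s^T] applied to the
    gradient at the shifted point [y + dt *: b]. *)
Lemma zvec_paraboloid c pt q (M : 'M[R]_k) t x t' y (dt : R) b (s : 'M[R]_(k, d)) :
  M^T = M -> 0 < dt ->
  zvec dt (fun w => paraboloid c pt q M t x (t' + dt) (y + incr dt b s w)) =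
  s^T *m (q + M *m (y - x) + dt *: (M *m b)).
Proof.
move=> MT dt0; apply/matrixP => a j; rewrite ord1 mxE.
under eq_mean do rewrite paraboloid_next //.
set A := paraboloid _ _ _ _ _ _ _ _ + _; set V := _ *m _.
have E w : (A + Num.sqrt dt * dotv V (xi w) + 2^-1 * dt * dotv (s *m xi w) (M *m (s *m xi w)))
     * (xi w : 'cV[R]_d) a 0 =
   A * dotv (delta_mx a 0) (xi w) + Num.sqrt dt * (dotv V (xi w) * dotv (delta_mx a 0) (xi w))
   + 2^-1 * dt * (dotv (s *m xi w) (M *m (s *m xi w)) * dotv (delta_mx a 0) (xi w)).
  by rewrite [dotv (delta_mx a 0) _]dotvC dotv_delta; ring.
rewrite (eq_mean E) meanD meanD !meanZ mean_xi mean_xi2 // mean_quad_odd dotv_delta.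
by rewrite !mulr0 add0r addr0 mulrAC mulfV ?mul1r // gt_eqF // sqrtr_gt0.
Qed.

End Quadratic.

(** * Continuity of the differential operator in all its arguments *)

Section Operator.
Context {R : realType} {I : Type} {F : set_system I} {FF : Filter F}.

(** Convergence by entries reduces products and traces to limits in [R]. *)
Definition ccvg a b (A : I -> 'M[R]_(a, b)) (A0 : 'M[R]_(a, b)) : Prop :=
  forall i j, A z i j @[z --> F] --> A0 i j.

Lemma cvg_bigsum n (u : I -> 'I_n -> R) (l : 'I_n -> R) :
  (forall i, u z i @[z --> F] --> l i) -> \sum_i u z i @[z --> F] --> \sum_i l i.
Proof.
move=> H; elim: n u l H => [|n IH] u l H.
  by rewrite big_ord0; under eq_fun do rewrite big_ord0; exact: cvg_cst.
rewrite big_ord_recl; under eq_fun do rewrite big_ord_recl.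
by apply: cvgD; [exact: H | apply: (IH (fun z i => u z (lift ord0 i)))].
Qed.

Lemma ccvg_mulmx a b c (A : I -> 'M[R]_(a, b)) A0 (B : I -> 'M[R]_(b, c)) B0 :
  ccvg A A0 -> ccvg B B0 -> ccvg (fun z => A z *m B z) (A0 *m B0).
Proof.
move=> HA HB i j; rewrite mxE; under eq_fun do rewrite mxE.
by apply: cvg_bigsum => l; exact: cvgM.
Qed.

Lemma ccvg_tr a b (A : I -> 'M[R]_(a, b)) A0 : ccvg A A0 -> ccvg (fun z => (A z)^T) A0^T.
Proof. by move=> HA i j; rewrite mxE; under eq_fun do rewrite mxE; exact: HA. Qed.

Lemma ccvgD a b (A : I -> 'M[R]_(a, b)) A0 B B0 :
  ccvg A A0 -> ccvg B B0 -> ccvg (fun z => A z + B z) (A0 + B0).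
Proof. by move=> HA HB i j; rewrite mxE; under eq_fun do rewrite mxE; exact: cvgD. Qed.

Lemma ccvgZ a b (c : I -> R) (c0 : R) (A : I -> 'M[R]_(a, b)) A0 :
  c z @[z --> F] --> c0 -> ccvg A A0 -> ccvg (fun z => c z *: A z) (c0 *: A0).
Proof. by move=> Hc HA i j; rewrite mxE; under eq_fun do rewrite mxE; exact: cvgM. Qed.

Lemma ccvg_cst a b (A : 'M[R]_(a, b)) : ccvg (fun=> A) A.
Proof. by move=> i j; exact: cvg_cst. Qed.

Lemma cvg_dotv k (u : I -> 'cV[R]_k) u0 v v0 :
  ccvg u u0 -> ccvg v v0 -> dotv (u z) (v z) @[z --> F] --> dotv u0 v0.
Proof. by move=> Hu Hv; apply: cvg_bigsum => i; exact: cvgM. Qed.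

Lemma cvg_trace k (A : I -> 'M[R]_k) A0 : ccvg A A0 -> \tr (A z) @[z --> F] --> \tr A0.
Proof. by move=> HA; apply: cvg_bigsum => i. Qed.

Lemma cvg_enorm a b (A : I -> 'M[R]_(a, b)) A0 :
  ccvg A A0 -> enorm (A z - A0) @[z --> F] --> (0 : R).
Proof.
move=> HA.
have H : frob (A z - A0) @[z --> F] --> frob (0 : 'M[R]_(a, b)).
  apply: cvg_bigsum => i; apply: cvg_bigsum => j.
  rewrite mxE -(subrr (A0 i j)); under eq_fun do rewrite !mxE.
  rewrite !expr2; under eq_fun do rewrite expr2.
  by apply: cvgM; apply: cvgB => //; exact: cvg_cst.
rewrite -[0](sqrtr0 R) -(frob0 a b).
exact: (continuous_cvg _ (@sqrt_continuous R _) H).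
Qed.

Variables (k d m : nat).

(** The second argument of the minimum in [system_lhs]. *)
Definition operator (b : 'cV[R]_k) (s : 'M[R]_(k, d)) (f : 'cV[R]_d -> R) (p : R) (q : 'cV[R]_k)
    (M : 'M[R]_k) : R :=
  - p - dotv b q - 2^-1 * \tr (s *m s^T *m M) - f (s^T *m q).

Lemma operator_cvg (C : R) (b : I -> 'cV[R]_k) b0 (s : I -> 'M[R]_(k, d)) s0
    (f : I -> 'cV[R]_m -> 'cV[R]_d -> R) (f0 : 'cV[R]_m -> 'cV[R]_d -> R) (Y : I -> 'cV[R]_m) Y0 (p : I -> R) (p0 : R) q q0 M M0 :
  0 <= C ->
  (forall y z y' z', `|f0 y z - f0 y' z'| <= C * (\sum_j `|y j 0 - y' j 0| + enorm (z - z'))) ->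
  (forall e, 0 < e -> \forall z \near F, forall y v, `|f z y v - f0 y v| <= e) ->
  ccvg b b0 -> ccvg s s0 -> ccvg Y Y0 -> p z @[z --> F] --> p0 -> ccvg q q0 -> ccvg M M0 ->
  operator (b z) (s z) (f z (Y z)) (p z) (q z) (M z) @[z --> F] -->
  operator b0 s0 (f0 Y0) p0 q0 M0.
Proof.
move=> C0 f_lip f_cont Hb Hs HY Hp Hq HM; rewrite /operator.
have Hsq : ccvg (fun z => (s z)^T *m q z) (s0^T *m q0).
  by apply: ccvg_mulmx => //; exact: ccvg_tr.
apply: cvgB; last first.
  have HYs : \sum_j `|Y z j 0 - Y0 j 0| @[z --> F] --> \sum_(j < m) (0 : R).
    apply: (@cvg_bigsum m (fun z j => `|Y z j 0 - Y0 j 0|)) => j.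
    rewrite -[X in _ --> X](normr0 R) -(subrr (Y0 j 0)).
    by apply: cvg_norm; apply: cvgB => //; exact: cvg_cst.
  rewrite big1 // in HYs.
  have H1 : C * (\sum_j `|Y z j 0 - Y0 j 0| + enorm ((s z)^T *m q z - s0^T *m q0)) @[z --> F] -->
      C * (0 + 0).
    by apply: cvgM; [exact: cvg_cst | apply: cvgD => //; exact: cvg_enorm].
  rewrite addr0 mulr0 in H1.
  apply/cvgrPdist_le => e e0.
  have e2 : 0 < e / 2 by rewrite divr_gt0.
  have /cvgrPdist_le/(_ _ e2) H2 := H1.
  apply: filterS2 (f_cont _ e2) H2 => z h1 h2.
  have h3 := h1 (Y z) ((s z)^T *m q z).
  have h4 := f_lip (Y z) ((s z)^T *m q z) Y0 (s0^T *m q0).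
  rewrite sub0r normrN in h2.
  have h5 := le_trans (ler_norm _) h2.
  rewrite distrC; have := ler_distD (f0 (Y z) ((s z)^T *m q z)) (f z (Y z) ((s z)^T *m q z)) (f0 Y0 (s0^T *m q0)).
  lra.
apply: cvgB; last first.
  apply: cvgM; first exact: cvg_cst.
  apply: cvg_trace; apply: ccvg_mulmx => //; apply: ccvg_mulmx => //.
  exact: ccvg_tr.
by apply: cvgB; [exact: cvgN | exact: cvg_dotv].
Qed.

End Operator.

(** * A paraboloid touching a discrete solution *)

Section DiscreteTouch.
Context {R : realType} {k d m : nat}.
Hypothesis d0 : (0 < d)%N.

(** The sign [sg] treats contact from below and from above at once. The generator sees the gradient
    of [u] instead of that of the paraboloid; the discrepancy is at most [C] times the gradient of
    their difference [om], and a change of weights turns it into a mean of [om], which is at least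
    [I0]. *)
Lemma discrete_touch (C dt sg I0 gap a pt t t' : R) p (c : @coef R k d m) (u : 'I_m -> 'cV[R]_k -> R)
    i (x y q : 'cV[R]_k) (M : 'M[R]_k) :
  0 <= C -> 0 < dt -> dt * d%:R * C ^+ 2 <= 1 -> wf_coef C p c -> sg * sg = 1 -> M^T = M ->
  (forall w, I0 <= sg * u i (next c dt y w) - paraboloid a pt q M t x (t' + dt) (next c dt y w)) ->
  sg * pre c dt u i y <= paraboloid a pt q M t x t' y + I0 + dt * gap ->
  - gap <= sg * operator (drift c y) (vol c y) (gen c i y (\col_j u j y))
     (sg * (pt - 2^-1 * dt * dotv (drift c y) (M *m drift c y)))
     (sg *: (q + M *m (y - x) + dt *: (M *m drift c y))) (sg *: M).
Proof.
move=> C0 dt0 dtC wf sg2 MT HI Hp.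
set Psi := fun w => paraboloid a pt q M t x (t' + dt) (next c dt y w).
set om := fun w => sg * u i (next c dt y w) - Psi w.
set D := q + M *m (y - x) in Hp *.
set be := drift c y; set s := vol c y.
have zPsi : zvec dt Psi = s^T *m (D + dt *: (M *m be)) by exact: zvec_paraboloid.
have mPsi : mean Psi = paraboloid a pt q M t x t' y + dt * (pt + dotv be D
     + 2^-1 * dt * dotv be (M *m be) + 2^-1 * \tr (s *m s^T *m M)) by exact: mean_paraboloid.
have [b bC bE] := enorm_linear (zvec dt om) C0.
have zE : slope c dt u i y - sg *: zvec dt Psi = sg *: zvec dt om.
  apply/matrixP => j l; rewrite !mxE.
  have -> : mean (fun w => om w * (xi w : 'cV[R]_d) j 0) =
      sg * mean (fun w => u i (next c dt y w) * (xi w : 'cV[R]_d) j 0)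
      - mean (fun w => Psi w * (xi w : 'cV[R]_d) j 0).
    by rewrite -meanZ -meanB; apply: eq_mean => w; rewrite /om; ring.
  by rewrite mulrBl mulrBr !mulrA sg2 mul1r.
have bN : frob (- b) <= C ^+ 2 by rewrite frobN.
have H1 : I0 <= mean om + dt * dotv (- b) (zvec dt om).
  rewrite -mean_wtE // -[leLHS](mean_wt_cst d0 dt (- b)).
  by apply: (mean_wt_le (ltW dt0) bN dtC) => w; exact: HI.
set Y := \col_j u j y.
have H2 : sg * gen c i y Y (sg *: zvec dt Psi) - dotv b (zvec dt om) <= sg * genu c dt u i y.
  have := wf_lip wf i y Y (slope c dt u i y) Y (sg *: zvec dt Psi).
  rewrite big1 ?add0r; last by move=> j _; rewrite subrr normr0.
  have -> : enorm (slope c dt u i y - sg *: zvec dt Psi) = enorm (zvec dt om).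
    apply/eqP; rewrite zE -(@eqrXn2 _ 2) ?enorm_ge0 //.
    by rewrite !enorm_sqr frobZ expr2 sg2 mul1r.
  rewrite bE -/(genu c dt u i y) => H.
  have := ler_norm (- sg * (genu c dt u i y - gen c i y Y (sg *: zvec dt Psi))).
  have n1 : `|- sg| = 1.
    rewrite normrN; apply/eqP; rewrite -(@eqrXn2 _ 2) ?normr_ge0 // expr1n -normrX expr2 sg2 normr1 //.
  rewrite normrM n1 mul1r; lra.
have mom : mean om = sg * mean (fun w => u i (next c dt y w)) - mean Psi.
  by rewrite -meanZ -meanB.
have H3 := ler_wpM2l (ltW dt0) H2.
have preE : sg * pre c dt u i y = sg * mean (fun w => u i (next c dt y w)) + dt * (sg * genu c dt u i y).
  by rewrite /pre; ring.
rewrite dotvNl in H1.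
have OpE : sg * operator be s (gen c i y Y)
     (sg * (pt - 2^-1 * dt * dotv be (M *m be)))
     (sg *: (D + dt *: (M *m be))) (sg *: M) =
   - (pt + dotv be D + 2^-1 * dt * dotv be (M *m be) + 2^-1 * \tr (s *m s^T *m M))
   - sg * gen c i y Y (sg *: zvec dt Psi).
  rewrite /operator zPsi -!scalemxAr mxtraceZ dotvZr (dotvDr D) dotvZr.
  set gg := gen _ _ _ _ _; set tt := \tr _.
  have -> : sg * (- (sg * (pt - 2^-1 * dt * dotv be (M *m be))) - sg * (dotv be D + dt * dotv be (M *m be))
      - 2^-1 * (sg * tt) - gg) =
      sg * sg * (- (pt - 2^-1 * dt * dotv be (M *m be)) - (dotv be D + dt * dotv be (M *m be))
      - 2^-1 * tt) - sg * gg by ring.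
  by rewrite sg2; field.
rewrite OpE -(ler_pM2l dt0).
move: H1 H3 Hp; rewrite preE mom mPsi.
move: (dotv b _) (sg * genu c dt u i y) (sg * gen _ _ _ _ _) => z1 z2 z3; lra.
Qed.

End DiscreteTouch.

(** * The operator near a point of the strip *)

Section OperatorContinuity.
Context {R : realType}.
Variables (T : R) (k d m : nat) (b : R * 'cV[R]_k -> 'cV[R]_k)
  (sigma : R * 'cV[R]_k -> 'M[R]_(k, d))
  (f : 'I_m -> R * 'cV[R]_k -> 'cV[R]_m -> 'cV[R]_d -> R) (C : R).
Hypotheses (C0 : 0 <= C)
  (f_lip : forall i t x y z y' z', 0 <= t <= T -> `|f i (t, x) y z - f i (t, x) y' z'|
     <= C * (\sum_j `|y j 0 - y' j 0| + enorm (z - z')))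
  (b_cont : equicontinuous_strip T (fun i tx => b tx i 0))
  (s_cont : equicontinuous_strip T (fun ij tx => sigma tx ij.1 ij.2))
  (f_cont : equicontinuous_strip T (fun iyz tx => f iyz.1.1 tx iyz.1.2 iyz.2)).

Lemma operator_cvg_strip (I : Type) (F : set_system I) (FF : Filter F) i (t : R) x
    (tz : I -> R) (xz : I -> 'cV[R]_k) (Y : I -> 'cV[R]_m) Y0 (p : I -> R) (p0 : R) q q0 M M0 :
  0 <= t <= T -> (\forall z \near F, 0 <= tz z <= T) ->
  tz z @[z --> F] --> t -> ccvg (F := F) xz x ->
  ccvg (F := F) Y Y0 -> p z @[z --> F] --> p0 -> ccvg (F := F) q q0 -> ccvg (F := F) M M0 ->
  operator (b (tz z, xz z)) (sigma (tz z, xz z)) (f i (tz z, xz z) (Y z)) (p z) (q z) (M z) @[z --> F]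
  --> operator (b (t, x)) (sigma (t, x)) (f i (t, x) Y0) p0 q0 M0.
Proof.
move=> tT tzT Ht Hx HY Hp Hq HM.
have close (r : R) : 0 < r -> \forall z \near F, [/\ 0 <= tz z <= T, `|tz z - t| < r & frob (xz z - x) < r].
  move=> r0; have r2 : 0 < r / 2 by rewrite divr_gt0.
  have r3 : r / 2 < r by lra.
  move/cvgrPdist_le/(_ _ r2) : (Ht) => Ht'.
  have Hfr : frob (xz z - x) @[z --> F] --> frob (x - x).
    have Hd : ccvg (F := F) (fun z => xz z - x) (x - x).
      by apply: ccvgD => //; exact: ccvg_cst.
    rewrite -dotvv; under eq_fun do rewrite -dotvv.
    exact: cvg_dotv.
  move/cvgrPdist_le/(_ _ r2) : Hfr; rewrite subrr frob0 => Hfr.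
  apply: filterS3 tzT Ht' Hfr => z h1 h2 h3; split => //.
    by rewrite distrC; apply: le_lt_trans h2 _.
  by rewrite sub0r normrN in h3; apply: le_lt_trans (le_trans (ler_norm _) h3) _.
apply: (@operator_cvg R I F FF k d m C (fun z => b (tz z, xz z)) (b (t, x))
  (fun z => sigma (tz z, xz z)) (sigma (t, x)) (fun z => f i (tz z, xz z)) (f i (t, x))
  Y Y0 p p0 q q0 M M0 C0) => //.
- by move=> y z y' z'; exact: f_lip.
- move=> e e0; have [r r0 Hr] := f_cont x tT e0.
  apply: filterS (close r r0) => z [h1 h2 h3] y w.
  exact: (Hr _ _ h1 h2 h3 (i, y, w)).
- move=> a a'; rewrite ord1; apply/cvgrPdist_le => e e0; have [r r0 Hr] := b_cont x tT e0.
  by apply: filterS (close r r0) => z [h1 h2 h3]; rewrite distrC; exact: Hr.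
- move=> a a'; apply/cvgrPdist_le => e e0; have [r r0 Hr] := s_cont x tT e0.
  apply: filterS (close r r0) => z [h1 h2 h3]; rewrite distrC.
  exact: (Hr _ _ h1 h2 h3 (a, a')).
Qed.

(** The filter generated by the sets [near_set r] packs the perturbations of all arguments together,
    so convergence along it is the statement with a single radius. *)
Lemma operator_perturbed (sg pt eps t : R) i (x q : 'cV[R]_k) (M : 'M[R]_k) (Y0 : 'cV[R]_m) :
  0 <= t <= T -> 0 < eps ->
  exists2 r : R, 0 < r & forall t' y (Y : 'cV[R]_m) (dt : R), 0 <= t' <= T -> `|t' - t| <= r ->
    frob (y - x) <= r -> (forall j, `|Y j 0 - Y0 j 0| <= r) -> `|dt| <= r ->
    sg * operator (b (t', y)) (sigma (t', y)) (f i (t', y) Y)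
      (sg * (pt - 2^-1 * dt * dotv (b (t', y)) (M *m b (t', y))))
      (sg *: (q + M *m (y - x) + dt *: (M *m b (t', y)))) (sg *: M)
    <= sg * operator (b (t, x)) (sigma (t, x)) (f i (t, x) Y0) (sg * pt) (sg *: q) (sg *: M) + eps.
Proof.
move=> tT eps0.
pose I := (R * 'cV[R]_k * 'cV[R]_m * R)%type.
pose near_set (r : R) : set I := [set z : R * 'cV[R]_k * 'cV[R]_m * R | [/\ 0 <= z.1.1.1 <= T, `|z.1.1.1 - t| <= r,
    frob (z.1.1.2 - x) <= r, (forall j, `|z.1.2 j 0 - Y0 j 0| <= r) & `|z.2| <= r]].
pose F := filter_from [set r : R | 0 < r] near_set.
have FF : Filter F.
  apply: filter_from_filter; first by exists 1 => /=.
  move=> r1 r2 /= r10 r20; exists (Num.min r1 r2); first by rewrite /= lt_min r10.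
  move=> z [z1 z2 z3 z4 z5]; split; split => //.
  - by apply: le_trans z2 _; rewrite ge_min lexx.
  - by apply: le_trans z3 _; rewrite ge_min lexx.
  - by move=> j; apply: le_trans (z4 j) _; rewrite ge_min lexx.
  - by apply: le_trans z5 _; rewrite ge_min lexx.
  - by apply: le_trans z2 _; rewrite ge_min lexx orbT.
  - by apply: le_trans z3 _; rewrite ge_min lexx orbT.
  - by move=> j; apply: le_trans (z4 j) _; rewrite ge_min lexx orbT.
  - by apply: le_trans z5 _; rewrite ge_min lexx orbT.
have base (r : R) : 0 < r -> F (near_set r) by move=> r0; exists r.
have Ht : (z : I).1.1.1 @[z --> F] --> t.
  apply/cvgrPdist_le => e e0; apply: filterS (base e e0) => z [_ h _ _ _].
  by rewrite distrC.
have Hx : ccvg (F := F) (fun z : I => z.1.1.2) x.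
  move=> a a'; apply/cvgrPdist_le => e e0.
  apply: filterS (base (e ^+ 2) (exprn_gt0 2 e0)) => z [_ _ h _ _].
  have := le_trans (coord_frob (z.1.1.2 - x) a a') h.
  rewrite !mxE distrC -(real_normK (num_real (z.1.1.2 a a' - x a a'))).
  by rewrite ler_pXn2r ?nnegrE ?normr_ge0 ?(ltW e0).
have HY : ccvg (F := F) (fun z : I => z.1.2) Y0.
  move=> a a'; rewrite ord1; apply/cvgrPdist_le => e e0; apply: filterS (base e e0) => z [_ _ _ h _].
  by rewrite distrC.
have Hdt : (z : I).2 @[z --> F] --> (0 : R).
  apply/cvgrPdist_le => e e0; apply: filterS (base e e0) => z [_ _ _ _ h].
  by rewrite sub0r normrN.
have HT : \forall z \near F, 0 <= (z : I).1.1.1 <= T.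
  by apply: filterS (base 1 ltr01) => z [].
have Hb : ccvg (F := F) (fun z : I => b (z.1.1.1, z.1.1.2)) (b (t, x)).
  move=> a a'; rewrite ord1; apply/cvgrPdist_le => e e0; have [r r0 Hr] := b_cont x tT e0.
  have r20 : 0 < r / 2 by rewrite divr_gt0.
  apply: filterS (base (r / 2) r20) => z [h1 h2 h3 _ _]; rewrite distrC.
  have r2 : r / 2 < r by lra.
  by apply: Hr => //; [exact: le_lt_trans h2 _ | exact: le_lt_trans h3 _].
have HMb : ccvg (F := F) (fun z : I => M *m b (z.1.1.1, z.1.1.2)) (M *m b (t, x)).
  by apply: ccvg_mulmx => //; exact: ccvg_cst.
have Hop := @operator_cvg_strip I F FF i t x (fun z => z.1.1.1) (fun z => z.1.1.2) (fun z => z.1.2) Y0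
  (fun z => sg * (pt - 2^-1 * z.2 * dotv (b (z.1.1.1, z.1.1.2)) (M *m b (z.1.1.1, z.1.1.2))))
  (sg * (pt - 2^-1 * 0 * dotv (b (t, x)) (M *m b (t, x))))
  (fun z => sg *: (q + M *m (z.1.1.2 - x) + z.2 *: (M *m b (z.1.1.1, z.1.1.2))))
  (sg *: (q + M *m (x - x) + 0 *: (M *m b (t, x))))
  (fun=> sg *: M) (sg *: M) tT HT Ht Hx HY.
have Hp : sg * (pt - 2^-1 * (z : I).2 * dotv (b (z.1.1.1, z.1.1.2)) (M *m b (z.1.1.1, z.1.1.2))) @[z --> F]
   --> sg * (pt - 2^-1 * 0 * dotv (b (t, x)) (M *m b (t, x))).
  apply: cvgM; [exact: cvg_cst | apply: cvgB]; first exact: cvg_cst.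
  by apply: cvgM; [by apply: cvgM => //; exact: cvg_cst | exact: cvg_dotv].
have Hq : ccvg (F := F) (fun z : I => sg *: (q + M *m (z.1.1.2 - x) + z.2 *: (M *m b (z.1.1.1, z.1.1.2))))
    (sg *: (q + M *m (x - x) + 0 *: (M *m b (t, x)))).
  apply: ccvgZ; first exact: cvg_cst.
  apply: ccvgD; last exact: ccvgZ.
  apply: ccvgD; first exact: ccvg_cst.
  apply: ccvg_mulmx; first exact: ccvg_cst.
  by apply: ccvgD => //; exact: ccvg_cst.
have HMc : ccvg (F := F) (fun=> sg *: M) (sg *: M) by exact: ccvg_cst.
have {}Hop := Hop Hp Hq HMc.
rewrite subrr mulmx0 scale0r !addr0 mulr0 mul0r subr0 in Hop.
have mul_sg (A : I -> R) (l : R) : A z @[z --> F] --> l -> sg * A z @[z --> F] --> sg * l.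
  by move=> H; apply: cvgM => //; exact: cvg_cst.
have {}Hop := mul_sg _ _ Hop.
move/cvgrPdist_le/(_ _ eps0) : Hop => [r /= r0 Hr].
exists r => // t' y Y dt t'T h1 h2 h3 h4.
have := Hr (t', y, Y, dt); rewrite /near_set /= => /(_ (And5 t'T h1 h2 h3 h4)).
by rewrite ler_norml => /andP[h _]; lra.
Qed.

End OperatorContinuity.

(** * From the scheme to the viscosity inequality *)

Lemma clockE (R : realType) (T : R) N l : 0 < T -> (0 < N)%N -> (l <= N)%N ->
  clock T N l = T - l%:R * tstep T N.
Proof.
move=> T0 N0 lN; rewrite /clock max_r // subr_ge0 -[leRHS](tstepN T N0).
by rewrite ler_pM2r ?ler_nat // tstep_gt0.
Qed.

Lemma clockS (R : realType) (T : R) N l : 0 < T -> (0 < N)%N -> (l < N)%N ->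
  clock T N l = clock T N l.+1 + tstep T N.
Proof. by move=> T0 N0 lN; rewrite !clockE // 1?ltnW // -natr1; ring. Qed.

(* Only times after [t] are explored, so the penalty [e * (clock - t)] is smooth there. *)
Lemma almost_minimum (R : realType) (k : nat) (T t r e mu gap : R) (x : 'cV[R]_k) (N : nat)
    (w : nat -> 'cV[R]_k -> R) :
  0 < T -> (0 < N)%N -> 0 <= t -> 0 < r -> t + r < T -> tstep T N <= r / 4 -> 0 < e -> 0 < mu ->
  20 * mu <= e * r -> 0 < gap -> gap <= mu ->
  (forall l y, (l <= N)%N -> t <= clock T N l <= t + r -> frob (y - x) <= r ->
     e * (clock T N l - t) + e * frob (y - x) - mu <= w l y) ->
  w (index_at T N t) x <= 3 * mu ->
  exists l y I0, [/\ (l < N)%N, t <= clock T N l.+1 <= t + r, frob (y - x) <= r / 4,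
    w l.+1 y <= I0 + gap & forall z, frob (z - y) <= r / 4 -> I0 <= w l z].
Proof.
move=> T0 N0 t0 r0 trT dtr e0 mu0 mur gap0 gapmu low start.
have tT : 0 <= t <= T by apply/andP; split; lra.
have [iN i1 i2] := index_atP T0 N0 tT.
pose E := [set z : R | exists l y, [/\ (l <= N)%N, t <= clock T N l <= t + r, frob (y - x) <= r & z = w l y]].
have E0 : E (w (index_at T N t) x).
  exists (index_at T N t), x; split => //; last by rewrite subrr frob0 ltW.
  by rewrite clockE //; apply/andP; split; lra.
have Elow : lbound E (- mu).
  move=> _ [l [y [lN /andP[c1 c2] yr ->]]]; apply: le_trans (low l y lN _ yr); last by rewrite c1.
  have h1 : 0 <= e * (clock T N l - t) by rewrite mulr_ge0 ?subr_ge0 // ltW.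
  have h2 : 0 <= e * frob (y - x) by rewrite mulr_ge0 ?frob_ge0 // ltW.
  lra.
have Einf : has_inf E by split; [exists (w (index_at T N t) x) | exists (- mu)].
have [z [l [y [lN /andP[c1 c2] yr ->]]] zlt] := inf_adherent gap0 Einf.
have infle : inf E <= 3 * mu by apply: le_trans start; apply: ge_inf => //; exists (- mu).
have cc : t <= clock T N l <= t + r by rewrite c1.
have lowl := low l y lN cc yr.
have h1 : 0 <= e * (clock T N l - t) by rewrite mulr_ge0 ?subr_ge0 // ltW.
have h2 : 0 <= e * frob (y - x) by rewrite mulr_ge0 ?frob_ge0 // ltW.
(* The value found is below [4 * mu], so each penalty is below [5 * mu <= e * r / 4], which is the
   origin of the factor 20. *)
have c4 : clock T N l - t <= r / 4 by rewrite -(ler_pM2l e0); lra.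
have y4 : frob (y - x) <= r / 4 by rewrite -(ler_pM2l e0); lra.
(* Index 0 is the time [T], beyond [t + r]; so the point found is the outcome of a step. *)
have l0 : (0 < l)%N.
  by case: l c2 {lN c1 yr zlt cc lowl h1 c4} => //; rewrite clock0 //; lra.
case: l l0 lN c1 c2 zlt cc lowl h1 c4 => // l _ lN c1 c2 zlt cc lowl h1 c4.
exists l, y, (inf E); split => //; first exact: ltW.
move=> u uy; apply: ge_inf; first by exists (- mu).
exists l, u; split => //; first exact: ltnW.
  by rewrite clockS //; apply/andP; split; lra.
have := frob_triangle u y x; lra.
Qed.

(** A violation by [4 * eps] is contradictory: one [eps] goes into making the jet strict, one into
    moving to the discrete contact point, and one into the approximate minimum, which is accurate up
    to [dt * eps] because the scheme is divided by [dt]. *)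
Lemma viscosity_touch (R : realType) (T : R) (k d m : nat) (b : R * 'cV[R]_k -> 'cV[R]_k)
  (sigma : R * 'cV[R]_k -> 'M[R]_(k, d))
  (f : 'I_m -> R * 'cV[R]_k -> 'cV[R]_m -> 'cV[R]_d -> R)
  (g : 'I_m -> 'I_m -> R * 'cV[R]_k -> R) (C : R) (n : nat)
  (u : nat -> nat -> 'I_m -> 'cV[R]_k -> R) (U : set_system nat) (v : 'I_m -> R * 'cV[R]_k -> R)
  (sg t p : R) (i : 'I_m) (x q : 'cV[R]_k) (M : 'M[R]_k) :
  0 < T -> (0 < d)%N -> 1 <= C ->
  (forall t, 0 <= t <= T -> wf_coef C n (coef_at b sigma f g t)) ->
  equicontinuous_strip T (fun i tx => b tx i 0) ->
  equicontinuous_strip T (fun ij tx => sigma tx ij.1 ij.2) ->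
  equicontinuous_strip T (fun iyz tx => f iyz.1.1 tx iyz.1.2 iyz.2) ->
  ProperFilter U -> \oo `<=` U ->
  (forall rho eps : R, 0 < eps -> \forall N \near U, forall l, (l <= N)%N ->
        forall i x, frob x <= rho -> `|u N l i x - v i (clock T N l, x)| <= eps) ->
  (forall rho eps : R, 0 <= rho -> 0 < eps -> exists2 r : R, 0 < r & forall t t' x x', 0 <= t <= T ->
        0 <= t' <= T -> frob x <= rho -> frob x' <= rho -> `|t - t'| <= r -> frob (x - x') <= r ->
        forall i, `|v i (t, x) - v i (t', x')| <= eps) ->
  sg = 1 \/ sg = -1 -> 0 <= t < T -> M^T = M ->
  (forall e : R, 0 < e -> exists2 r : R, 0 < r & forall t' x', 0 <= t' <= T -> `|t' - t| < r ->
     frob (x' - x) < r -> sg * jet_expansion (v i) t x p q M t' x'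
        - e * (`|t' - t| + frob (x' - x)) <= sg * v i (t', x')) ->
  (exists2 r : R, 0 < r & \forall N \near U, forall l y, (l < N)%N -> `|clock T N l.+1 - t| <= r ->
     frob (y - x) <= r -> 0 <= sg * (u N l.+1 i y -
        pre (coef_at b sigma f g (clock T N l.+1)) (tstep T N) (u N l) i y)) ->
  0 <= sg * operator (b (t, x)) (sigma (t, x)) (f i (t, x) (\col_j v j (t, x))) p q M.
Proof.
move=> T0 d0 C1 wf b_cont s_cont f_cont PU ooU v1 v2 sgE /andP[t0 tT] MT jet [r0 r00 sch].
have C0 : 0 <= C := le_trans ler01 C1.
have sg2 : sg * sg = 1 by case: sgE => ->; ring.
have near_oo (P : nat -> Prop) : (\forall N \near \oo, P N) -> \forall N \near U, P N by exact: ooU.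
have tTT : 0 <= t <= T by rewrite t0 ltW.
rewrite leNgt; apply/negP; set Op := operator _ _ _ _ _ _ => neg.
pose eps := - (sg * Op) / 4.
have eps0 : 0 < eps by rewrite divr_gt0 // oppr_gt0.
have epsE : sg * Op = - (4 * eps) by rewrite /eps; by field.
pose tr0 := \tr (sigma (t, x) *m (sigma (t, x))^T).
have tr1 : 0 <= 2 + 2 * `|tr0| by rewrite addr_ge0 // mulr_ge0.
have [e /andP[e0 e1] eM] := small_factor tr1 eps0.
(* The paraboloid is lowered by [2 * e * (t' - t)] and [2 * e * frob (x' - x)], for [t' >= t]: one
   half absorbs the error term of the jet, the other is a strict margin. *)
pose pt := sg * p - 2 * e; pose Mh := sg *: M - (4 * e)%:M.
have MhT : Mh^T = Mh by rewrite /Mh linearB /= linearZ /= MT tr_scalar_mx.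
have sgx (z : R) : sg * (sg * z) = z by rewrite mulrA sg2 mul1r.
have base : sg * operator (b (t, x)) (sigma (t, x)) (f i (t, x) (\col_j v j (t, x)))
    (sg * pt) (sg *: (sg *: q)) (sg *: Mh) <= - (3 * eps).
  have -> : operator (b (t, x)) (sigma (t, x)) (f i (t, x) (\col_j v j (t, x)))
    (sg * pt) (sg *: (sg *: q)) (sg *: Mh) = Op + sg * (2 * e) + sg * (2 * e * tr0).
    rewrite /Op /operator scalerA sg2 scale1r /Mh scalerBr scalerA sg2 scale1r scale_scalar_mx.
    rewrite mulmxBr mul_mx_scalar linearB /= mxtraceZ -/tr0 /pt mulrBr sgx; by field.
  rewrite 2!(mulrDr sg) 2!sgx epsE.
  have h1 : e * (2 * tr0) <= e * (2 * `|tr0|) by rewrite ler_wpM2l ?(ltW e0) // ler_pM2l // ler_norm.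
  move: eM h1; clear; move: (`|tr0|) => *; lra.
have [r1 r10 H1] := operator_perturbed C0 (fun i t x y z y' z' tT => wf_lip (wf t tT) i x y z y' z')
   b_cont s_cont f_cont sg pt i x (sg *: q) Mh (\col_j v j (t, x)) tTT eps0.
have [r2 r20 jet2] := jet e e0.
pose rho := 2 * frob x + 2.
have fx0 := frob_ge0 x.
have rho0 : 0 <= rho by rewrite /rho addr_ge0 // mulr_ge0.
have r12 : 0 < r1 / 2 by rewrite divr_gt0.
have [r3 r30 H3] := v2 rho (r1 / 2) rho0 r12.
have [r [r_gt0 rT rr1 rr2 [rr3 rr0 r_1]]] : exists r : R, [/\ 0 < r, t + r < T, r <= r1 / 2, r < r2 &
    [/\ r <= r3 / 2, r <= r0 & r <= 1]].
  exists (Num.min ((T - t) / 2) (Num.min (r1 / 2) (Num.min (r2 / 2) (Num.min (r3 / 2) (Num.min r0 1))))).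
  have Tt : 0 < (T - t) / 2 by rewrite divr_gt0 // subr_gt0.
  have r22 : 0 < r2 / 2 by rewrite divr_gt0.
  have r32 : 0 < r3 / 2 by rewrite divr_gt0.
  set mn := Num.min _ _.
  have m1 : mn <= (T - t) / 2 by rewrite /mn !ge_min lexx.
  have m2 : mn <= r1 / 2 by rewrite /mn !ge_min lexx !orbT.
  have m3 : mn <= r2 / 2 by rewrite /mn !ge_min lexx !orbT.
  have m4 : mn <= r3 / 2 by rewrite /mn !ge_min lexx !orbT.
  have m5 : mn <= r0 by rewrite /mn !ge_min lexx !orbT.
  have m6 : mn <= 1 by rewrite /mn !ge_min lexx !orbT.
  split => //; [by rewrite /mn !lt_min Tt r12 r22 r32 r00 ltr01 | | ].
    by move: m1 Tt; clear; lra.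
  by move: m3 r22; clear; lra.
have mu_ex : exists mu : R, [/\ 0 < mu, 20 * mu <= e * r & mu <= r1 / 2].
  exists (Num.min (e * r / 20) (r1 / 2)).
  have er : 0 < e * r / 20 by rewrite divr_gt0 // mulr_gt0.
  have m1 : Num.min (e * r / 20) (r1 / 2) <= e * r / 20 by rewrite ge_min lexx.
  split; [by rewrite lt_min er | | by rewrite ge_min lexx orbT].
  by move: m1; clear; lra.
have [mu [mu0 mur mur1]] := mu_ex.
have [r4 r40 H4] := v2 rho mu rho0 mu0.
pose S := (2 + 2 * d%:R) * (C * (1 + rho)).
have S0 : 0 <= S by rewrite /S !mulr_ge0 ?addr_ge0 // mulr_ge0.
have r4' : 0 < r / 4 by rewrite divr_gt0.
(* [a1] keeps the next points within [r / 4] of the contact point, [a2] bounds the effect of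
   rounding [t] to the grid on the paraboloid, [a3] brings the accuracy [dt * eps] below [mu]. *)
have [a1 /andP[a10 a11] a1M] := small_factor S0 r4'.
have [a2 /andP[a20 a21] a2M] := small_factor (normr_ge0 pt) mu0.
have [a3 /andP[a30 a31] a3M] := small_factor (ltW eps0) mu0.
have small (a : R) : 0 < a -> (\forall N \near U, tstep T N <= a).
  move=> a0; apply: near_oo; apply: filterS (near_tstep T0 a0) => K /andP[] //.
near U => N.
have [t01 tC _ N0] : [/\ 0 < tstep T N <= 1, tstep T N * d%:R * C ^+ 2 <= 1,
    8 * tstep T N * C ^+ 2 <= 1 & (0 < N)%N] by near: N; apply: near_oo; exact: near_tstep_small.
have /andP[dt0 dt1] := t01.
have dta1 : tstep T N <= a1 by near: N; exact: small.
have dta2 : tstep T N <= a2 by near: N; exact: small.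
have dta3 : tstep T N <= a3 by near: N; exact: small.
have dtr4 : tstep T N <= r4 by near: N; exact: small.
have dtr : tstep T N <= r / 4 by near: N; exact: small.
have v1N : forall l, (l <= N)%N ->
   forall i x, frob x <= rho -> `|u N l i x - v i (clock T N l, x)| <= mu by near: N; exact: v1.
have schN : forall l y, (l < N)%N -> `|clock T N l.+1 - t| <= r0 ->
     frob (y - x) <= r0 -> 0 <= sg * (u N l.+1 i y -
        pre (coef_at b sigma f g (clock T N l.+1)) (tstep T N) (u N l) i y) by near: N.
pose Psi := paraboloid (sg * v i (t, x)) pt (sg *: q) Mh t x.
pose w l y := sg * u N l i y - Psi (clock T N l) y.
have nsg : `|sg| = 1 by case: sgE => ->; rewrite ?normrN normr1.
have sgv l y : (l <= N)%N -> frob y <= rho -> `|sg * u N l i y - sg * v i (clock T N l, y)| <= mu.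
  by move=> lN yr; rewrite -mulrBr normrM nsg mul1r; exact: v1N.
have ball_rho y : frob (y - x) <= r -> frob y <= rho.
  move=> yr; have := frobD_le (y - x) x; rewrite subrK /rho; move: yr r_1; clear; lra.
have frob_scalar (z : 'cV[R]_k) : dotv z (Mh *m z) = sg * dotv z (M *m z) - 4 * e * frob z.
  by rewrite /Mh mulmxBl mul_scalar_mx -scalemxAl dotvDr dotvNr !dotvZr dotvv.
have PsiE t' y : Psi t' y = sg * jet_expansion (v i) t x p q M t' y - 2 * e * (t' - t) - 2 * e * frob (y - x).
  by rewrite /Psi /paraboloid /jet_expansion frob_scalar dotvZl /pt; by field.
have low l y : (l <= N)%N -> t <= clock T N l <= t + r -> frob (y - x) <= r ->
     e * (clock T N l - t) + e * frob (y - x) - mu <= w l y.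
  move=> lN /andP[c1 c2] yr; rewrite /w PsiE.
  have ct : `|clock T N l - t| = clock T N l - t by rewrite ger0_norm // subr_ge0.
  have h1 := jet2 (clock T N l) y (clock_strip T0 N l).
  have c3 : `|clock T N l - t| < r2 by rewrite ct; move: c2 rr2; clear; lra.
  have h2 := h1 c3 (le_lt_trans yr rr2); rewrite ct in h2.
  have := sgv l y lN (ball_rho y yr); rewrite ler_norml => /andP[h3 _].
  by move: h2 h3; clear; lra.
have [iN i1 i2] := index_atP T0 N0 tTT.
have xr : frob x <= rho by apply: ball_rho; rewrite subrr frob0 ltW.
have start : w (index_at T N t) x <= 3 * mu.
  set l0 := index_at T N t; have cE := clockE T0 N0 iN.
  have c1 : 0 <= clock T N l0 - t by rewrite cE; move: i1; clear; lra.
  have c2 : clock T N l0 - t <= tstep T N by rewrite cE; move: i2; rewrite -/l0; clear; lra.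
  have ct : `|clock T N l0 - t| <= r4 by rewrite ger0_norm //; exact: le_trans dtr4.
  have h0 : frob (x - x) <= r4 by rewrite subrr frob0 ltW.
  have : `|sg * (v i (clock T N l0, x) - v i (t, x))| <= mu.
    by rewrite normrM nsg mul1r; exact: (H4 _ _ _ _ (clock_strip T0 N l0) tTT xr xr ct h0 i).
  rewrite mulrBr ler_norml => /andP[_ h1].
  have := sgv l0 x iN xr; rewrite ler_norml => /andP[_ h2].
  have PE : Psi (clock T N l0) x = sg * v i (t, x) + pt * (clock T N l0 - t).
    by rewrite /Psi /paraboloid subrr mulmx0 !dotv0r mulr0 !addr0.
  have h3 : - (pt * (clock T N l0 - t)) <= mu.
    apply: le_trans (ler_norm _) _; rewrite normrN normrM (ger0_norm c1) mulrC.
    by apply: (le_trans _ a2M); rewrite ler_wpM2r //; exact: le_trans c2 dta2.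
  rewrite /w PE; move: h1 h2 h3; clear; lra.
have gap0 : 0 < tstep T N * eps by rewrite mulr_gt0.
have gapmu : tstep T N * eps <= mu.
  by apply: le_trans a3M; rewrite ler_wpM2r // ltW.
have [l [y [I0 [lN c12 y4 wl HI]]]] :=
  almost_minimum T0 N0 t0 r_gt0 rT dtr e0 mu0 mur gap0 gapmu low start.
have yr : frob (y - x) <= r by apply: le_trans y4 _; move: r_gt0; clear; lra.
have /andP[c1 c2] := c12.
have cabs : `|clock T N l.+1 - t| <= r.
  by rewrite ger0_norm ?subr_ge0 //; move: c2; clear; lra.
have sc := schN l y lN (le_trans cabs rr0) (le_trans yr rr0).
have wfl := wf _ (clock_strip T0 N l.+1).
have next_close z : frob (next (coef_at b sigma f g (clock T N l.+1)) (tstep T N) y z - y) <= r / 4.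
  rewrite /next addrAC subrr add0r.
  have yC : C * (1 + frob y) <= C * (1 + rho) by rewrite ler_wpM2l // lerD2l ball_rho.
  have dt01 : 0 <= tstep T N <= 1 by rewrite (ltW dt0).
  apply: le_trans (frob_incr z dt01 (le_trans (wf_drift wfl y) yC) (le_trans (wf_vol wfl y) yC)) _.
  by apply: le_trans a1M; rewrite ler_wpM2r.
have HI' z : I0 <= sg * u N l i (next (coef_at b sigma f g (clock T N l.+1)) (tstep T N) y z)
   - paraboloid (sg * v i (t, x)) pt (sg *: q) Mh t x (clock T N l.+1 + tstep T N)
       (next (coef_at b sigma f g (clock T N l.+1)) (tstep T N) y z).
  by rewrite -clockS //; exact: (HI _ (next_close z)).
have pre_le : sg * pre (coef_at b sigma f g (clock T N l.+1)) (tstep T N) (u N l) i y <=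
    paraboloid (sg * v i (t, x)) pt (sg *: q) Mh t x (clock T N l.+1) y + I0 + tstep T N * eps.
  by move: sc wl; rewrite /w /Psi; clear; lra.
have := discrete_touch d0 C0 dt0 tC wfl sg2 MhT HI' pre_le.
have Yclose j : `|(\col_j u N l j y) j 0 - (\col_j v j (t, x)) j 0| <= r1.
  rewrite !mxE.
  have h1 := v1N l (ltnW lN) j y (ball_rho y yr).
  have ct : `|clock T N l - t| <= r3.
    rewrite (clockS T0 N0 lN) ger0_norm; move: c1 c2 dtr dt0 rr3 r_gt0; clear; lra.
  have yr3 : frob (y - x) <= r3 by move: yr rr3 r30; clear; lra.
  have h2 := H3 _ _ _ _ (clock_strip T0 N l) tTT (ball_rho y yr) xr ct yr3 j.
  have := ler_distD (v j (clock T N l, y)) (u N l j y) (v j (t, x)).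
  by move: h1 h2 mur1; clear; lra.
have dtabs : `|tstep T N| <= r1 by rewrite gtr0_norm //; move: dtr rr1 r10 r_gt0; clear; lra.
have cabs1 : `|clock T N l.+1 - t| <= r1 by move: cabs rr1 r10; clear; lra.
have yr1 : frob (y - x) <= r1 by move: yr rr1 r10; clear; lra.
have := H1 _ _ _ _ (clock_strip T0 N l.+1) cabs1 yr1 Yclose dtabs.
move: base eps0; rewrite /coef_at /=.
set o1 := sg * _; set o2 := sg * _.
clear; lra.
Unshelve. all: by end_near. Qed.

(** * From pointwise assumptions to uniform moduli and common growth *)

Section Conversions.
Context {R : realType} {k : nat}.

Lemma min_positive (J : finType) (r : J -> R) : (forall j, 0 < r j) ->
  exists2 r0 : R, 0 < r0 & forall j, r0 <= r j.
Proof.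
move=> rp; exists (\big[Num.min/1]_j r j); last by move=> j; exact: bigmin_le_cond.
exact: lt_bigmin.
Qed.

Lemma equicontinuous_fin (T : R) (J : finType) (A : J -> Type)
    (F : forall j, A j -> R * 'cV[R]_k -> R) :
  (forall j, equicontinuous_strip T (F j)) ->
  equicontinuous_strip T (fun ja : {j : J & A j} => F (projT1 ja) (projT2 ja)).
Proof.
move=> H t x tT e e0.
have [r rp Hr] := fin_all_exists2 (fun j => H j t x tT e e0).
have [r0 r00 r0r] := min_positive rp.
exists r0 => // t' x' t'T tr xr [j a] /=.
by apply: Hr => //; apply: lt_le_trans (r0r j).
Qed.

Lemma equicontinuous_reindex (T : R) (J J' : Type) (F : J -> R * 'cV[R]_k -> R)
    (F' : J' -> R * 'cV[R]_k -> R) :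
  equicontinuous_strip T F -> (forall j', exists j, F' j' = F j) -> equicontinuous_strip T F'.
Proof.
move=> H HF t x tT e e0; have [r r0 Hr] := H t x tT e e0.
exists r => // t' x' t'T tr xr j'; have [j ->] := HF j'; exact: Hr.
Qed.

Lemma within_continuousP (T : R) (phi : R * 'cV[R]_k -> R) :
  {within strip T, continuous phi} <-> equicontinuous_strip T (fun _ : unit => phi).
Proof.
split.
  move/subspace_continuousP => H t x tT e e0.
  have tx : strip T (t, x) by rewrite /strip /setX /= in_itv.
  have /cvgrPdist_le/(_ _ e0) := H (t, x) tx.
  case/near_stripP => r r0 Hr; exists r => // t' x' t'T tr xr _.
  by rewrite distrC; exact: Hr.
move=> H; apply/subspace_continuousP => -[t x] [/= tT _].
rewrite in_itv /= in tT.
apply/cvgrPdist_le => e e0; apply/near_stripP; have [r r0 Hr] := H t x tT e e0.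
by exists r => // t' x' t'T tr xr; rewrite distrC; exact: (Hr _ _ t'T tr xr tt).
Qed.

Lemma within_continuous_coord (T : R) a b (phi : R * 'cV[R]_k -> 'M[R]_(a, b)) :
  {within strip T, continuous phi} ->
  equicontinuous_strip T (fun (ij : 'I_a * 'I_b) tx => phi tx ij.1 ij.2).
Proof.
move=> H.
have Hij (ij : 'I_a * 'I_b) : equicontinuous_strip T (fun _ : unit => fun tx => phi tx ij.1 ij.2).
  apply/within_continuousP; apply/subspace_continuousP => tx txT.
  move/subspace_continuousP : H => /(_ tx txT) H.
  exact: (continuous_cvg _ (@coord_continuous R a b ij.1 ij.2 _) H).
apply: (equicontinuous_reindex (equicontinuous_fin Hij)) => ij.
by exists (existT _ ij tt).
Qed.

Lemma enorm_powR_le (x : 'cV[R]_k) (gam : R) (p : nat) : 0 <= gam -> gam <= p%:R ->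
  enorm x `^ gam <= poly p x.
Proof.
move=> g0 gp; have e0 := enorm_ge0 x.
have [e1|e1] := leP (enorm x) 1.
  apply: le_trans (poly_ge1 _ _); have -> : (1 : R) = 1 `^ gam by rewrite powR1.
  by apply: ge0_ler_powR; rewrite ?nnegrE.
apply: (le_trans (ler_powR (ltW e1) gp)); rewrite powR_mulrn //.
rewrite lerXn2r ?nnegrE ?addr_ge0 ?frob_ge0 // -enorm_sqr.
have := sqr_ge0 (enorm x - 1); lra.
Qed.

Lemma poly_le_powR (p : nat) : exists2 C : R, 0 <= C &
  forall x : 'cV[R]_k, poly p x <= C * (1 + enorm x `^ (p + p)%:R).
Proof.
exists (2 ^+ p); first exact: exprn_ge0.
move=> x; have e0 := enorm_ge0 x; rewrite powR_mulrn // addnn -muln2 mulnC exprM enorm_sqr.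
have f0 := frob_ge0 x.
have [f1|f1] := leP (frob x) 1.
  apply: (le_trans (y := 2 ^+ p * 1)).
    by rewrite mulr1 lerXn2r ?nnegrE ?addr_ge0 //; lra.
  by rewrite ler_wpM2l ?exprn_ge0 // lerDl exprn_ge0.
apply: (le_trans (y := 2 ^+ p * frob x ^+ p)).
  by rewrite -exprMn lerXn2r ?nnegrE ?addr_ge0 ?mulr_ge0 //; lra.
by rewrite ler_wpM2l ?exprn_ge0 // lerDr.
Qed.

Lemma poly_mono p p' (x : 'cV[R]_k) : (p <= p')%N -> poly p x <= poly p' x.
Proof. by move=> pp; rewrite /poly ler_weXn2l // lerDl frob_ge0. Qed.

(** Finitely many bounds with real exponents become one with a natural exponent. The parameters [A],
    [D] and [X] cover functions on the strip and functions of [x] alone. *)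
Lemma common_growth (J : finType) (A : J -> Type) (D : forall j, A j -> Prop)
    (F : forall j, A j -> R) (X : forall j, A j -> 'cV[R]_k) :
  (forall j, exists C gam : R, [/\ 0 <= C, 0 <= gam &
     forall a, D j a -> `|F j a| <= C * (1 + enorm (X j a) `^ gam)]) ->
  exists (C : R) (p : nat), 0 <= C /\ forall j a, D j a -> `|F j a| <= C * poly p (X j a).
Proof.
move=> H.
have H' j : exists Cp : R * nat, 0 <= Cp.1 /\ forall a, D j a -> `|F j a| <= Cp.1 * poly Cp.2 (X j a).
  have [C [gam [C0 g0 Hj]]] := H j; exists (2 * C, (Num.truncn gam).+1); split; first by rewrite mulr_ge0.
  move=> a Da; apply: le_trans (Hj a Da) _ => /=.
  have gp : gam <= (Num.truncn gam).+1%:R by have /andP[_ /ltW] := truncn_itv g0.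
  have h1 := enorm_powR_le (X j a) g0 gp; have h2 := poly_ge1 (Num.truncn gam).+1 (X j a).
  have -> : 2 * C * poly (Num.truncn gam).+1 (X j a) = C * (2 * poly (Num.truncn gam).+1 (X j a)) by ring.
  by rewrite ler_wpM2l //; lra.
have [Cp HCp] := fin_all_exists H'.
exists (\sum_j (Cp j).1), (\max_j (Cp j).2)%N; split.
  by apply: sumr_ge0 => j _; exact: (HCp j).1.
move=> j a Da; apply: le_trans ((HCp j).2 a Da) _.
apply: ler_pM; [exact: (HCp j).1 | exact: ltW (poly_gt0 _ _) | | ].
  by rewrite (bigD1 j) //= lerDl sumr_ge0 // => l _; exact: (HCp l).1.
by apply: poly_mono; exact: leq_bigmax.
Qed.

End Conversions.

(** * The limit solves the system *)

Section LimitSolution.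
Context {R : realType}.
Variables (T : R) (k d m : nat) (b : R * 'cV[R]_k -> 'cV[R]_k)
  (sigma : R * 'cV[R]_k -> 'M[R]_(k, d))
  (f : 'I_m -> R * 'cV[R]_k -> 'cV[R]_m -> 'cV[R]_d -> R)
  (g : 'I_m -> 'I_m -> R * 'cV[R]_k -> R) (h : 'I_m -> 'cV[R]_k -> R) (C : R) (p : nat).
Hypotheses (T0 : 0 < T) (d0 : (0 < d)%N) (C1 : 1 <= C)
  (b_growth : forall t x, 0 <= t <= T -> frob (b (t, x)) <= C * (1 + frob x))
  (s_growth : forall t x, 0 <= t <= T -> frob (sigma (t, x)) <= C * (1 + frob x))
  (f_growth : forall i t x, 0 <= t <= T -> `|f i (t, x) 0 0| <= C * poly p x)
  (f_lip : forall i t x y z y' z', 0 <= t <= T -> `|f i (t, x) y z - f i (t, x) y' z'|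
     <= C * (\sum_j `|y j 0 - y' j 0| + enorm (z - z')))
  (b_cont : equicontinuous_strip T (fun i tx => b tx i 0))
  (s_cont : equicontinuous_strip T (fun ij tx => sigma tx ij.1 ij.2))
  (f_cont : equicontinuous_strip T (fun iyz tx => f iyz.1.1 tx iyz.1.2 iyz.2))
  (g_cont : equicontinuous_strip T (fun (ij : 'I_m * 'I_m) tx =>
      if ij.1 != ij.2 then g ij.1 ij.2 tx else 0))
  (g_ge0 : forall i j t x, i != j -> 0 <= t <= T -> 0 <= g i j (t, x)).

Let C0 : 0 <= C := le_trans ler01 C1.

Variables (U : set_system nat) (v : 'I_m -> R * 'cV[R]_k -> R) (B : R) (PU : ProperFilter U)
  (ooU : \oo `<=` U).
Local Notation u := (disc T b sigma f g h).
Hypotheses (v_lim : forall rho eps : R, 0 < eps -> \forall N \near U, forall l, (l <= N)%N ->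
        forall i x, frob x <= rho -> `|u N l i x - v i (clock T N l, x)| <= eps)
  (v_unif : forall rho eps : R, 0 <= rho -> 0 < eps -> exists2 r : R, 0 < r & forall t t' x x',
        0 <= t <= T -> 0 <= t' <= T -> frob x <= rho -> frob x' <= rho -> `|t - t'| <= r ->
        frob (x - x') <= r -> forall i, `|v i (t, x) - v i (t', x')| <= eps)
  (v_end : forall i x, v i (T, x) = h i x) (B1 : 1 <= B)
  (u_bound : \forall N \near \oo, forall l, (l <= N)%N -> forall i x, `|u N l i x| <= B * poly p x).

Let near_oo (P : nat -> Prop) : (\forall N \near \oo, P N) -> \forall N \near U, P N.
Proof. exact: ooU. Qed.

Let near_small (a : R) : 0 < a -> \forall N \near U, tstep T N <= a.
Proof.
by move=> a0; apply: near_oo; apply: filterS (near_tstep T0 a0) => K /andP[].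
Qed.

Let wf t : 0 <= t <= T -> wf_coef C p (coef_at b sigma f g t).
Proof. exact: (wf_coef_at b_growth s_growth f_growth f_lip g_ge0). Qed.

Ltac clear_local := clear - R T k d m b sigma f g h C p T0 d0 C1 b_growth s_growth f_growth f_lip
  b_cont s_cont f_cont g_cont g_ge0 C0 U v B PU ooU v_lim v_unif v_end B1 u_bound near_oo near_small wf.

Lemma limit_equicontinuous : equicontinuous_strip T v.
Proof.
move=> t x tT e e0; have fx := frob_ge0 x.
have rho0 : 0 <= 2 * frob x + 2 by lra.
have [r r0 Hr] := v_unif rho0 e0.
exists (Num.min r 1); first by rewrite lt_min r0 ltr01.
move=> t' x' t'T; rewrite !lt_min => /andP[tr _] /andP[xr x1] i.
apply: Hr => //; try exact: ltW; last by lra.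
by have := frobD_le (x' - x) x; rewrite subrK; lra.
Qed.

(** The discrete gradient [Z] may be unbounded in [dt], but [dt * enorm Z] is of order [sqrt dt],
    since [zvec_bessel] bounds [dt * frob Z] by a variance. *)
Lemma pre_close (rho eps : R) : 0 <= rho -> 0 < eps -> \forall N \near U, forall l y j, (l < N)%N ->
  frob y <= rho ->
  `|pre (coef_at b sigma f g (clock T N l.+1)) (tstep T N) (u N l) j y - v j (clock T N l.+1, y)| <= eps.
Proof.
move=> rho0 eps0.
pose S := (2 + 2 * d%:R) * (C * (1 + rho)).
have S0 : 0 <= S by rewrite /S !mulr_ge0 ?addr_ge0 // mulr_ge0.
pose rho2 := 2 * rho + 2 * S.
have rho2_ge : rho <= rho2 by rewrite /rho2; lra.
have rho20 : 0 <= rho2 := le_trans rho0 rho2_ge.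
have e4 : 0 < eps / 4 by rewrite divr_gt0.
have [r r0 Hr] := v_unif rho20 e4.
have B0 : 0 <= B := le_trans ler01 B1.
pose V := B * (1 + rho2) ^+ p.
have V0 : 0 <= V by rewrite /V mulr_ge0 // exprn_ge0 // addr_ge0.
pose Bf := C * (1 + rho2) ^+ p + C * m%:R * V.
have Bf0 : 0 <= Bf by rewrite /Bf addr_ge0 ?mulr_ge0 // exprn_ge0 // addr_ge0.
have [a1 /andP[a10 _] a1M] := small_factor S0 r0.
have [a2 /andP[a20 _] a2M] := small_factor Bf0 e4.
have C_gt0 : 0 < C by exact: lt_le_trans C1.
pose e' := eps / (4 * C).
have e'0 : 0 < e' by rewrite divr_gt0 // mulr_gt0.
have V40 : 0 <= 4 * V ^+ 2 by rewrite mulr_ge0 ?sqr_ge0.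
have e'20 : 0 < e' ^+ 2 by rewrite exprn_gt0.
have [a3 /andP[a30 _] a3M] := small_factor V40 e'20.
near=> N.
have [t01 tC _ N0] : [/\ 0 < tstep T N <= 1, tstep T N * d%:R * C ^+ 2 <= 1,
    8 * tstep T N * C ^+ 2 <= 1 & (0 < N)%N] by near: N; apply: near_oo; exact: near_tstep_small.
have /andP[dt0 dt1] := t01.
have dta1 : tstep T N <= a1 by near: N; exact: near_small.
have dta2 : tstep T N <= a2 by near: N; exact: near_small.
have dta3 : tstep T N <= a3 by near: N; exact: near_small.
have dtr : tstep T N <= r by near: N; exact: near_small.
have vN : forall l, (l <= N)%N -> forall i x, frob x <= rho2 ->
    `|u N l i x - v i (clock T N l, x)| <= eps / 4 by near: N; exact: v_lim.
have uN : forall l, (l <= N)%N -> forall i x, `|u N l i x| <= B * poly p x.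
  by near: N; exact: near_oo.
move=> l y j lN yr.
have uV i z : frob z <= rho2 -> `|u N l i z| <= V.
  move=> zr; apply: le_trans (uN l (ltnW lN) i z) _.
  have one_z : 0 <= 1 + frob z by rewrite addr_ge0 // frob_ge0.
  have one_r : 0 <= 1 + rho2 := addr_ge0 ler01 rho20.
  by apply: ler_wpM2l => //; apply: lerXn2r; rewrite ?nnegrE // lerD2l.
set c := coef_at b sigma f g (clock T N l.+1); set dt := tstep T N in t01 tC dt0 dt1 dta1 dta2 dta3 dtr *.
have wfc : wf_coef C p c by apply: wf; exact: clock_strip.
have dt01 : 0 <= dt <= 1 by rewrite (ltW dt0).
have nr w : frob (next c dt y w) <= rho2 by exact: (next_frob w wfc C0 dt01 yr).
have ny w : frob (next c dt y w - y) <= r.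
  rewrite /next addrAC subrr add0r.
  have yC : C * (1 + frob y) <= C * (1 + rho) by rewrite ler_wpM2l // lerD2l.
  apply: le_trans (frob_incr w dt01 (le_trans (wf_drift wfc y) yC) (le_trans (wf_vol wfc y) yC)) _.
  by apply: (le_trans _ a1M); rewrite ler_wpM2r.
set vj := v j (clock T N l.+1, y).
pose phi w := u N l j (next c dt y w).
have phiv w : `|phi w - vj| <= eps / 2.
  have h1 := vN l (ltnW lN) j _ (nr w).
  have ct : `|clock T N l - clock T N l.+1| <= r.
    by rewrite (clockS T0 N0 lN) addrAC subrr add0r gtr0_norm.
  have h2 := Hr _ _ _ _ (clock_strip T0 N l) (clock_strip T0 N l.+1) (nr w) (le_trans yr rho2_ge) ct (ny w) j.
  have := ler_distD (v j (clock T N l, next c dt y w)) (phi w) vj.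
  move: h1 h2; clear_local => h1 h2; rewrite /phi /vj; lra.
have h_mean : `|mean phi - vj| <= eps / 2.
  rewrite -[vj](mean_cst d0) -meanB ler_norml -(mean_cst d0 (- (eps / 2))) -{2}(mean_cst d0 (eps / 2)).
  by apply/andP; split; apply: mean_le => w; have := phiv w; rewrite ler_norml => /andP[].
set Z := slope c dt (u N l) j y.
have z0 : 0 <= enorm Z by exact: enorm_ge0.
have dtz0 : 0 <= dt * enorm Z := mulr_ge0 (ltW dt0) z0.
have dtz : dt * enorm Z <= e'.
  rewrite -(ler_pXn2r (n := 2)) ?nnegrE ?(ltW e'0) ?dtz0 //.
  apply: (le_trans _ a3M); rewrite exprMn enorm_sqr expr2 -mulrA.
  apply: ler_pM => //; [exact: ltW | by rewrite mulr_ge0 ?frob_ge0 // ltW |].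
  apply: le_trans (zvec_bessel d0 phi dt0) _.
  rewrite -[leRHS](mean_cst d0); apply: mean_le => w.
  have mV : `|mean phi| <= V.
    rewrite ler_norml -(mean_cst d0 (- V)) -{2}(mean_cst d0 V).
    by apply/andP; split; apply: mean_le => w'; have := uV j _ (nr w'); rewrite ler_norml => /andP[].
  have pV := uV j _ (nr w); rewrite -/(phi w) in pV.
  have -> : 4 * V ^+ 2 = (2 * V) ^+ 2 by ring.
  have key : `|phi w - mean phi| <= 2 * V by apply: (le_trans (ler_normB _ _)); move: mV pV; clear_local; lra.
  rewrite -(real_normK (num_real (phi w - mean phi))).
  by apply: lerXn2r; rewrite ?nnegrE // mulr_ge0.
have hgen : `|genu c dt (u N l) j y| <= Bf + C * enorm Z.
  apply: le_trans (gen_le _ _ _ _ wfc) _; rewrite mulrDr addrA lerD2r /Bf -mulrA -mulrDr -mulrDr ler_wpM2l //.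
  apply: lerD.
    have one_y : 0 <= 1 + frob y by rewrite addr_ge0 // frob_ge0.
    have one_r : 0 <= 1 + rho2 := addr_ge0 ler01 rho20.
    by apply: lerXn2r; rewrite ?nnegrE // lerD2l; exact: (le_trans yr rho2_ge).
  apply: (le_trans (y := \sum_(i < m) V)); last by rewrite sumr_const card_ord mulr_natl.
  by apply: ler_sum => i _; rewrite mxE; apply: uV; exact: (le_trans yr rho2_ge).
have hdt : `|dt * genu c dt (u N l) j y| <= eps / 2.
  rewrite normrM (gtr0_norm dt0).
  have h1 := ler_wpM2l (ltW dt0) hgen.
  have h2 : dt * Bf <= eps / 4 by apply: (le_trans _ a2M); rewrite ler_wpM2r.
  have h3 : C * (dt * enorm Z) <= C * e' := ler_wpM2l C0 dtz.
  have h4 : C * e' = eps / 4 by rewrite /e'; field; rewrite gt_eqF.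
  move: h1 h2 h3 h4; clear_local => h1 h2 h3 h4; move: (`|genu _ _ _ _ _|) h1 => z h1; lra.
rewrite /pre -/phi; have := ler_normD (mean phi - vj) (dt * genu c dt (u N l) j y).
have -> : mean phi - vj + dt * genu c dt (u N l) j y = mean phi + dt * genu c dt (u N l) j y - vj by ring.
move: hdt h_mean; clear_local; lra.
Unshelve. all: by end_near. Qed.

Lemma limit_obstacle i j t x : j != i -> 0 <= t < T -> v j (t, x) - g i j (t, x) <= v i (t, x).
Proof.
move=> ji /andP[t0 tT]; apply/ler_addgt0Pr => e e0.
have tTT : 0 <= t <= T by rewrite t0 ltW.
have e5 : 0 < e / 5 by rewrite divr_gt0.
have [r r0 Hr] := limit_equicontinuous x tTT e5.
have [r' r'0 Hr'] := g_cont x tTT e5.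
have Tt : 0 < T - t by rewrite subr_gt0.
near U => N.
have N0 : (0 < N)%N by near: N; apply: near_oo; exact: nbhs_infty_gt.
have dtT : tstep T N <= T - t by near: N; exact: near_small.
have dtr : tstep T N <= r / 2 by near: N; apply: near_small; rewrite divr_gt0.
have dtr' : tstep T N <= r' / 2 by near: N; apply: near_small; rewrite divr_gt0.
have vN : forall l, (l <= N)%N -> forall i y, frob y <= frob x ->
    `|u N l i y - v i (clock T N l, y)| <= e / 5 by near: N; exact: v_lim.
have pN : forall l y j, (l < N)%N -> frob y <= frob x ->
  `|pre (coef_at b sigma f g (clock T N l.+1)) (tstep T N) (u N l) j y - v j (clock T N l.+1, y)| <= e / 5.
  by near: N; apply: pre_close => //; exact: frob_ge0.
have [iN i1 i2] := index_atP T0 N0 tTT.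
have dt0 := tstep_gt0 T0 N0.
(* Index 0 would mean [T - t < dt]. So at least one step has been made, and its maximum includes the
   branch [j]. *)
move: iN i1 i2; case: (index_at T N t) => [|l] iN i1 i2.
  by move: i2; rewrite mul0r add0r => /lt_le_trans/(_ dtT); rewrite ltxx.
have cE := clockE T0 N0 iN.
have c0 : frob (x - x) < r by rewrite subrr frob0.
have c0' : frob (x - x) < r' by rewrite subrr frob0.
have c1 : `|clock T N l.+1 - t| <= tstep T N by rewrite cE ler_norml; move: i1 i2 dt0; clear_local => i1 i2 dt0; apply/andP; split; lra.
have c1r : `|clock T N l.+1 - t| < r by move: c1 dtr (r0); clear_local; lra.
have c1r' : `|clock T N l.+1 - t| < r' by move: c1 dtr' (r'0); clear_local; lra.
have h1 := vN l.+1 iN i x (lexx _).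
have h2 := pN l x j iN (lexx _).
have h3 := Hr _ _ (clock_strip T0 N l.+1) c1r c0 i.
have h4 := Hr _ _ (clock_strip T0 N l.+1) c1r c0 j.
have h5 := Hr' _ _ (clock_strip T0 N l.+1) c1r' c0' (i, j); rewrite /= eq_sym ji in h5.
have h6 : pre (coef_at b sigma f g (clock T N l.+1)) (tstep T N) (u N l) j x - g i j (clock T N l.+1, x) <= u N l.+1 i x.
  exact: (step_ge_switch (coef_at b sigma f g (clock T N l.+1)) (tstep T N) (u N l) x ji).
move: h1 h2 h3 h4 h5 h6 (e0); clear_local => + + + + + h6 e00.
rewrite !ler_norml => /andP[? ?] /andP[? ?] /andP[? ?] /andP[? ?] /andP[? ?].
lra.
Unshelve. all: by end_near. Qed.

(** A switch of the scheme nearby would bring the obstacle within five errors of [mu / 6] of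
    [v i (t, x)], whereas it lies at least [mu] below. *)
Lemma continuation_scheme i t x : 0 <= t < T ->
  (forall j, j != i -> v j (t, x) - g i j (t, x) < v i (t, x)) ->
  exists2 r : R, 0 < r & \forall N \near U, forall l y, (l < N)%N -> `|clock T N l.+1 - t| <= r ->
     frob (y - x) <= r -> u N l.+1 i y =
        pre (coef_at b sigma f g (clock T N l.+1)) (tstep T N) (u N l) i y.
Proof.
move=> /andP[t0 tT] gap.
have tTT : 0 <= t <= T by rewrite t0 ltW.
have gap' j : 0 < (if j != i then v i (t, x) - (v j (t, x) - g i j (t, x)) else 1).
  by case: ifP => // ji; rewrite subr_gt0 gap.
have [mu mu0 Hmu] := min_positive gap'.
have m6 : 0 < mu / 6 by rewrite divr_gt0.
have [r r0 Hr] := limit_equicontinuous x tTT m6.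
have [r' r'0 Hr'] := g_cont x tTT m6.
pose r1 := Num.min 1 (Num.min (r / 2) (r' / 2)).
have [r11 r1r r1r'] : [/\ r1 <= 1, r1 < r & r1 < r'].
  have q1 : r1 <= 1 by rewrite /r1 ge_min lexx.
  have q2 : r1 <= r / 2 by rewrite /r1 !ge_min lexx orbT.
  have q3 : r1 <= r' / 2 by rewrite /r1 !ge_min lexx !orbT.
  by split; lra.
exists r1; first by rewrite /r1 !lt_min ltr01 !divr_gt0.
pose rho := 2 * frob x + 2.
have rho0 : 0 <= rho by rewrite /rho addr_ge0 // mulr_ge0 // frob_ge0.
near=> N.
have vN : forall l, (l <= N)%N -> forall i y, frob y <= rho ->
    `|u N l i y - v i (clock T N l, y)| <= mu / 6 by near: N; exact: v_lim.
have pN : forall l y j, (l < N)%N -> frob y <= rho ->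
  `|pre (coef_at b sigma f g (clock T N l.+1)) (tstep T N) (u N l) j y - v j (clock T N l.+1, y)| <= mu / 6.
  by near: N; exact: pre_close.
move=> l y lN ct yx.
have yr : frob y <= rho by have := frobD_le (y - x) x; rewrite subrK /rho; lra.
have E : u N l.+1 i y = step (coef_at b sigma f g (clock T N l.+1)) (tstep T N) (u N l) i y by [].
case: (step_cases (coef_at b sigma f g (clock T N l.+1)) (tstep T N) (u N l) i y) => [<- //|[j ji]].
move=> Ej; exfalso.
have ctr := le_lt_trans ct r1r; have ctr' := le_lt_trans ct r1r'.
have yxr := le_lt_trans yx r1r; have yxr' := le_lt_trans yx r1r'.
have h1 := vN l.+1 lN i y yr.
have h2 := pN l y j lN yr.
have h3 := Hr _ _ (clock_strip T0 N l.+1) ctr yxr i.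
have h4 := Hr _ _ (clock_strip T0 N l.+1) ctr yxr j.
have h5 := Hr' _ _ (clock_strip T0 N l.+1) ctr' yxr' (i, j); rewrite /= eq_sym ji in h5.
have h6 := Hmu j; rewrite ji in h6.
move: h1; rewrite E Ej /= => h1.
move: h1 h2 h3 h4 h5 h6 (mu0); clear_local => + + + + + h6 mu00.
rewrite !ler_norml => /andP[? ?] /andP[? ?] /andP[? ?] /andP[? ?] /andP[? ?].
lra.
Unshelve. all: by end_near. Qed.

Let limit_touch sg t i (x q : 'cV[R]_k) M pp :=
  @viscosity_touch R T k d m b sigma f g C p (disc T b sigma f g h) U v sg t pp i x q M
    T0 d0 C1 wf b_cont s_cont f_cont PU ooU v_lim v_unif.

(** A step is at least its own branch wherever the obstacle stands: this is the scheme inequality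
    for [sg = 1]. *)
Lemma subjet_operator i t x pp q (M : 'M[R]_k) : 0 <= t < T -> subjet T (v i) t x pp q M ->
  0 <= operator (b (t, x)) (sigma (t, x)) (f i (t, x) (\col_j v j (t, x))) pp q M.
Proof.
move=> tT [_ MT J]; rewrite -[operator _ _ _ _ _ _]mul1r.
apply: limit_touch => //; [by left | |].
  move=> e e0; have /near_stripP[r r0 Hr] := J e e0; exists r => // t' x' t'T tr xr.
  by have := Hr t' x' t'T tr xr; rewrite /= enorm_sqr !mul1r.
exists 1 => //; near=> N => l y lN _ _; rewrite mul1r subr_ge0.
exact: (step_ge_pre (coef_at b sigma f g (clock T N l.+1)) (tstep T N) (u N l)).
Unshelve. all: by end_near. Qed.

Lemma superjet_operator i t x pp q (M : 'M[R]_k) : 0 <= t < T -> superjet T (v i) t x pp q M ->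
  (forall j, j != i -> v j (t, x) - g i j (t, x) < v i (t, x)) ->
  0 <= -1 * operator (b (t, x)) (sigma (t, x)) (f i (t, x) (\col_j v j (t, x))) pp q M.
Proof.
move=> tT [_ MT J] gap.
apply: limit_touch => //; [by right | |].
  move=> e e0; have /near_stripP[r r0 Hr] := J e e0; exists r => // t' x' t'T tr xr.
  by have := Hr t' x' t'T tr xr; rewrite /= enorm_sqr; lra.
have [r r0 Hr] := continuation_scheme tT gap.
exists r => //; apply: filterS Hr => N Hr l y lN ct yx.
by rewrite Hr // subrr mulr0.
Qed.

(** The operator is continuous along the sequence defining the limiting jet. The inequality is asked
    only near [(t, x)] and before [T], because for superjets it holds in the continuation region
    only. *)
Lemma limiting_operator (J : R -> 'cV[R]_k -> R -> 'cV[R]_k -> 'M[R]_k -> Prop) (sg : R) i t x pp q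
    (M : 'M[R]_k) : 0 <= t < T -> limiting_jet (v i) J t x pp q M ->
  (forall t x pp q M, J t x pp q M -> 0 <= t <= T) ->
  (exists2 r : R, 0 < r & forall t' x' pp q M, 0 <= t' < T -> `|t' - t| < r -> frob (x' - x) < r ->
     J t' x' pp q M ->
     0 <= sg * operator (b (t', x')) (sigma (t', x')) (f i (t', x') (\col_j v j (t', x'))) pp q M) ->
  0 <= sg * operator (b (t, x)) (sigma (t, x)) (f i (t, x) (\col_j v j (t, x))) pp q M.
Proof.
move=> /andP[t0 tT] [t_ [x_ [p_ [q_ [M_ [HJ [[ct cx _] [cp cq cM]]]]]]]] JT [r r0 Hr].
have tTT : 0 <= t <= T by rewrite t0 ltW.
have tnT n : 0 <= t_ n <= T by exact: JT (HJ n).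
have cx' : ccvg (F := \oo) x_ x by move=> a a'; exact: (continuous_cvg _ (@coord_continuous R k 1 a a' _) cx).
have cq' : ccvg (F := \oo) q_ q by move=> a a'; exact: (continuous_cvg _ (@coord_continuous R k 1 a a' _) cq).
have cM' : ccvg (F := \oo) M_ M by move=> a a'; exact: (continuous_cvg _ (@coord_continuous R k k a a' _) cM).
have frob_cvg : frob (x_ n - x) @[n --> \oo] --> (0 : R).
  rewrite -(frob0 k 1) -(subrr x) -dotvv; under eq_fun do rewrite -dotvv.
  by apply: cvg_dotv; apply: ccvgD => //; exact: ccvg_cst.
have close (e : R) : 0 < e -> \forall n \near \oo, `|t_ n - t| < e /\ frob (x_ n - x) < e.
  move=> e0; have e2 : 0 < e / 2 by rewrite divr_gt0.
  have ee : e / 2 < e by lra.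
  move/cvgrPdist_le/(_ _ e2) : ct => ct; move/cvgrPdist_le/(_ _ e2) : frob_cvg => fc.
  apply: filterS2 ct fc => n h1 h2; split.
    by rewrite distrC; exact: le_lt_trans ee.
  by rewrite sub0r normrN in h2; apply: le_lt_trans (le_trans (ler_norm _) h2) ee.
have cY : ccvg (F := \oo) (fun n => \col_j v j (t_ n, x_ n)) (\col_j v j (t, x)).
  move=> a a'; rewrite mxE; under eq_fun do rewrite mxE.
  apply/cvgrPdist_le => e e0; have [s s0 Hs] := limit_equicontinuous x tTT e0.
  by apply: filterS (close s s0) => n [h1 h2]; rewrite distrC; exact: Hs.
have ntT : \forall n \near \oo, 0 <= t_ n <= T by near=> n; exact: tnT.
have FFo : Filter (\oo : set_system nat) by exact _.
have Hop := operator_cvg_strip C0 f_lip b_cont s_cont f_cont FFo (i := i) tTT ntT ct cx' cY cp cq' cM'.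
rewrite leNgt; apply/negP => neg.
pose e := - (sg * operator (b (t, x)) (sigma (t, x)) (f i (t, x) (\col_j v j (t, x))) pp q M) / 2.
have e0 : 0 < e by rewrite divr_gt0 // oppr_gt0.
have mul_sg (A : nat -> R) (l : R) : A z @[z --> \oo] --> l -> sg * A z @[z --> \oo] --> sg * l.
  by move=> H; apply: cvgM => //; exact: cvg_cst.
have := mul_sg _ _ Hop; move/cvgrPdist_le/(_ _ e0) => Hop'.
have Tt : 0 < T - t by rewrite subr_gt0.
near \oo => n.
have h1 : `|sg * operator (b (t, x)) (sigma (t, x)) (f i (t, x) (\col_j v j (t, x))) pp q M -
   sg * operator (b (t_ n, x_ n)) (sigma (t_ n, x_ n)) (f i (t_ n, x_ n) (\col_j v j (t_ n, x_ n)))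
      (p_ n) (q_ n) (M_ n)| <= e by near: n; exact: Hop'.
have [h2 h3] : `|t_ n - t| < r /\ frob (x_ n - x) < r by near: n; exact: (close _ r0).
have [h4 _] : `|t_ n - t| < T - t /\ frob (x_ n - x) < T - t by near: n; exact: (close _ Tt).
have h5 : 0 <= t_ n < T.
  have /andP[-> _] := tnT n; have := le_lt_trans (ler_norm _) h4; lra.
have := Hr _ _ _ _ _ h5 h2 h3 (HJ n).
move: h1; rewrite ler_norml => /andP[h1 _]; move: h1 e0; rewrite /e.
move: (sg * _) (sg * _) => o1 o2; lra.
Unshelve. all: by end_near. Qed.

Lemma limit_continuous i : {within strip T, continuous (v i)}.
Proof.
apply/within_continuousP; apply: (equicontinuous_reindex limit_equicontinuous) => _.
by exists i.
Qed.

Lemma limit_semicontinuous (sg : R) i : lsc_strip T (fun tx => sg * v i tx).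
Proof.
have cv : continuous ((fun tx => sg * v i tx) : subspace (@strip R k T) -> R).
  by move=> tx; apply: cvgM; [exact: cvg_cst | exact: (@limit_continuous i tx)].
move=> tx a; rewrite lte_fin => H.
exists [set ty : subspace (@strip R k T) | a < sg * v i ty]; last by move=> ty; rewrite lte_fin.
exact: (cvgr_gt _ (cv tx) _ H).
Qed.

Lemma limit_supersolution : viscosity_supersolution T b sigma f g h v.
Proof.
split.
- move=> i; have := @limit_semicontinuous 1 i.
  by congr (lsc_strip T _); apply/funext => tx; rewrite mul1r.
- move=> i t x pp q M tT J; rewrite /system_lhs le_min; apply/andP; split.
    rewrite sube_ge0 //; last by rewrite orbC.
    rewrite /obstacle; elim/big_rec: _ => [|j y ji H]; first exact: leNye.
    by rewrite ge_max H andbT lee_fin limit_obstacle.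
  rewrite lee_fin -/(operator _ _ _ _ _ _) -[leRHS]mul1r.
  apply: (limiting_operator tT J) => [? ? ? ? ? [] //|].
  exists 1 => // t' x' pp' q' M' t'T _ _ J'; rewrite mul1r; exact: subjet_operator J'.
- by move=> i x; rewrite v_end.
Qed.

Lemma limit_subsolution : viscosity_subsolution T b sigma f g h v.
Proof.
split.
- move=> i; have := @limit_semicontinuous (-1) i.
  by congr (lsc_strip T _); apply/funext => tx; rewrite mulN1r.
- move=> i t x pp q M tT J; rewrite /system_lhs ge_min.
  have [ob|ob] := leP (v i (t, x))%:E (obstacle i (fun j => v j (t, x)) (fun j => g i j (t, x))).
    by rewrite sube_le0 ob.
  apply/orP; right; rewrite lee_fin -/(operator _ _ _ _ _ _) -oppr_ge0 -mulN1r.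
  apply: (limiting_operator tT J) => [? ? ? ? ? [] //|].
  (* The strict inequality with the obstacle persists around [(t, x)] with a margin, so jets at
     nearby points are covered as well. *)
  have gap j : j != i -> v j (t, x) - g i j (t, x) < v i (t, x).
    move=> ji; rewrite -lte_fin; apply: le_lt_trans ob.
    exact: (le_bigmax_cond _ (fun j => (v j (t, x) - g i j (t, x))%:E)).
  have /andP[t0 tlt] := tT; have tTT : 0 <= t <= T by rewrite t0 ltW.
  have gap' j : 0 < (if j != i then v i (t, x) - (v j (t, x) - g i j (t, x)) else 1).
    by case: ifP => // ji; rewrite subr_gt0 gap.
  have [mu mu0 Hmu] := min_positive gap'.
  have m4 : 0 < mu / 4 by rewrite divr_gt0.
  have [r r0 Hr] := limit_equicontinuous x tTT m4.
  have [r' r'0 Hr'] := g_cont x tTT m4.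
  exists (Num.min r r'); first by rewrite lt_min r0.
  move=> t' x' pp' q' M' t'T; rewrite !lt_min => /andP[tr tr'] /andP[xr xr'] J'.
  apply: superjet_operator J' _ => // j ji.
  have /andP[t'0 t'lt] := t'T; have t'TT : 0 <= t' <= T by rewrite t'0 ltW.
  have h1 := Hr _ _ t'TT tr xr i; have h2 := Hr _ _ t'TT tr xr j.
  have h3 := Hr' _ _ t'TT tr' xr' (i, j); rewrite /= eq_sym ji in h3.
  have h4 := Hmu j; rewrite ji in h4.
  move: h1 h2 h3; rewrite !ler_norml => /andP[? ?] /andP[? ?] /andP[? ?]; lra.
- by move=> i x; rewrite v_end.
Qed.

End LimitSolution.

Theorem theorem7 (R : realType) (T : R) (k d m : nat)
  (b : R * 'cV[R]_k -> 'cV[R]_k) (sigma : R * 'cV[R]_k -> 'M[R]_(k, d))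
  (f : 'I_m -> R * 'cV[R]_k -> 'cV[R]_m -> 'cV[R]_d -> R)
  (g : 'I_m -> 'I_m -> R * 'cV[R]_k -> R)
  (h : 'I_m -> 'cV[R]_k -> R) :
  0 < T -> (0 < k)%N -> (0 < d)%N -> (0 < m)%N ->
  {within strip T, continuous b} ->
  {within strip T, continuous sigma} ->
  (exists C : R, [/\ 0 <= C,
     forall t x, 0 <= t <= T ->
       enorm (b (t, x)) + enorm (sigma (t, x)) <= C * (1 + enorm x) &
     forall t x x', 0 <= t <= T ->
       enorm (b (t, x) - b (t, x')) + enorm (sigma (t, x) - sigma (t, x'))
         <= C * enorm (x - x')]) ->
  (forall i tx, strip T tx -> forall e : R, 0 < e ->
     \forall tx' \near within (strip T) (nbhs tx),
       forall (y : 'cV[R]_m) (z : 'cV[R]_d), `|f i tx' y z - f i tx y z| <= e) ->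
  (forall i, exists2 C : R, 0 <= C &
     forall tx (y y' : 'cV[R]_m) (z z' : 'cV[R]_d), strip T tx ->
       `|f i tx y z - f i tx y' z'|
         <= C * (\sum_j `|y j 0 - y' j 0| + enorm (z - z'))) ->
  (forall i, borel_measurable_strip T (fun tx => f i tx 0 0) /\
             poly_growth_strip T (fun tx => f i tx 0 0)) ->
  (forall i l : 'I_m, l != i ->
     forall tx (y y' : 'cV[R]_m) (z : 'cV[R]_d), strip T tx ->
     (forall j, j != l -> y j 0 = y' j 0) -> y l 0 <= y' l 0 ->
     - f i tx y z <= - f i tx y' z) ->
  (forall i j : 'I_m, i != j ->
     [/\ {within strip T, continuous (g i j)},
         forall tx, strip T tx -> 0 <= g i j tx &
         poly_growth_strip T (g i j)]) ->
  no_free_loop T g ->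
  (forall i, continuous (h i) /\ poly_growth (h i)) ->
  (forall i x,
     (obstacle i (fun j => h j x) (fun j => g i j (T, x)) <= (h i x)%:E)%E) ->
  exists v : 'I_m -> R * 'cV[R]_k -> R,
    viscosity_solution T b sigma f g h v /\
    (forall i, poly_growth_strip T (v i)).
Proof.
move=> T0 _ d0 _ cb cs [C0 [C00 growth lip]] fcont flip fgrow _ gcond g_loop hcond hobs.
have [Cf Cf0 Hf] := fin_all_exists2 flip.
have [Cg [pg [Cg0 Hg]]] := @common_growth R k 'I_m (fun=> (R * 'cV[R]_k)%type)
  (fun _ a => 0 <= a.1 <= T) (fun j a => f j a 0 0) (fun _ a => a.2)
  ltac:(move=> j; have [_ [c [gam [c0 gam0 H]]]] := fgrow j; exists c, gam; split => // -[t x];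
    exact: H).
have [Ch [ph [Ch0 Hh]]] := @common_growth R k 'I_m (fun=> 'cV[R]_k)
  (fun _ _ => True) (fun j a => h j a) (fun _ a => a)
  ltac:(move=> j; have [_ [c [gam [c0 gam0 H]]]] := hcond j; exists c, gam; split => // x _;
    exact: H).
(* The term [2 * C0 ^+ 2] comes from squaring: for the growth conditions through
   [(1 + r)^2 <= 2 * (1 + r^2)], for the Lipschitz conditions through the factor 2 demanded in
   [b_lip] and [s_lip]. *)
pose p := maxn pg ph; pose C := 1 + 2 * C0 ^+ 2 + (\sum_i Cf i) + Cg + Ch.
have S0 : 0 <= \sum_i Cf i by apply: sumr_ge0.
have C02 : 0 <= C0 ^+ 2 by exact: sqr_ge0.
have C1 : 1 <= C by rewrite /C; lra.
have CC0 : 2 * C0 ^+ 2 <= C by rewrite /C; lra.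
have CCg : Cg <= C by rewrite /C; lra.
have CCh : Ch <= C by rewrite /C; lra.
have CCf i : Cf i <= C.
  have : Cf i <= \sum_i Cf i by rewrite (bigD1 i) //= lerDl sumr_ge0.
  rewrite /C; lra.
clearbody C.
have sq_growth a a' (A : 'M[R]_(a, a')) (x : 'cV[R]_k) : enorm A <= C0 * (1 + enorm x) ->
    frob A <= C * (1 + frob x).
  move=> Ax; rewrite -!enorm_sqr.
  apply: (le_trans (y := (C0 * (1 + enorm x)) ^+ 2)).
    by rewrite lerXn2r ?nnegrE ?enorm_ge0 // mulr_ge0 // addr_ge0 // enorm_ge0.
  apply: (le_trans (y := 2 * C0 ^+ 2 * (1 + enorm x ^+ 2))).
    rewrite exprMn; have h1 : (1 + enorm x) ^+ 2 <= 2 * (1 + enorm x ^+ 2).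
      by have := sqr_ge0 (1 - enorm x); lra.
    by have := ler_wpM2l C02 h1; lra.
  by rewrite ler_wpM2r // addr_ge0 // sqr_ge0.
have sq_lip a a' (A : 'M[R]_(a, a')) (x : 'cV[R]_k) : enorm A <= C0 * enorm x ->
    2 * frob A <= C * frob x.
  move=> Ax; rewrite -!enorm_sqr.
  have h1 : enorm A ^+ 2 <= (C0 * enorm x) ^+ 2.
    by rewrite lerXn2r ?nnegrE ?enorm_ge0 // mulr_ge0 // enorm_ge0.
  rewrite exprMn in h1.
  have := ler_wpM2r (sqr_ge0 (enorm x)) CC0; lra.
have b_growth t x : 0 <= t <= T -> frob (b (t, x)) <= C * (1 + frob x).
  by move=> tT; apply: sq_growth; have := growth t x tT; have := enorm_ge0 (sigma (t, x)); lra.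
have s_growth t x : 0 <= t <= T -> frob (sigma (t, x)) <= C * (1 + frob x).
  by move=> tT; apply: sq_growth; have := growth t x tT; have := enorm_ge0 (b (t, x)); lra.
have b_lip t x x' : 0 <= t <= T -> 2 * frob (b (t, x) - b (t, x')) <= C * frob (x - x').
  move=> tT; apply: sq_lip; have := lip t x x' tT.
  by have := enorm_ge0 (sigma (t, x) - sigma (t, x')); lra.
have s_lip t x x' : 0 <= t <= T -> 2 * frob (sigma (t, x) - sigma (t, x')) <= C * frob (x - x').
  move=> tT; apply: sq_lip; have := lip t x x' tT.
  by have := enorm_ge0 (b (t, x) - b (t, x')); lra.
have stripE t x : 0 <= t <= T -> strip T (t, x : 'cV[R]_k).
  by move=> tT; rewrite /strip /setX /= in_itv.
have f_growth i t x : 0 <= t <= T -> `|f i (t, x) 0 0| <= C * poly p x.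
  move=> tT; apply: le_trans (Hg i (t, x) tT) _; apply: ler_pM => //.
    exact: ltW (poly_gt0 _ _).
  by apply: poly_mono; exact: leq_maxl.
have f_lip i t x y z y' z' : 0 <= t <= T -> `|f i (t, x) y z - f i (t, x) y' z'|
     <= C * (\sum_j `|y j 0 - y' j 0| + enorm (z - z')).
  move=> tT; apply: le_trans (Hf i (t, x) y y' z z' (stripE _ _ tT)) _.
  by rewrite ler_wpM2r // addr_ge0 ?enorm_ge0 // sumr_ge0.
have h_growth i x : `|h i x| <= C * poly p x.
  apply: le_trans (Hh i x I) _; apply: ler_pM => //.
    exact: ltW (poly_gt0 _ _).
  by apply: poly_mono; exact: leq_maxr.
have b_cont : equicontinuous_strip T (fun i tx => b tx i 0).
  by apply: (equicontinuous_reindex (within_continuous_coord cb)) => i; exists (i, 0).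
have s_cont := within_continuous_coord cs.
have f_cont : equicontinuous_strip T (fun iyz tx => f iyz.1.1 tx iyz.1.2 iyz.2).
  have Hfi (i : 'I_m) : equicontinuous_strip T
      (fun (yz : 'cV[R]_m * 'cV[R]_d) tx => f i tx yz.1 yz.2).
    move=> t x tT e e0.
    have /near_stripP[r r0 Hr] := fcont i (t, x) (stripE _ _ tT) e e0.
    by exists r => // t' x' t'T tr xr [y z]; exact: Hr.
  apply: (equicontinuous_reindex (equicontinuous_fin Hfi)) => -[[i y] z].
  by exists (existT _ i (y, z)).
have h_cont : equicontinuous_strip T (fun i tx => h i tx.2).
  have Hhi (i : 'I_m) : equicontinuous_strip T (fun (_ : unit) (tx : R * 'cV[R]_k) => h i tx.2).
    apply/within_continuousP; apply: continuous_subspaceT => tx.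
    by apply: continuous_comp; [exact: cvg_snd | exact: (hcond i).1].
  apply: (equicontinuous_reindex (equicontinuous_fin Hhi)) => i.
  by exists (existT _ i tt).
have g_cont : equicontinuous_strip T (fun (ij : 'I_m * 'I_m) tx =>
      if ij.1 != ij.2 then g ij.1 ij.2 tx else 0).
  have Hgij (ij : 'I_m * 'I_m) : equicontinuous_strip T (fun (_ : unit) (tx : R * 'cV[R]_k) =>
      if ij.1 != ij.2 then g ij.1 ij.2 tx else 0).
    case: (ij.1 =P ij.2) => [_|/eqP ij12]; last by apply/within_continuousP; case: (gcond _ _ ij12).
    by move=> t x tT e e0; exists 1 => // *; rewrite subrr normr0 ltW.
  apply: (equicontinuous_reindex (equicontinuous_fin Hgij)) => ij.
  by exists (existT _ ij tt).
have g_ge0 i j t x : i != j -> 0 <= t <= T -> 0 <= g i j (t, x).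
  by move=> ij tT; case: (gcond i j ij) => _ H _; apply: H; exact: stripE.
have h_obs i j x : j != i -> h j x - g i j (T, x) <= h i x.
  move=> ji; rewrite -lee_fin; apply: le_trans (hobs i x).
  exact: (le_bigmax_cond _ (fun j => (h j x - g i j (T, x))%:E)).
have [B B1 u_bound] := disc_bound T0 d0 C1 b_growth s_growth f_growth f_lip h_growth g_ge0.
have u_equi := disc_equicontinuous T0 d0 C1 b_growth s_growth b_lip s_lip f_growth f_lip h_growth
  b_cont s_cont f_cont h_cont g_cont g_ge0 g_loop h_obs.
have [U [v [PU [ooU [v_lim v_unif v_bound v_end]]]]] :=
  limit_exists (u := fun N => disc T b sigma f g h N) (h := h) T0 (fun _ _ _ => erefl) u_bound u_equi.
exists v; split.
  split.
  - by move=> i; apply: (limit_continuous v_unif).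
  - exact: (limit_supersolution T0 d0 C1 b_growth s_growth f_growth f_lip b_cont s_cont f_cont g_cont
      g_ge0 PU ooU v_lim v_unif v_end B1 u_bound).
  - exact: (limit_subsolution T0 d0 C1 b_growth s_growth f_growth f_lip b_cont s_cont f_cont g_cont
      g_ge0 PU ooU v_lim v_unif v_end B1 u_bound).
move=> i; have [D D0 HD] := @poly_le_powR R k p.
exists (B * D), (p + p)%:R; split => //; first by rewrite mulr_ge0 // (le_trans ler01).
move=> t x tT; apply: le_trans (v_bound i t x tT) _.
by rewrite -mulrA ler_wpM2l // (le_trans ler01).
Qed.
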